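(* Suppose there are two different symmetries with center at $x$ on a torsion-free $|1|$-graded parabolic geometry. Let $\Upsilon=[\![u,Z]\!]$ be their difference at $x$, for some $Z\in\mathfrak g_1$ and some $u$ in the fiber of $\mathcal G$ over $x$. Suppose there exists $X\in\mathfrak g_{-1}$ such that the adjoint action of $[X,Z]$ on $\mathfrak g_{-1}$ is diagonalizable with eigenvalues $a_1,\dots,a_k$ such that $a_{i_1}+a_{i_2}+a_{i_3}-a_{i_4}\neq0$ for every choice of indices $i_1,i_2,i_3,i_4\in\{1,\dots,k\}$. Then the Weyl curvature $W$ vanishes at $x$, and thus the whole curvature $\kappa$ vanishes at $x$.
   Context: A $|1|$-graded semisimple Lie algebra is a real semisimple Lie algebra $\mathfrak g=\mathfrak g_{-1}\oplus\mathfrak g_0\oplus\mathfrak g_1$ with $[\mathfrak g_i,\mathfrak g_j]\subset\mathfrak g_{i+j}$ (where $\mathfrak g_r=0$ for $|r|>1$) such that no simple ideal of $\mathfrak g$ is contained in $\mathfrak g_0$. Put $\mathfrak g^i=\bigoplus_{j\ge i}\mathfrak g_j$ and $\mathfrak p=\mathfrak g^0$. $G$ is a Lie group with Lie algebra $\mathfrak g$; $P$ is a subgroup lying between $\{g\in G:\mathrm{Ad}_g(\mathfrak g^i)\subset\mathfrak g^i\ \forall i\}$ and its identity component; $G_0=\{g\in P:\mathrm{Ad}_g(\mathfrak g_i)\subset\mathfrak g_i\ \forall i\}$, so $P=G_0\ltimes\exp\mathfrak g_1$. A $|1|$-graded parabolic geometry of type $(G,P)$ on a smooth manifold $M$ is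 a principal $P$-bundle $p:\mathcal G\to M$ with a Cartan connection $\omega\in\Omega^1(\mathcal G,\mathfrak g)$: $(r^h)^*\omega=\mathrm{Ad}_{h^{-1}}\circ\omega$ for $h\in P$, $\omega(\zeta_X)=X$ for fundamental vector fields $\zeta_X$, $X\in\mathfrak p$, and $\omega(u):T_u\mathcal G\to\mathfrak g$ is a linear isomorphism for each $u$. A (locally defined) automorphism is a principal bundle isomorphism $\varphi:p^{-1}(U)\to p^{-1}(V)$ with $\varphi^*\omega=\omega$; its base map is $\underline\varphi:U\to V$. A (local) symmetry with center at $x$ is a locally defined diffeomorphism $s_x$ on $M$, defined near $x$, with $s_x(x)=x$, $T_xs_x=-\mathrm{id}_{T_xM}$, which near $x$ equals $\underline\varphi$ for some automorphism $\varphi$ ($\varphi$ covers $s_x$). Two symmetries at $x$ are different if they do not agree on any neighborhood of $x$. Weyl structures: $p_0:\mathcal G_0=\mathcal G/\exp\mathfrak g_1\to M$ is a principal $G_0$-bundle, $\pi:\mathcal G\to\mathcal G_0$ the projection. A Weyl structure is a smooth $G_0$-equivariant section $\sigma$ of $\pi$. For two Weyl structures $\hat\sigma(v)=\sigma(v)\exp\Upsilon(v)$ for a unique $G_0$-equivariant $\Upsilon:\mathcal G_0\to\mathfrak g_1$; write $\hat\sigma=\sigma+\Upsilon$. $\Upsilon$ extends to a $P$-equivariant map on $\mathcal G$, i.e. a 1-form on $M$, section of $T^*M\simeq\mathcal G\times_P\mathfrak g_1$; $[\![u,Z]\!]$ denotes the element of this associated bundle represented by $(u,Z)$. Pullback: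 $\varphi^*\sigma=\varphi^{-1}\circ\sigma\circ\varphi_0$, with $\varphi_0$ induced by $\varphi$ on $\mathcal G_0$. Difference: for two different symmetries at $x$ covered by $\varphi$ and $\psi$, choose a Weyl structure $\sigma$ with $\varphi^*\sigma=\sigma$ on $p_0^{-1}(x)$ (it exists and is unique along this fiber) and define $\Upsilon$ by $\psi^*\sigma=\sigma+\Upsilon$. The value of $\Upsilon$ at $x$ is independent of the choices of coverings and is nonzero; it is called the difference between the symmetries (the order of the two symmetries plays no role). Curvature: with $\omega^{-1}(X)$ the vector field on $\mathcal G$ satisfying $\omega(\omega^{-1}(X))=X$, $\kappa(u)(X,Y)=[X,Y]-\omega([\omega^{-1}(X),\omega^{-1}(Y)](u))$, $X,Y\in\mathfrak g_{-1}$; $\kappa_j$ is its $\mathfrak g_j$-valued component. Torsion free means $\kappa_{-1}=0$. For a torsion-free geometry the Weyl curvature is $W=\kappa_0\circ\sigma:\mathcal G_0\to\wedge^2\mathfrak g_{-1}^*\otimes\mathfrak g_0$, independent of the Weyl structure $\sigma$. ''$\kappa$ vanishes at $x$'' means $\kappa(u)=0$ for all $u\in p^{-1}(x)$. *)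

(* Defs.v *)
From HB Require Import structures.
From mathcomp Require Import all_boot all_order all_algebra.
From mathcomp Require Import all_classical all_reals all_analysis.

Set Implicit Arguments.
Unset Strict Implicit.
Unset Printing Implicit Defensive.

Import Order.TTheory GRing.Theory Num.Theory.
Import numFieldNormedType.Exports.

Local Open Scope classical_set_scope.
Local Open Scope ring_scope.

Section Smooth.
Context {R : realType} {V W : normedModType R}.

(* For finite-dimensional [V] and open [U] this is the usual class C^k(U). *)
Fixpoint Ck (k : nat) (U : set V) (f : V -> W) : Prop :=
  if k is k'.+1 then
    (forall x, U x -> differentiable f x) /\ (forall v, Ck k' U ('D_v f))
  else forall x, U x -> {for x, continuous f}.

Definition smooth_at (f : V -> W) (x : V) : Prop :=
  exists2 U, open_nbhs x U & forall k, Ck k U f.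

End Smooth.

(* Partially defined bijections; the values of [pfwd] and [pbwd] outside [psrc]
   and [ptgt] are irrelevant. *)
Record partial_map (A B : Type) := PartialMap {
  psrc : set A;
  ptgt : set B;
  pfwd :> A -> B;
  pbwd : B -> A
}.

Definition pbijective (A B : Type) (f : partial_map A B) : Prop :=
  [/\ forall a, psrc f a -> ptgt f (f a),
      forall b, ptgt f b -> psrc f (pbwd f b),
      forall a, psrc f a -> pbwd f (f a) = a
    & forall b, ptgt f b -> f (pbwd f b) = b].

Definition phomeomorphism (A B : topologicalType) (f : partial_map A B) : Prop :=
  [/\ pbijective f, open (psrc f), open (ptgt f),
      forall a, psrc f a -> {for a, continuous f}
    & forall b, ptgt f b -> {for b, continuous (pbwd f)}].

(* The atlas is the range of [chart_at], which moreover selects a preferred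
   chart around each point. *)
HB.mixin Record isManifold (R : realType) (n : nat) M of Topological M := {
  chart_at : M -> partial_map M 'rV[R]_n;
  chart_at_homeo : forall x, phomeomorphism (chart_at x);
  chart_at_src : forall x, psrc (chart_at x) x;
  chart_at_smooth : forall x y z,
    psrc (chart_at x) z -> psrc (chart_at y) z ->
    smooth_at (chart_at y \o pbwd (chart_at x)) (chart_at x z);
  manifold_hausdorff : hausdorff_space M;
  manifold_second_countable : @second_countable M
}.

#[short(type="manifoldType")]
HB.structure Definition Manifold (R : realType) (n : nat) :=
  {M of isManifold R n M & Topological M}.

Section Manifolds.
Context {R : realType} {n m l : nat}.
Context {M : manifoldType R n} {N : manifoldType R m} {L : manifoldType R l}.

Definition msmooth_at (f : M -> N) (x : M) : Prop :=
  {for x, continuous f} /\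
  smooth_at (chart_at (f x) \o f \o pbwd (chart_at x)) (chart_at x x).

(* Smoothness at [(x, y)] as a map on the product manifold. *)
Definition msmooth2_at (f : M -> N -> L) (x : M) (y : N) : Prop :=
  {for (x, y), continuous (fun z : M * N => f z.1 z.2)} /\
  smooth_at (fun z : 'rV[R]_n * 'rV[R]_m =>
               chart_at (f x y) (f (pbwd (chart_at x) z.1)
                                   (pbwd (chart_at y) z.2)))
            (chart_at x x, chart_at y y).

Definition csmooth_at (c : R -> M) (t : R) : Prop :=
  {for t, continuous c} /\ smooth_at (chart_at (c t) \o c) t.

(* T_xM is represented by 'rV_n, through the coordinates of the preferred
   chart [chart_at x]; [mdiff f x] is the tangent map T_xM -> T_(f x)N. *)
Definition mdiff (f : M -> N) (x : M) : 'rV[R]_n -> 'rV[R]_m :=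
  'd (chart_at (f x) \o f \o pbwd (chart_at x)) (chart_at x x).

Definition velocity (c : R -> M) (t : R) : 'rV[R]_n :=
  derive1 (chart_at (c t) \o c) t.

End Manifolds.

Definition pdiffeomorphism (R : realType) (n m : nat)
    (M : manifoldType R n) (N : manifoldType R m) (f : partial_map M N) : Prop :=
  [/\ pbijective f, open (psrc f), open (ptgt f),
      forall x, psrc f x -> msmooth_at f x
    & forall y, ptgt f y -> msmooth_at (pbwd f) y].

Section VectorFields.
Context {R : realType} {n : nat} {M : manifoldType R n}.
Implicit Types xi eta : M -> 'rV[R]_n.

(* The coordinate expression of the vector field [xi] in the chart [c]. *)
Definition vf_coord (c : partial_map M 'rV[R]_n) xi (y : 'rV[R]_n) : 'rV[R]_n :=
  let z := pbwd c y in
  'd (c \o pbwd (chart_at z)) (chart_at z z) (xi z).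

Definition vf_bracket xi eta (x : M) : 'rV[R]_n :=
  let c := chart_at x in
  'D_(vf_coord c xi (c x)) (vf_coord c eta) (c x)
  - 'D_(vf_coord c eta (c x)) (vf_coord c xi) (c x).

(* Smoothness of a vector-valued 1-form: all its pullbacks [(c^-1)^* omega]
   to coordinate domains have smooth components. *)
Definition smooth_form (V : vectType R) (omega : M -> 'rV[R]_n -> V) : Prop :=
  forall (x z : M) (v : 'rV[R]_n) (j : 'I_(\dim {:V})),
  psrc (chart_at x) z ->
  smooth_at (fun y : 'rV[R]_n => let w := pbwd (chart_at x) y in
               coord (vbasis {:V}) j
                 (omega w ('d (chart_at w \o pbwd (chart_at x)) y v)) : R)
            (chart_at x z).

End VectorFields.

HB.mixin Record isLieAlgebra (K : fieldType) g of Vector K g := {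
  lie : g -> g -> g;
  lie_linearl : forall y, linear (lie^~ y);
  lie_linearr : forall x, linear (lie x);
  liexx : forall x, lie x x = 0;
  lie_jacobi : forall x y z,
    lie x (lie y z) + lie y (lie z x) + lie z (lie x y) = 0
}.

#[short(type="lieAlgType")]
HB.structure Definition LieAlgebra (K : fieldType) :=
  {g of isLieAlgebra K g & Vector K g}.

Section LieAlgebras.
Context {K : fieldType} {g : lieAlgType K}.
Implicit Types U V I J : {vspace g}.

Definition lie_prod U V : {vspace g} :=
  <<[seq lie x y | x <- vbasis U, y <- vbasis V]>>%VS.

Definition lie_ideal I : Prop := forall x y : g, y \in I -> lie x y \in I.

Definition lie_solvable I : Prop :=
  exists n, iter n (fun U => lie_prod U U) I = 0%VS.

Definition lie_semisimple : Prop :=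
  forall I, lie_ideal I -> lie_solvable I -> I = 0%VS.

Definition lie_simple_ideal I : Prop :=
  [/\ lie_ideal I, lie_prod I I <> 0%VS
    & forall J, (J <= I)%VS ->
        (forall x y : g, x \in I -> y \in J -> lie x y \in J) ->
        J = 0%VS \/ J = I].

(* ad(A) maps [U] to itself and is diagonalizable there, with eigenvalues
   [a] listed with multiplicity. *)
Definition ad_diagonalizable (A : g) U k (a : k.-tuple K) : Prop :=
  exists2 b : k.-tuple g, basis_of U b &
    forall i : 'I_k, lie A (tnth b i) = tnth a i *: tnth b i.

End LieAlgebras.

Arguments lie_semisimple {K} g.

(* |1|-gradings; semisimplicity of [g] and the condition that no simple ideal
   lies in g_0 are part of the structure. *)
Record onegrading (K : fieldType) (g : lieAlgType K) := OneGrading {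
  gr :> int -> {vspace g};
  gr_out : forall i : int, 1 < `|i| -> gr i = 0%VS;
  gr_full : (gr (-1) + gr 0 + gr 1)%VS = fullv;
  gr_direct : directv (gr (-1) + gr 0 + gr 1);
  gr_lie : forall (i j : int) (x y : g),
    x \in gr i -> y \in gr j -> lie x y \in gr (i + j);
  gr_semisimple : lie_semisimple g;
  gr_effective : forall I, lie_simple_ideal I -> ~ (I <= gr 0)%VS
}.

Section Grading.
Context {K : fieldType} {g : lieAlgType K} (gr : onegrading g).

Definition filt (i : int) : {vspace g} :=
  (\sum_(j <- ([:: -1; 0; 1] : seq int)%R | (i <= j)%R) gr j)%VS.

Definition gr_comp (i : int) : g -> g :=
  daddv_pi (gr i) (\sum_(j <- ([:: -1; 0; 1] : seq int)%R | j != i) gr j)%VS.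

End Grading.

HB.mixin Record isLieGroup (R : realType) (n : nat) G
    of Manifold R n G & Group G := {
  mul_smooth : forall a b : G, msmooth2_at (fun a b : G => (a * b)%g) a b;
  inv_smooth : forall a : G, msmooth_at (fun a : G => a^-1%g) a
}.

#[short(type="lieGroupType")]
HB.structure Definition LieGroup (R : realType) (n : nat) :=
  {G of isLieGroup R n G & Manifold R n G & Group G}.

Section LieGroupLieAlgebra.
Context {R : realType} {n : nat} (G : lieGroupType R n).

Definition left_invariant (a : 'rV[R]_n) (x : G) : 'rV[R]_n :=
  mdiff (fun y : G => (x * y)%g) 1%g a.

Definition lieg_bracket (a b : 'rV[R]_n) : 'rV[R]_n :=
  vf_bracket (left_invariant a) (left_invariant b) 1%g.

(* An identification of [g] with the Lie algebra T_1 G of [G]. *)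
Record lie_algebra_of (g : lieAlgType R) := LieAlgebraOf {
  lieG : {linear 'rV[R]_n -> g};
  lieGV : g -> 'rV[R]_n;
  lieGK : cancel lieG lieGV;
  lieGVK : cancel lieGV lieG;
  lieG_bracket : forall a b, lieG (lieg_bracket a b) = lie (lieG a) (lieG b)
}.

Definition Ad (g : lieAlgType R) (L : lie_algebra_of g) (a : G) (x : g) : g :=
  lieG L (mdiff (fun b : G => (a * b * a^-1)%g) 1%g (lieGV L x)).

Definition filtration_stabilizer (g : lieAlgType R) (L : lie_algebra_of g)
    (gr : onegrading g) : set G :=
  [set a | forall (i : int) x, x \in filt gr i -> Ad L a x \in filt gr i].

(* [P], included by [incl], is an embedded Lie subgroup with Lie algebra
   p = g^0, lying between the stabilizer of the filtration and the identity
   component of that stabilizer. The embedded Lie group structure is the one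
   every such (automatically closed) subgroup carries. *)
Record parabolic_subgroup (g : lieAlgType R) (L : lie_algebra_of g)
    (gr : onegrading g) (k : nat) (P : lieGroupType R k) := ParabolicSubgroup {
  incl : P -> G;
  inclM : {morph incl : a b / (a * b)%g};
  incl_inj : injective incl;
  incl_smooth : forall h, msmooth_at incl h;
  incl_embedding : forall U : set P,
    open U <-> exists2 V : set G, open V & U = incl @^-1` V;
  incl_immersion : injective (mdiff incl 1%g);
  incl_lie : forall x : g,
    x \in filt gr 0 <-> exists b, x = lieG L (mdiff incl 1%g b);
  incl_sub : range incl `<=` filtration_stabilizer L gr;
  incl_sup :
    connected_component (filtration_stabilizer L gr) 1%g `<=` range incl
}.

End LieGroupLieAlgebra.

Section Parabolic.
Context {R : realType} {n k : nat} {G : lieGroupType R n}.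
Context {g : lieAlgType R} {L : lie_algebra_of G g} {gr : onegrading g}.
Context {P : lieGroupType R k} (i : parabolic_subgroup L gr P).

Definition lieP (b : 'rV[R]_k) : g := lieG L (mdiff (incl i) 1%g b).

Definition AdP (h : P) : g -> g := Ad L (incl i h).

Definition levi : set P :=
  [set h | forall (j : int) x, x \in gr j -> AdP h x \in gr j].

(* The graph of exp on p: [expP Z h] says that h = exp(Z), i.e. that h is the
   value at 1 of the one-parameter subgroup with initial velocity Z. *)
Definition expP (Z : g) (h : P) : Prop :=
  exists c : R -> P,
    [/\ forall s t, c (s + t) = (c s * c t)%g,
        forall t, csmooth_at c t,
        lieP (velocity c 0) = Z
      & c 1 = h].

End Parabolic.

Record principal_bundle (R : realType) (k : nat) (P : lieGroupType R k)
    (m N : nat) (M : manifoldType R m) (E : manifoldType R N) :=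
    PrincipalBundle {
  bproj : E -> M;
  bact : E -> P -> E;
  bproj_smooth : forall u, msmooth_at bproj u;
  bact_smooth : forall u h, msmooth2_at bact u h;
  bact1 : forall u, bact u 1%g = u;
  bactM : forall u h h', bact u (h * h')%g = bact (bact u h) h';
  bproj_bact : forall u h, bproj (bact u h) = bproj u;
  (* [theta : U * P -> bproj^-1(U)] is an equivariant diffeomorphism over [U],
     with inverse [(bproj, tau)]. *)
  locally_trivial : forall x : M, exists (U : set M) (tau : E -> P)
      (theta : M -> P -> E),
    [/\ open_nbhs x U,
        forall u, U (bproj u) ->
          msmooth_at tau u /\ theta (bproj u) (tau u) = u,
        forall y h, U y ->
          [/\ msmooth2_at theta y h, bproj (theta y h) = y
            & tau (theta y h) = h]
      & forall u h, U (bproj u) -> tau (bact u h) = (tau u * h)%g]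
}.

Record parabolic_geometry (R : realType) (n : nat) (G : lieGroupType R n)
    (g : lieAlgType R) (L : lie_algebra_of G g) (gr : onegrading g)
    (k : nat) (P : lieGroupType R k) (i : parabolic_subgroup L gr P)
    (m N : nat) (M : manifoldType R m) (E : manifoldType R N) :=
    ParabolicGeometry {
  bundle :> principal_bundle P M E;
  omega : E -> {linear 'rV[R]_N -> g};
  (* [omegaV u X] is the value at [u] of the vector field omega^-1(X). *)
  omegaV : E -> g -> 'rV[R]_N;
  omegaK : forall u, cancel (omega u) (omegaV u);
  omegaVK : forall u, cancel (omegaV u) (omega u);
  omega_smooth : smooth_form (fun u => omega u : 'rV[R]_N -> g);
  omega_equivariant : forall (u : E) (h : P) (v : 'rV[R]_N),
    omega (bact bundle u h) (mdiff (fun w => bact bundle w h) u v)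
    = AdP i h^-1%g (omega u v);
  (* The fundamental vector field of X at u is the tangent map at 1 of
     h |-> u h, applied to X. *)
  omega_fundamental : forall (u : E) (b : 'rV[R]_k),
    omega u (mdiff (bact bundle u) 1%g b) = lieP i b
}.

Section Geometry.
Context {R : realType} {n k m N : nat} {G : lieGroupType R n}.
Context {g : lieAlgType R} {L : lie_algebra_of G g} {gr : onegrading g}.
Context {P : lieGroupType R k} {i : parabolic_subgroup L gr P}.
Context {M : manifoldType R m} {E : manifoldType R N}.
Variable geo : parabolic_geometry i M E.

Local Notation p := (bproj geo).
Local Notation "u ** h" := (bact geo u h) (at level 40, left associativity).

Definition curvature (u : E) (X Y : g) : g :=
  lie X Y - omega geo u (vf_bracket (fun w => omegaV geo w X)
                                    (fun w => omegaV geo w Y) u).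

Definition curvature_comp (j : int) (u : E) (X Y : g) : g :=
  gr_comp gr j (curvature u X Y).

Definition torsion_free : Prop :=
  forall u X Y, X \in gr (-1) -> Y \in gr (-1) ->
    curvature_comp (-1) u X Y = 0.

Definition curvature_vanishes_at (x : M) : Prop :=
  forall u X Y, p u = x -> X \in gr (-1) -> Y \in gr (-1) ->
    curvature u X Y = 0.

Record local_automorphism (U V : set M) (phi : partial_map E E) : Prop := LocalAut {
  laut_openl : open U;
  laut_openr : open V;
  laut_src : psrc phi = p @^-1` U;
  laut_tgt : ptgt phi = p @^-1` V;
  laut_diffeo : pdiffeomorphism phi;
  laut_equivariant : forall u h, U (p u) -> phi (u ** h) = phi u ** h;
  laut_omega : forall u v, U (p u) ->
    omega geo (phi u) (mdiff phi u v) = omega geo u v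
}.

(* Near x, the base map of [phi] is [s]. *)
Definition covers_at (x : M) (phi : partial_map E E) (s : partial_map M M) : Prop :=
  (exists U V, U x /\ local_automorphism U V phi) /\
  \forall y \near x, forall u, p u = y -> p (phi u) = s y.

Record symmetry (x : M) (s : partial_map M M) : Prop := Symmetry {
  sym_diffeo : pdiffeomorphism s;
  sym_src : psrc s x;
  sym_fix : s x = x;
  sym_diff : forall v, mdiff s x v = - v;
  sym_covered : exists phi, covers_at x phi s
}.

Definition different_at (x : M) (s s' : partial_map M M) : Prop :=
  ~ \forall y \near x, s y = s' y.

(* G_0 = G / exp(g_1), as the type of orbits. Only maps out of this bundle
   occur below; a map out of it is smooth for the quotient structure iff its
   composition with the surjective submersion [pi0] is. *)
Definition orbit1 (u : E) : set E :=
  [set w | exists Z h, [/\ Z \in gr 1, expP i Z h & w = u ** h]].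

Definition bundle0 := {v : set E | exists u, v = orbit1 u}.

Definition pi0 (u : E) : bundle0 :=
  exist _ (orbit1 u) (ex_intro _ u erefl).

(* [levi] acts on [bundle0] by (pi0 u) h = pi0 (u h). *)
Record weyl_structure (sigma : bundle0 -> E) : Prop := WeylStructure {
  weyl_section : cancel sigma pi0;
  weyl_equivariant : forall u h, levi i h ->
    sigma (pi0 (u ** h)) = sigma (pi0 u) ** h;
  weyl_smooth : forall u, msmooth_at (sigma \o pi0) u
}.

(* The value of phi^* sigma = phi^-1 \o sigma \o phi_0 at [pi0 u], where
   phi_0 (pi0 u) = pi0 (phi u). *)
Definition weyl_pullback (phi : partial_map E E) (sigma : bundle0 -> E) (u : E) : E :=
  pbwd phi (sigma (pi0 (phi u))).

(* [w] is the value of sigma + Upsilon at [v]. *)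
Definition weyl_shift (sigma : bundle0 -> E) (Upsilon : bundle0 -> g)
    (v : bundle0) (w : E) : Prop :=
  Upsilon v \in gr 1 /\
  exists2 h, expP i (Upsilon v) h & w = sigma v ** h.

Definition weyl_curvature (sigma : bundle0 -> E) (v : bundle0) (X Y : g) : g :=
  curvature_comp 0 (sigma v) X Y.

Definition weyl_curvature_vanishes_at (x : M) : Prop :=
  forall sigma, weyl_structure sigma ->
  forall u X Y, p u = x -> X \in gr (-1) -> Y \in gr (-1) ->
    weyl_curvature sigma (pi0 u) X Y = 0.

(* [[u, Z]], as a point of the associated bundle E x_P g_1: the class of the
   pair (u, Z) under (u, Z) h = (u h, Ad_(h^-1) Z). *)
Definition assoc (u : E) (Z : g) : set (E * g) :=
  [set q | exists h : P, q = (u ** h, AdP i h^-1%g Z)].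

Definition difference (x : M) (s s' : partial_map M M) (D : set (E * g)) : Prop :=
  exists (phi psi : partial_map E E) (sigma : bundle0 -> E) (Upsilon : bundle0 -> g),
    [/\ covers_at x phi s, covers_at x psi s', weyl_structure sigma,
        forall u, p u = x -> weyl_pullback phi sigma u = sigma (pi0 u)
      & (forall u, psrc psi u ->
           weyl_shift sigma Upsilon (pi0 u) (weyl_pullback psi sigma u)) /\
        (forall u, p u = x -> D = assoc u (Upsilon (pi0 u)))].

End Geometry.

(* Main.v *)
(* Let phi and psi cover the two symmetries, with phi(u) = u h and psi(u) = u h'.
   As the base maps have differential - id at x, Ad_h acts by - 1 on g / p = g_(-1);
   a graded automorphism argument with the grading element then shows that it acts by
   + 1 on p / g_1 and by - 1 on g_1.

   The map w |-> phi(w) h^(-1) fixes u and preserves the functions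
   w |-> kappa_0(w)(X, Y), X, Y in g_(-1). Differentiating this at u along omega^(-1)(V),
   V in g_(-1), gives D_V kappa_0 = D_(Ad_h V) kappa_0, that is
   2 D_V kappa_0 = D_(f(V)) kappa_0, where f(V) is the g_0-component of Ad_h V: vertical
   derivatives in the directions of g_1 vanish because the torsion does. For h' the same
   holds, and by the definition of the difference Ad_h' = Ad_h exp(- ad Z), which changes
   f(V) by [Z, V]. Hence D_[Z, V] kappa_0 = 0, that is [V, Z] acts trivially on
   kappa_0(u), for all V in g_(-1). For V = X the eigenvalues of this action on
   (g_(-1)^* )^3 (x) g_(-1), which contains the values of kappa_0, are the numbers
   a_i4 - a_i1 - a_i2 - a_i3, so that kappa_0(u) = 0. Then kappa(u) takes values in g_1,
   where Ad_h is - 1, but kappa(u) is even in its pair of arguments, so kappa(u) = 0.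

   Two ingredients need more than calculus in charts. The grading element comes from
   derivations of g being inner, hence from Cartan's criterion. The one-parameter
   subgroups exp(t Y), Y in g_1, which identify Ad_h' in terms of Z, are the limits of
   gamma(t / m)^m for a curve gamma with initial velocity Y: Ad is an immersion near 1
   because g has trivial center, and Ad(gamma(t / m)^m) tends to the polynomial
   exp(t ad Y). *)

From HB Require Import structures.
From mathcomp Require Import all_boot all_order all_algebra complex.
From mathcomp Require Import all_classical all_reals all_analysis.
From mathcomp Require Import ring lra.
Require Import Defs.

Set Implicit Arguments.
Unset Strict Implicit.
Unset Printing Implicit Defensive.

Import Order.TTheory GRing.Theory Num.Theory.

Local Open Scope ring_scope.

(** * Semisimple Lie algebras *)

(** The two symmetries are compared at [u1 = sigma (pi0 geo u)] instead of u: the class of (u, Z)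
    fixes [Upsilon] at the orbit of u under exp(g_1), and [u1] is the point of this orbit in the
    image of [sigma]. Whether Ad_h preserves the grading is never decided; only the difference of
    the terms f(V) belonging to h and h' enters. Derivatives along the constant fields omega^(-1)(V)
    replace the covariant derivative of a Weyl connection, so no connection is constructed.

    The exponential map is given only as the relation [expP], through one-parameter subgroups of P,
    so its existence on g_1 and the group law of exp(g_1) have to be established. Both are read off
    from Ad, which determines an element of P near 1 but not globally; the group law therefore
    passes through the roots exp(Y / m) for large m, which do lie near 1.

    The rigidity of Ad_h and the eigenvalue argument rest on the faithful action of g_0 on g_(-1).
    This is where the condition on simple ideals enters, and it requires that every nonzero ideal
    contain a simple one. *)

Section GeneralizedEigenvectors.
Import VectorInternalTheory.
Variable C : numClosedFieldType.

(** The characteristic polynomial splits, and the kernels of pairwise coprime polynomials in T add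
    up to the kernel of their product; a multiple of the minimal polynomial has the whole space as
    kernel. *)
Lemma sum_geigenspace n (T : 'M[C]_n) :
  exists m (a : 'I_m -> C), injective a /\
    (\sum_i geigenspace T (a i) :=: 1%:M)%MS.
Proof.
case: n T => [|n] T.
  by exists 0, (fun=> 0); split; [case | apply/eqmxP; rewrite [1%:M]thinmx0 big_ord0 !submx_refl].
have [rs rsE] := closed_field_poly_normal (char_poly T).
move: rsE; rewrite (monicP (char_poly_monic T)) scale1r => rsE.
pose s := undup rs; exists (size s), (fun i : 'I_(size s) => nth 0 s i); split.
  by move=> i j /eqP; rewrite nth_uniq ?undup_uniq// => /eqP/val_inj.
have co : {in xpredT &, forall i j : 'I_(size s), j != i ->
    coprimep (('X - (nth 0 s i)%:P) ^+ n.+1) (('X - (nth 0 s j)%:P) ^+ n.+1)}.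
  move=> i j _ _ nij; rewrite coprimep_expr ?coprimep_expl//.
  by rewrite coprimep_XsubC root_XsubC nth_uniq ?undup_uniq// eq_sym.
apply: eqmx_trans (kermxpoly_min (g := T)
  (p := \prod_(i < size s) ('X - (nth 0 s i)%:P) ^+ n.+1) _).
  by apply: eqmx_sym; apply: kermxpoly_prod.
rewrite (dvdp_trans (mxminpoly_dvd_char T))// rsE.
have size_rs : size rs = n.+1.
  by apply/eqP; rewrite -eqSS -(size_prod_XsubC rs id) -rsE size_char_poly.
have -> : \prod_(i < size s) ('X - (nth 0 s i)%:P) ^+ n.+1
   = \prod_(z <- s) ('X - z%:P) ^+ n.+1.
  by rewrite (big_nth 0) big_mkord.
(* No root occurs more than [n.+1] times, so the common exponent [n.+1] only enlarges the
   product. *)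
rewrite -prodr_undup_exp_count; apply: (big_ind2 (fun p q : {poly C} => p %| q)) => //.
- by move=> p1 p2 q1 q2; apply: dvdp_mul.
- by move=> z _; rewrite dvdp_exp2l// -size_rs count_size.
Qed.

(** Stands in for a basis adapted to the generalized eigenspaces: additive statements need only be
    checked on generalized eigenvectors. *)
Lemma gen_eigen_ind n (T : 'M[C]_n) (P : 'rV[C]_n -> Prop) :
  P 0 -> (forall u v, P u -> P v -> P (u + v)) ->
  (forall mu k u, u *m (T - mu%:M) ^+ k = 0 -> P u) -> forall u, P u.
Proof.
move=> P0 PD Pg u; have [m [a [_ aT]]] := sum_geigenspace T.
have : (u <= \sum_i geigenspace T (a i))%MS by rewrite aT submx1.
move=> /sub_sumsmxP [f ->]; apply: (big_ind P) => // i _.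
case: n T u a aT P P0 PD Pg f => [|n] T u a aT P P0 PD Pg f.
  by rewrite [_ *m _]thinmx0.
apply: (Pg (a i) n.+1); apply/sub_kermxP; rewrite -geigenspaceE.
exact: submxMl.
Qed.

Lemma gen_eigen_uniq n (T : 'M[C]_n) mu nu k l (u : 'rV_n) :
  mu != nu -> u *m (T - mu%:M) ^+ k = 0 -> u *m (T - nu%:M) ^+ l = 0 -> u = 0.
Proof.
case: n T u => [|n] T u; first by rewrite [u]thinmx0.
move=> nmunu u1 u2; apply/eqP; rewrite -submx0.
have co : coprimep (('X - mu%:P) ^+ k) (('X - nu%:P) ^+ l).
  by rewrite coprimep_expr ?coprimep_expl// coprimep_XsubC root_XsubC eq_sym.
rewrite -(mxdirect_kermxpoly T co) sub_capmx.
rewrite /kermxpoly !rmorphXn/= !rmorphB/= !horner_mx_X !horner_mx_C.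
by apply/andP; split; apply/sub_kermxP.
Qed.

Lemma direct_sum_projections (F : fieldType) n m (V : 'I_m -> 'M[F]_n) :
  mxdirect (\sum_i V i) -> exists P : 'I_m -> 'M[F]_n,
    (forall i (u : 'rV_n), (u <= V i)%MS -> u *m P i = u) /\
    (forall i j (u : 'rV_n), j != i -> (u <= V j)%MS -> u *m P i = 0).
Proof.
move=> dV; pose W i := (\sum_(j | j != i) V j)%MS.
have dVW i : (V i :&: W i = 0)%MS by move/mxdirect_sumsP: dV => /(_ i isT).
exists (fun i => proj_mx (V i) (W i)); split=> [i u uV|i j u ji uV].
  by rewrite proj_mx_id.
by rewrite proj_mx_0// /W (sumsmx_sup j).
Qed.

(* D is the complex conjugate of the semisimple part of T, so that tr (D T) is the
   sum of |mu|^2 over the eigenvalues mu of T. *)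
Lemma conj_semisimple_part n (T : 'M[C]_n) : exists D : 'M[C]_n,
  forall mu k (u : 'rV_n), u *m (T - mu%:M) ^+ k = 0 -> u *m D = mu^* *: u.
Proof.
have [m [a [ainj aT]]] := sum_geigenspace T.
have [P [Pid P0]] : exists P : 'I_m -> 'M[C]_n,
    (forall i (u : 'rV_n), (u <= geigenspace T (a i))%MS -> u *m P i = u) /\
    (forall i j (u : 'rV_n), j != i -> (u <= geigenspace T (a j))%MS -> u *m P i = 0).
  by apply: direct_sum_projections; apply: mxdirect_sum_geigenspace => i j _ _; apply: ainj.
case: n T aT P Pid P0 => [|n] T aT P Pid P0.
  by exists 0 => mu k u _; rewrite [u]thinmx0 mul0mx scaler0.
pose V i := geigenspace T (a i).
have VE i (u : 'rV_n.+1) : (u <= V i)%MS -> u *m (T - (a i)%:M) ^+ n.+1 = 0.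
  by move=> uV; apply/sub_kermxP; rewrite -geigenspaceE.
have stV j : stablemx (V j) T by apply: comm_mx_stable_geigenspace.
have VT : (1%:M <= \sum_i V i)%MS by rewrite aT.
change (forall i (u : 'rV_n.+1), (u <= V i)%MS -> u *m P i = u) in Pid.
change (forall i j (u : 'rV_n.+1), j != i -> (u <= V j)%MS -> u *m P i = 0) in P0.
move: V VE stV VT Pid P0 {aT} => V VE stV VT Pid P0.
exists (\sum_i (a i)^* *: P i).
have DE i (u : 'rV_n.+1) : (u <= V i)%MS -> u *m (\sum_i (a i)^* *: P i) = (a i)^* *: u.
  move=> uV; rewrite mulmx_sumr (bigD1 i)//= -scalemxAr Pid//.
  by rewrite big1 ?addr0// => j ji; rewrite -scalemxAr (P0 j i) ?scaler0// eq_sym.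
move=> mu k u u0.
have /sub_sumsmxP [f uE] : (u <= \sum_i V i)%MS := submx_trans (submx1 u) VT.
have fV i : (f i *m V i <= V i)%MS by apply: submxMl.
have stVk i l (v : 'rV_n.+1) : (v <= V i)%MS -> (v *m (T - mu%:M) ^+ l <= V i)%MS.
  elim: l v => [|l IH] v vV; first by rewrite expr0 mulmx1.
  rewrite exprS mulmxA IH// mulmxBr mul_mx_scalar addmx_sub// ?eqmx_opp ?scalemx_sub//.
  by apply: submx_trans (stV i); apply: submxMr.
(* This component is killed by a power of T - a_i and by the given power of T - mu, hence is 0 when
   the two numbers differ. *)
have f0 i : a i != mu -> f i *m V i = 0.
  move=> aimu; apply: (@gen_eigen_uniq _ T (a i) mu n.+1 k) => //; first exact: VE.
  move: u0 => /(congr1 (mulmx^~ (P i))).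
  rewrite mul0mx uE !mulmx_suml (bigD1 i)//= Pid ?stVk//.
  by rewrite big1 ?addr0// => j ji; rewrite (P0 i j) ?stVk.
rewrite uE mulmx_suml scaler_sumr; apply: eq_bigr => i _.
rewrite (DE i) ?fV//; have [->//|/f0 ->] := eqVneq (a i) mu.
by rewrite !scaler0.
Qed.

(** [D] and [T] commute, and the eigenvalues of [D *m T] are numbers |mu|^2 with mu an eigenvalue of
    [T]. They are nonnegative with sum 0, so all vanish; then 0 is the only eigenvalue of [T], and
    Cayley-Hamilton applies. *)
Lemma conj_part_nilpotent n (T D : 'M[C]_n) :
  (forall mu k (u : 'rV_n), u *m (T - mu%:M) ^+ k = 0 -> u *m D = mu^* *: u) ->
  \tr (D *m T) = 0 -> T ^+ n = 0.
Proof.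
move=> hD trDT.
case: n T D hD trDT => [|n] T D hD trDT; first by rewrite [LHS]thinmx0.
have cDT : D *m T = T *m D.
  apply/row_matrixP => r; rewrite !rowE; move: (delta_mx 0 r).
  apply: (gen_eigen_ind (T := T)) => [|u v uE vE|mu k u u0]; first by rewrite !mul0mx.
    by rewrite !mulmxDl uE vE.
  rewrite !mulmxA (hD _ _ _ u0) -scalemxAl (hD mu k)//.
  have cc : T *m (T - mu%:M) ^+ k = (T - mu%:M) ^+ k *m T.
    by rewrite !mulmxE; apply: commrX; apply: commrB => //; apply: comm_mx_scalar.
  by rewrite -mulmxA cc mulmxA u0 mul0mx.
(* The eigenspace of [D *m T] for [a] is stable under [T], so it contains an eigenvector of [T]. *)
have geM a : eigenvalue (D *m T) a -> exists2 mu, eigenvalue T mu & a = `|mu| ^+ 2.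
  move=> aM; pose V := eigenspace (D *m T) a.
  have stV : stablemx V T.
    by apply: comm_mx_stable_eigenspace; rewrite /comm_mx !mulmxA -cDT.
  have rV : (0 < \rank V)%N by rewrite lt0n mxrank_eq0.
  have [b /eigenvalueP[w wE w0]] := eigenvalue_closed (restrictmx V T) rV.
  have /eigenvectorP [mu] : stablemx (w *m row_base V) T.
    by rewrite -stablemx_restrict//; apply/eigenvectorP; exists b; apply/eigenspaceP.
  move=> /eigenspaceP vT; set v := w *m _ in vT.
  have v0 : v != 0 by rewrite mulmx_free_eq0 ?row_base_free.
  have /eigenspaceP vM : (v <= V)%MS by rewrite mulmx_sub // eq_row_base.
  exists mu; first by apply/eigenvalueP; exists v.
  have vDT : v *m D *m T = (mu * mu^*) *: v.
    by rewrite (hD mu 1) ?expr1 ?mulmxBr ?mul_mx_scalar ?vT ?subrr// -scalemxAl vT scalerA mulrC.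
  apply/eqP; rewrite normCK -subr_eq0.
  have /eqP : (a - mu * mu^*) *: v = 0 by rewrite scalerBl -vDT -vM mulmxA subrr.
  by rewrite scaler_eq0 (negPf v0) orbF.
have [rs rsE] := closed_field_poly_normal (char_poly (D *m T)).
move: rsE; rewrite (monicP (char_poly_monic _)) scale1r => rsE.
have size_rs : size rs = n.+1.
  by apply/eqP; rewrite -eqSS -(size_prod_XsubC rs id) -rsE size_char_poly.
have memM a : (a \in rs) = eigenvalue (D *m T) a.
  by rewrite eigenvalue_root_char rsE root_prod_XsubC.
have sum0 : \sum_(z <- rs) z = 0.
  apply/eqP; rewrite -oppr_eq0 -coefPn_prod_XsubC ?size_rs// -rsE.
  by rewrite char_poly_trace// trDT oppr0.
have rs0 : all (fun z => z == 0) rs.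
  move: sum0; rewrite big_seq => /eqP; rewrite psumr_eq0 => [/allP h|z].
    by apply/allP => z zrs; have := h z zrs; rewrite zrs.
  by rewrite memM => /geM[mu _ ->]; rewrite exprn_ge0.
have T0 mu : eigenvalue T mu -> mu = 0.
  move=> /eigenvalueP[v vT v0]; apply/eqP; rewrite -normr_eq0 -sqrf_eq0.
  apply: (allP rs0); rewrite memM; apply/eigenvalueP; exists v => //.
  rewrite mulmxA (hD mu 1) ?expr1 ?mulmxBr ?mul_mx_scalar ?vT ?subrr//.
  by rewrite -scalemxAl vT scalerA mulrC normCK.
have [ts tsE] := closed_field_poly_normal (char_poly T).
move: tsE; rewrite (monicP (char_poly_monic _)) scale1r => tsE.
have size_ts : size ts = n.+1.
  by apply/eqP; rewrite -eqSS -(size_prod_XsubC ts id) -tsE size_char_poly.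
have ts0 : ts = nseq n.+1 0.
  rewrite -size_ts; apply/all_pred1P/allP => z zts; apply/eqP/T0.
  by rewrite eigenvalue_root_char tsE root_prod_XsubC.
have := Cayley_Hamilton T.
by rewrite tsE ts0 big_nseq iter_mulr_1 subr0 rmorphXn/= horner_mx_X.
Qed.
End GeneralizedEigenvectors.

(** * Brackets, ideals and Engel's theorem *)

Section LieBasics.
Import VectorInternalTheory.
Variables (K : fieldType) (g : lieAlgType K).
Implicit Types (x y z : g) (U V W I : {vspace g}).

HB.instance Definition _ x := GRing.isLinear.Build K g g *:%R (lie x) (lie_linearr x).

Lemma lieDl x y z : lie (x + y) z = lie x z + lie y z.
Proof. by have := lie_linearl z 1 x y; rewrite !scale1r. Qed.

Lemma lie0l x : lie 0 x = 0.
Proof. by apply: (addrI (lie 0 x)); rewrite -lieDl !addr0. Qed.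

Lemma lieZl a x y : lie (a *: x) y = a *: lie x y.
Proof. by have := lie_linearl y a x 0; rewrite !addr0 lie0l addr0. Qed.

Lemma lieNl x y : lie (- x) y = - lie x y.
Proof. by rewrite -scaleN1r lieZl scaleN1r. Qed.

Lemma lieBl x y z : lie (x - y) z = lie x z - lie y z.
Proof. by rewrite lieDl lieNl. Qed.

Lemma lie0r x : lie x 0 = 0. Proof. exact: linear0. Qed.
Lemma lieDr x y z : lie x (y + z) = lie x y + lie x z. Proof. exact: linearD. Qed.
Lemma lieNr x y : lie x (- y) = - lie x y. Proof. exact: linearN. Qed.
Lemma lieBr x y z : lie x (y - z) = lie x y - lie x z. Proof. exact: linearB. Qed.
Lemma lieZr a x y : lie x (a *: y) = a *: lie x y. Proof. exact: linearZ. Qed.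

Lemma lieC x y : lie x y = - lie y x.
Proof.
apply/eqP; rewrite -addr_eq0; have := liexx (x + y).
by rewrite !lieDl !lieDr !liexx add0r addr0 => ->.
Qed.

Lemma lie_lie x y z : lie (lie x y) z = lie x (lie y z) - lie y (lie x z).
Proof.
have := lie_jacobi x y z; rewrite (lieC z x) (lieC z (lie x y)) lieNr => /eqP.
by rewrite subr_eq0 => /eqP ->.
Qed.

Lemma lie_prodP U V W :
  (forall x y, x \in U -> y \in V -> lie x y \in W) -> (lie_prod U V <= W)%VS.
Proof.
move=> h; apply/span_subvP => _ /allpairsP[[x y] [/= xU yV ->]].
by apply: h; apply: vbasis_mem.
Qed.

Lemma lie_prod_ind U V (P : g -> Prop) :
  P 0 -> (forall x y, P x -> P y -> P (x + y)) ->
  (forall a x, P x -> P (a *: x)) ->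
  (forall x y, x \in U -> y \in V -> P (lie x y)) ->
  forall z, z \in lie_prod U V -> P z.
Proof.
move=> P0 PD PZ PL z zUV; rewrite (coord_span (X := in_tuple _) zUV).
apply: (big_ind P) => // i _; apply: PZ.
have /allpairsP[[x y] [/= xU yV ->]] :=
  mem_nth 0 (ltn_ord i : (i < size [seq lie x y | x <- vbasis U, y <- vbasis V])%N).
by apply: PL; apply: vbasis_mem.
Qed.

Lemma mem_lie_prod U V x y : x \in U -> y \in V -> lie x y \in lie_prod U V.
Proof.
move=> xU yV; rewrite (coord_vbasis xU) (coord_vbasis yV).
rewrite linear_sum/=; apply: rpred_sum => j _; rewrite lieC linear_sum/= -sumrN.
apply: rpred_sum => i _; rewrite -lieC lieZl lieZr !memvZ// memv_span//.
by apply: allpairs_f; rewrite mem_nth// size_tuple.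
Qed.

Lemma lie_prodS U U' V V' : (U <= U')%VS -> (V <= V')%VS ->
  (lie_prod U V <= lie_prod U' V')%VS.
Proof.
move=> UU VV; apply: lie_prodP => x y xU yV.
by apply: mem_lie_prod; [apply: (subvP UU)|apply: (subvP VV)].
Qed.

Lemma lie_prod_ideal I J : lie_ideal I -> lie_ideal J -> lie_ideal (lie_prod I J).
Proof.
move=> iI iJ x y yIJ; pose f : 'End(g) := linfun (lie x).
suff : (lie_prod I J <= f @^-1: lie_prod I J)%VS.
  by move/subvP/(_ _ yIJ); rewrite -memv_preim lfunE.
apply: lie_prodP => a b aI bJ; rewrite -memv_preim lfunE/=.
have -> : lie x (lie a b) = lie (lie x a) b + lie a (lie x b).
  by rewrite lie_lie subrK.
by rewrite memvD// mem_lie_prod//; [apply: iI|apply: iJ].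
Qed.

Lemma lie_prod_iterS U V W n : (V <= W)%VS ->
  (iter n (lie_prod U) V <= iter n (lie_prod U) W)%VS.
Proof. by move=> VW; elim: n => //= n; apply: lie_prodS. Qed.

(* Engel's theorem; a subalgebra of Q is enlarged one dimension at a time. *)
Lemma ad_nilpotent_products (Q : {vspace g}) d :
  (forall x y, x \in Q -> y \in Q -> lie x y \in Q) ->
  (forall x y, x \in Q -> iter d (lie x) y = 0) ->
  exists m, iter m (lie_prod Q) fullv = 0%VS.
Proof.
move=> subQ nilQ.
pose good K := [/\ (K <= Q)%VS, forall x y, x \in K -> y \in K -> lie x y \in K
  & exists m, iter m (lie_prod K) fullv = 0%VS].
suff grow n : exists2 K, good K & (n <= \dim K)%N \/ K = Q.
  have [H [HQ _ Hm] [|HE]] := grow (\dim Q).+1; last by rewrite -HE.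
  by rewrite ltnNge dimvS.
elim: n => [|n [H [HQ subH [m Hm]] dimH]].
  exists 0%VS; last by left.
  split; first exact: sub0v.
    by move=> x y; rewrite !memv0 => /eqP -> _; rewrite lie0l.
  exists 1 => /=; apply/eqP; rewrite -subv0; apply: lie_prodP => x y.
  by rewrite memv0 => /eqP -> _; rewrite lie0l mem0v.
have [HeQ|HnQ] := eqVneq H Q.
  have gH : good H by split => //; exists m.
  by exists H; last right.
have {}dimH : (n <= \dim H)%N by case: dimH => // E; rewrite E eqxx in HnQ.
(* By induction H acts nilpotently, so the series Q, [H, Q], [H, [H, Q]], ... ends up inside H; any
   element outside H of the last term not contained in H normalizes H. *)
have [x xQ [xH Hx]] : exists2 x, x \in Q & x \notin H /\ forall y, y \in H -> lie y x \in H.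
  pose Wj j := iter j (lie_prod H) Q.
  have Wm : (Wj m <= H)%VS by apply: subv_trans (sub0v H); rewrite -Hm lie_prod_iterS ?subvf.
  have [] := @ex_minnP (fun j => (Wj j <= H)%VS) (ex_intro _ m Wm).
  case=> [|j] Wj1 Wjmin; first by rewrite /Wj/= in Wj1; case/eqP: HnQ; apply/eqP; rewrite eqEsubv HQ.
  have /subvPn[x xW xH] : ~~ (Wj j <= H)%VS by apply/negP => /Wjmin; rewrite ltnn.
  exists x; last split => // y yH; last by apply: (subvP Wj1); apply: mem_lie_prod.
  suff /subvP/(_ _ xW) : (Wj j <= Q)%VS by [].
  elim: (j) => [|i IH]; first exact: subvv.
  by apply: lie_prodP => a b aH /(subvP IH) bQ; apply: subQ => //; apply: (subvP HQ).
pose H' := (H + <[x]>)%VS.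
have H'P y : y \in H' -> exists2 k, k \in H & exists a, y = k + a *: x.
  by move=> /memv_addP[k kH [_ /vlineP[a ->] ->]]; exists k => //; exists a.
have HH' : (H <= H')%VS := addvSl _ _.
have xH' : x \in H' by apply: (subvP (addvSr _ _)); rewrite memv_line.
exists H'; last first.
  left; rewrite (leq_ltn_trans dimH)// ltn_neqAle dimvS// andbT.
  apply: contraNneq xH => dd; have /eqP -> // : H == H' by rewrite eqEdim HH' dd leqnn.
split.
- by rewrite subv_add HQ -memvE.
- move=> _ _ /H'P[k kH [a ->]] /H'P[l lH [b ->]].
  rewrite lieDl !lieDr !lieZl !lieZr liexx !scaler0 addr0 !memvD ?memvZ//.
  + by rewrite (subvP HH')//; apply: subH.
  + by rewrite (subvP HH')//; apply: Hx.
  + by rewrite (subvP HH')// lieC memvN; apply: Hx.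
(* This series is stable under x because x normalizes H. A d-fold product with H + <x> lowers it by
   one step: d factors x give 0, and a factor from H already lowers it. *)
pose U i := iter i (lie_prod H) fullv.
have xU i y : y \in U i -> lie x y \in U i.
  elim: i y => [|i IH] y; first by rewrite !memvf.
  pose f : 'End(g) := linfun (lie x) => yU.
  suff : (U i.+1 <= f @^-1: U i.+1)%VS by move/subvP/(_ _ yU); rewrite -memv_preim lfunE.
  apply: lie_prodP => k u kH uU; rewrite -memv_preim lfunE/=.
  have -> : lie x (lie k u) = lie (lie x k) u + lie k (lie x u) by rewrite lie_lie subrK.
  by rewrite memvD// mem_lie_prod// ?IH// lieC memvN; exact: Hx.
have US i : (U i.+1 <= U i)%VS.
  elim: i => [|i IH]; first exact: subvf.
  exact: lie_prodS (subvv _) IH.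
have step i : (iter d (lie_prod H') (U i) <= U i.+1)%VS.
  pose X j := iter j (fun V => linfun (lie x) @: V)%VS (U i).
  have XP j v : v \in X j -> exists u, v = iter j (lie x) u.
    elim: j v => [|j IH] v; first by exists v.
    by move=> /memv_imgP[w /IH[u ->] ->]; exists u; rewrite lfunE.
  have X0 : X d = 0%VS.
    by apply/eqP; rewrite -subv0; apply/subvP => v /XP[u ->]; rewrite nilQ// mem0v.
  rewrite -[U i.+1]add0v -X0; elim: (d) => [|j IH]; first exact: addvSl.
  apply: lie_prodP => _ v /H'P[k kH [a ->]] /(subvP IH)/memv_addP[w wX [z zU ->]].
  have XU : (X j <= U i)%VS.
    elim: (j) => [|l IHl]; first exact: subvv.
    by apply/subvP => _ /memv_imgP[t /(subvP IHl) tU ->]; rewrite lfunE/= xU.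
  rewrite lieDl lieZl addrC; rewrite lieDr scalerDr -addrA memv_add//.
    by rewrite memvZ//; apply/memv_imgP; exists w => //; rewrite lfunE.
  rewrite memvD// ?memvZ ?xU//; apply: mem_lie_prod => //.
  by apply: memvD; [apply: (subvP XU)|apply: (subvP (US i))].
exists (m * d)%N; apply/eqP; rewrite -subv0 -Hm.
elim: (m) => [|i IH]; first by rewrite subvf.
rewrite mulSn iterD; apply: subv_trans (step i).
exact: lie_prod_iterS.
Qed.

(** By Engel's theorem the series Q, [Q, Q], [Q, [Q, Q]], ... reaches 0. Its last nonzero term L
    would satisfy [L, L] <= [Q, L] = 0 and be an abelian ideal. *)
Lemma nil_ideal_eq0 (Q : {vspace g}) d : lie_semisimple g -> lie_ideal Q ->
  (forall x y, x \in Q -> iter d (lie x) y = 0) -> Q = 0%VS.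
Proof.
move=> ss iQ nilQ.
have [m Qm] : exists m, iter m (lie_prod Q) fullv = 0%VS.
  by apply: (ad_nilpotent_products (d := d)) => // x y _; apply: iQ.
pose L j := iter j (lie_prod Q) Q.
have iL j : lie_ideal (L j) by elim: j => //= j IH; apply: lie_prod_ideal.
have LQ j : (L j <= Q)%VS.
  elim: j => [|j IH]; first exact: subvv.
  by apply: lie_prodP => a b aQ /(subvP IH) bQ; apply: iQ.
have Lm : L m == 0%VS by rewrite -subv0 -Qm lie_prod_iterS ?subvf.
have [] := @ex_minnP (fun j => L j == 0%VS) (ex_intro _ m Lm).
case=> [|j] /eqP Lj Lmin; first exact: Lj.
suff /eqP /Lmin : L j = 0%VS by rewrite ltnn.
apply: ss => //; exists 1; apply/eqP; rewrite -subv0/= -Lj.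
exact: lie_prodS.
Qed.
End LieBasics.

(** * The Killing form *)

Section Killing.
Import VectorInternalTheory.
Variables (K : fieldType) (g : lieAlgType K).
Implicit Types (x y z : g).
Local Notation d := (dim g).

(** Matrices act on coordinate rows from the right, so composition of maps reverses the order of the
    matrices; this explains the order of factors in commutators below. *)
Definition linmx (f : g -> g) : 'M[K]_d := lin1_mx (v2r \o f \o r2v).

Lemma linmxP (f : {linear g -> g}) x : v2r x *m linmx f = v2r (f x).
Proof. by rewrite /linmx mul_rV_lin1/= v2rK. Qed.

Lemma linmx_ext (A B : 'M[K]_d) : (forall x : g, v2r x *m A = v2r x *m B) -> A = B.
Proof. by move=> h; apply/row_matrixP => i; rewrite !rowE -(r2vK (delta_mx 0 i)) h. Qed.

Definition admx x : 'M[K]_d := linmx (lie x).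

Lemma admxP x y : v2r y *m admx x = v2r (lie x y).
Proof. exact: linmxP. Qed.

Lemma admx_linear : linear admx.
Proof.
move=> a x y; apply: linmx_ext => z.
by rewrite mulmxDr -scalemxAr !admxP lieDl lieZl linearP.
Qed.
HB.instance Definition _ := GRing.isLinear.Build K g 'M[K]_d *:%R admx admx_linear.

Lemma admx_lie x y : admx (lie x y) = admx y *m admx x - admx x *m admx y.
Proof.
apply: linmx_ext => z.
by rewrite mulmxBr !mulmxA !admxP lie_lie linearB.
Qed.

Lemma admxX x n y : v2r y *m admx x ^+ n = v2r (iter n (lie x) y).
Proof.
by elim: n => [|n IH]; rewrite ?expr0 ?mulmx1// exprSr mulmxA IH admxP.
Qed.

Definition killing x y : K := \tr (admx x *m admx y).

Lemma killingC x y : killing x y = killing y x.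
Proof. by rewrite /killing mxtrace_mulC. Qed.

Lemma killingDl x y z : killing (x + y) z = killing x z + killing y z.
Proof. by rewrite /killing linearD mulmxDl linearD. Qed.

Lemma killingZl a x z : killing (a *: x) z = a * killing x z.
Proof. by rewrite /killing linearZ -scalemxAl linearZ. Qed.

Lemma killing_lie x y z : killing (lie x y) z = killing x (lie y z).
Proof.
rewrite /killing !admx_lie mulmxBl mulmxBr !linearB/=; congr (_ - _).
  by rewrite -mulmxA mxtrace_mulC !mulmxA.
by rewrite !mulmxA.
Qed.

Lemma derivation_admx (D : {linear g -> g}) :
  (forall x y, D (lie x y) = lie (D x) y + lie x (D y)) ->
  forall x, admx (D x) = admx x *m linmx D - linmx D *m admx x.
Proof.
move=> dD x; apply: linmx_ext => y.
rewrite mulmxBr !mulmxA !admxP !linmxP ?admxP -linearB; congr v2r.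
by rewrite dD addrK.
Qed.

End Killing.

(** * Cartan's criterion *)

Section Complexification.
Import VectorInternalTheory.
Variables (R : fieldType) (g : lieAlgType R) (C : numClosedFieldType).
Variable f : {rmorphism R -> C}.
Local Notation d := (dim g).
Local Notation e i := (r2v (delta_mx 0 i) : g).

(** The adjoint representation of the complexified algebra, whose elements are rows of complex
    coordinates; no Lie algebra structure is put on them. *)
Definition adC (u : 'rV[C]_d) : 'M[C]_d := \sum_i u 0 i *: map_mx f (admx (e i)).

Lemma adC_linear : linear adC.
Proof.
move=> a u v; rewrite /adC scaler_sumr -big_split; apply: eq_bigr => i _ /=.
by rewrite !mxE scalerDl scalerA.
Qed.
HB.instance Definition _ := GRing.isLinear.Build C 'rV[C]_d 'M[C]_d *:%R adC adC_linear.

Lemma adC_real (x : g) : adC (map_mx f (v2r x)) = map_mx f (admx x).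
Proof.
rewrite -[in RHS](v2rK x) [v2r x in RHS]row_sum_delta !linear_sum/=.
rewrite (big_morph _ (@map_mxD _ _ f _ _) (@map_mx0 _ _ f _ _)).
by apply: eq_bigr => i _; rewrite !linearZ/= map_mxZ mxE.
Qed.

(** The real rows span the complex ones, so complex-linear identities can be checked on elements of
    [g]. *)
Lemma rV_real_ind (P : 'rV[C]_d -> Prop) :
  (forall u v, P u -> P v -> P (u + v)) -> (forall a u, P u -> P (a *: u)) ->
  P 0 -> (forall x : g, P (map_mx f (v2r x))) -> forall u, P u.
Proof.
move=> PD PZ P0 Pr u; rewrite [u]row_sum_delta; apply: (big_ind P) => // i _.
by apply: PZ; rewrite -(map_delta_mx f) -(r2vK (delta_mx 0 i)).
Qed.

Lemma adC_mulT (x : g) (u : 'rV[C]_d) :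
  adC (u *m map_mx f (admx x)) =
  adC u *m map_mx f (admx x) - map_mx f (admx x) *m adC u.
Proof.
move: u; apply: rV_real_ind => [u v uE vE|a u uE||y].
- by rewrite mulmxDl !(raddfD adC) /= uE vE (mulmxDl (adC u)) (mulmxDr _ (adC u)) opprD addrACA.
- by rewrite -scalemxAl !(linearZ_LR adC) /= uE -scalemxAl -scalemxAr scalerBr.
- by rewrite mul0mx !(raddf0 adC) /= mul0mx mulmx0 subr0.
- by rewrite -map_mxM admxP !adC_real admx_lie map_mxB !map_mxM.
Qed.

(** T - (mu + nu) obeys a Leibniz rule on [u, v], acting as T - mu on u and as T - nu on v. Each
    application lowers k + l, and exponent 0 means that the factor itself is 0. *)
Lemma adC_gen_eigen (x : g) mu nu k l (u v : 'rV[C]_d) :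
  let T := map_mx f (admx x) in
  u *m (T - mu%:M) ^+ k = 0 -> v *m (T - nu%:M) ^+ l = 0 ->
  v *m adC u *m (T - (mu + nu)%:M) ^+ (k + l) = 0.
Proof.
move=> T; have [n] := ubnP (k + l); elim: n k l u v => // n IH k l u v kl u0 v0.
case: k kl u0 => [|k] kl u0.
  by rewrite expr0 mulmx1 in u0; rewrite u0 linear0 mulmx0 mul0mx.
case: l kl v0 => [|l] kl v0.
  by rewrite expr0 mulmx1 in v0; rewrite v0 !mul0mx.
have step : v *m adC u *m (T - (mu + nu)%:M) =
   v *m adC (u *m (T - mu%:M)) + v *m (T - nu%:M) *m adC u.
  have -> : adC (u *m (T - mu%:M)) = adC u *m T - T *m adC u - mu *: adC u.
    by rewrite mulmxBr (raddfB adC)/= adC_mulT mul_mx_scalar (linearZ_LR adC).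
  rewrite !mulmxBr !mul_mx_scalar mulmxBl -!scalemxAl -scalemxAr !mulmxA scalerDl.
  by rewrite opprD [in RHS]addrAC subrKA addrA addrAC.
rewrite addSn exprS mulmxA step mulmxDl.
rewrite IH ?add0r// -?addSnnS ?IH//.
- by rewrite addnS in kl.
- by rewrite -[RHS]v0 exprS mulmxA.
- by rewrite -[RHS]u0 exprS mulmxA.
Qed.

(** Brackets add eigenvalues, and complex conjugation is additive. *)
Lemma adC_derivation (x : g) (D : 'M[C]_d) :
  (forall mu k (u : 'rV_d), u *m (map_mx f (admx x) - mu%:M) ^+ k = 0 ->
     u *m D = mu^* *: u) ->
  forall u, adC (u *m D) = adC u *m D - D *m adC u.
Proof.
move=> hD u; apply/row_matrixP => r; rewrite !rowE; move: (delta_mx 0 r) => v.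
move: u v; pose T := map_mx f (admx x).
apply: (gen_eigen_ind (T := T)) => [v|u u' uE uE' v|mu k u u0 v].
- by rewrite mul0mx (raddf0 adC)/= mul0mx !mulmx0 subr0 mulmx0.
- rewrite mulmxDl !(raddfD adC) /= [LHS](mulmxDr v) uE uE' -(mulmxDr v); congr (_ *m _).
  by rewrite (mulmxDl _ _ D) (mulmxDr D) opprD addrACA.
rewrite (hD _ _ _ u0) linearZ/=; move: v.
apply: (gen_eigen_ind (T := T)) => [|v v' vE vE'|nu l v v0].
- by rewrite !mul0mx.
- by rewrite !mulmxDl vE vE'.
rewrite mulmxBr !mulmxA (hD _ _ _ v0) (hD _ _ _ (adC_gen_eigen u0 v0)).
by rewrite -scalemxAr -scalemxAl -scalerBl rmorphD/= addrK.
Qed.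

(** For x = [a, b] with b in [N], tr(D ad x) = tr(ad(D a) ad b) because D is a derivation. Expanded
    in a real basis this is a combination of values of the Killing form at b, hence 0, and
    [conj_part_nilpotent] applies. *)
Lemma killing_radical_nilpotent (x : g) (N : {vspace g}) :
  (forall y z, y \in N -> killing y z = 0) ->
  x \in lie_prod fullv N -> forall y, iter d (lie x) y = 0.
Proof.
move=> N0 xN y; pose T := map_mx f (admx x).
have [D hD] := conj_semisimple_part T.
suff T0 : T ^+ d = 0.
  apply: v2r_inj; rewrite linear0 -admxX.
  suff -> : admx x ^+ d = 0 by rewrite mulmx0.
  have mapX n : map_mx f (admx x ^+ n) = T ^+ n.
    by elim: n => [|n IH]; rewrite ?expr0 ?map_mx1// !exprS map_mxM IH.
  by apply/eqP; rewrite -(map_mx_eq0 f) mapX T0.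
apply: (conj_part_nilpotent hD).
have dD := adC_derivation hD.
apply: (lie_prod_ind (P := fun z => \tr (D *m map_mx f (admx z)) = 0) _ _ _ _ xN).
- by rewrite linear0 map_mx0 mulmx0 linear0.
- by move=> a b aE bE; rewrite linearD/= map_mxD mulmxDr linearD/= aE bE addr0.
- by move=> c a aE; rewrite linearZ/= map_mxZ -scalemxAr linearZ/= aE mulr0.
move=> a b _ bN.
have -> : \tr (D *m map_mx f (admx (lie a b))) =
    \tr (adC (map_mx f (v2r a) *m D) *m map_mx f (admx b)).
  rewrite dD adC_real admx_lie map_mxB !map_mxM mulmxBr mulmxBl !linearB/=.
  by rewrite !mulmxA [in X in X - _]mxtrace_mulC !mulmxA.
move: (_ *m D) => u; rewrite mulmx_suml linear_sum/=; apply: big1 => i _.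
by rewrite -scalemxAl linearZ/= -map_mxM trace_map_mx -/(killing _ _) killingC (N0 b _ bN) raddf0 mulr0.
Qed.

End Complexification.


(** * Nondegeneracy of the Killing form and inner derivations *)

Section Semisimple.
Import VectorInternalTheory.
Variables (R : rcfType) (g : lieAlgType R).
Hypothesis ss : lie_semisimple g.
Implicit Types (x y z : g) (I J N : {vspace g}).
Local Notation d := (dim g).

Definition killing_form_mx : 'M[R]_d :=
  \matrix_(i, j) killing (r2v (delta_mx 0 i) : g) (r2v (delta_mx 0 j)).

Lemma killing_form_mxE x y :
  killing x y = (v2r x *m killing_form_mx *m (v2r y)^T) 0 0.
Proof.
have xE z : z = \sum_i v2r z 0 i *: (r2v (delta_mx 0 i) : g).
  by rewrite -[LHS]v2rK [v2r z in LHS]row_sum_delta linear_sum; apply: eq_bigr => i _; rewrite linearZ.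
rewrite mxE; under eq_bigr => j _ do rewrite mxE big_distrl/=.
rewrite exchange_big {1}(xE x)/=.
rewrite (big_morph (fun x => killing x y) (id1 := 0) (op1 := +%R)); last first.
- by rewrite -[0 in LHS](scale0r (0 : g)) killingZl mul0r.
- by move=> a b; apply: killingDl.
apply: eq_bigr => i _; rewrite killingZl killingC {1}(xE y).
rewrite (big_morph (fun y => killing y _) (id1 := 0) (op1 := +%R)); last first.
- by rewrite -[0 in LHS](scale0r (0 : g)) killingZl mul0r.
- by move=> a b; apply: killingDl.
rewrite mulr_sumr; apply: eq_bigr => j _.
by rewrite killingZl !mxE killingC mulrCA mulrC.
Qed.

(** The radical N is an ideal, and [g, N] is an ideal of ad-nilpotent elements by Cartan's
    criterion, so it is 0. Then N is abelian, hence 0. *)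
Lemma killing_nondegenerate x : (forall y, killing x y = 0) -> x = 0.
Proof.
move=> x0.
pose N : {vspace g} := lker (linfun (r2v \o mulmxr killing_form_mx \o v2r : g -> g)).
have NP z : reflect (forall y, killing z y = 0) (z \in N).
  rewrite memv_ker lfunE/=; apply: (iffP eqP) => [|z0].
    by move/(congr1 v2r); rewrite r2vK linear0 => h y; rewrite killing_form_mxE h mul0mx mxE.
  apply: v2r_inj; rewrite r2vK linear0; apply/rowP => j.
  have := z0 (r2v (delta_mx 0 j)); rewrite killing_form_mxE r2vK trmx_delta -colE !mxE.
  by [].
have iN : lie_ideal N.
  move=> a b /NP b0; apply/NP => c.
  by rewrite lieC -scaleN1r killingZl killing_lie b0 mulr0.
have N0 y z : y \in N -> killing y z = 0 by move/NP.
have gN : lie_prod fullv N = 0%VS.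
  apply: (nil_ideal_eq0 (d := d)) => //; first by apply: lie_prod_ideal iN => a b _; apply: memvf.
  by move=> a b aN; apply: (killing_radical_nilpotent (real_complex R) N0 aN).
suff N00 : N = 0%VS by apply/eqP; rewrite -memv0 -N00; apply/NP.
apply: ss => //; exists 1; apply/eqP; rewrite -subv0 -gN /=.
by apply: lie_prodS; rewrite ?subvf.
Qed.

Lemma killing_repr (l : {scalar g}) : exists z, forall y, l y = killing z y.
Proof.
have Gunit : killing_form_mx \in unitmx.
  rewrite -row_free_unit -kermx_eq0; apply/rowV0P => v /sub_kermxP vG.
  apply: r2v_inj; rewrite linear0; apply: killing_nondegenerate => y.
  by rewrite killing_form_mxE r2vK vG mul0mx mxE.
pose w : 'rV[R]_d := \row_j l (r2v (delta_mx 0 j)).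
exists (r2v (w *m invmx killing_form_mx)) => y.
rewrite killing_form_mxE r2vK mulmxKV//.
rewrite -{1}[y]v2rK [v2r y in LHS]row_sum_delta !linear_sum/= mxE.
by apply: eq_bigr => j _; rewrite !linearZ/= !mxE mulrC.
Qed.

(** z represents the functional y |-> tr(D ad y). Since ad(D x) = [D, ad x], cyclicity of the trace
    makes D x - [z, x] orthogonal to every y. *)
Lemma derivation_inner (D : {linear g -> g}) :
  (forall x y, D (lie x y) = lie (D x) y + lie x (D y)) ->
  exists z, forall x, D x = lie z x.
Proof.
move=> dD.
pose l : {scalar g} := mxtrace \o mulmx (linmx D) \o @admx R g.
have [z zE] := killing_repr l; exists z => x; apply/eqP; rewrite -subr_eq0; apply/eqP.
apply: killing_nondegenerate => y.
rewrite killingDl -scaleN1r killingZl mulN1r killing_lie -zE /l/=.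
rewrite /killing (derivation_admx dD) admx_lie mulmxBl mulmxBr !linearB/=.
by rewrite -mulmxA mxtrace_mulC !mulmxA subrr.
Qed.

End Semisimple.

(** * One-gradings *)

Section Gradings.
Import VectorInternalTheory.
Variables (K : fieldType) (g : lieAlgType K) (gr : onegrading g).
Implicit Types (x y z : g).
Local Notation gm := (gr (-1)).
Local Notation g0 := (gr 0).
Local Notation g1 := (gr 1).
Local Notation pi := (gr_comp gr).

Lemma gr_independent x y z : x \in gm -> y \in g0 -> z \in g1 -> x + y + z = 0 ->
  [/\ x = 0, y = 0 & z = 0].
Proof.
move=> xm y0 z1 s0.
have := gr_direct gr; rewrite directv_addE => /and3P[].
rewrite directv_addE => /and3P[_ _ /eqP d01] _ /eqP d1.
have z00 : z = 0.
  apply/eqP; rewrite -memv0 -d1 memv_cap z1 andbT.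
  by move/eqP: s0; rewrite addrC addr_eq0 => /eqP ->; rewrite memvN memv_add.
move: s0; rewrite z00 addr0 => /eqP; rewrite addr_eq0 => /eqP xy.
have x00 : x = 0 by apply/eqP; rewrite -memv0 -d01 memv_cap xm xy memvN y0.
by split=> //; apply/eqP; rewrite -oppr_eq0 -xy x00.
Qed.

Lemma gr_decomp x : exists a b c, [/\ a \in gm, b \in g0, c \in g1 & x = a + b + c].
Proof.
have : x \in (gm + g0 + g1)%VS by rewrite gr_full memvf.
move=> /memv_addP[_ /memv_addP[a am [b b0 ->]] [c c1 ->]].
by exists a, b, c.
Qed.

Definition gr_others (i : int) : {vspace g} :=
  (\sum_(j <- ([:: -1; 0; 1] : seq int)%R | j != i) gr j)%VS.

Lemma gr_othersN1 : gr_others (-1) = (g0 + g1)%VS.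
Proof. by rewrite /gr_others !big_cons big_nil /= addv0. Qed.
Lemma gr_others0 : gr_others 0 = (gm + g1)%VS.
Proof. by rewrite /gr_others !big_cons big_nil /= addv0. Qed.
Lemma gr_others1 : gr_others 1 = (gm + g0)%VS.
Proof. by rewrite /gr_others !big_cons big_nil /= addv0. Qed.

Lemma gr_cap_others i : i \in [:: -1; 0; 1] -> (gr i :&: gr_others i = 0)%VS.
Proof.
move=> iP; apply/eqP; rewrite -subv0; apply/subvP => x.
rewrite memv_cap memv0 => /andP[xi]; move: iP xi; rewrite !inE => /or3P[] /eqP -> xi.
- rewrite gr_othersN1 => /memv_addP[b b0 [c c1 xE]]; rewrite -memvN in b0; rewrite -memvN in c1.
  have [|-> //] := gr_independent xi b0 c1; by rewrite xE -addrA -opprD subrr.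
- rewrite gr_others0 => /memv_addP[b b0 [c c1 xE]]; rewrite -memvN in b0; rewrite -memvN in c1.
  have [|_ -> //] := gr_independent b0 xi c1; by rewrite xE addrA addNr add0r subrr.
- rewrite gr_others1 => /memv_addP[b b0 [c c1 xE]]; rewrite -memvN in b0; rewrite -memvN in c1.
  have [|_ _ -> //] := gr_independent b0 c1 xi; by rewrite xE -opprD addNr.
Qed.

Lemma gr_comp_linear i : linear (pi i).
Proof. by move=> a x y; rewrite /gr_comp linearP. Qed.
HB.instance Definition _ i := GRing.isLinear.Build K g g *:%R (pi i) (gr_comp_linear i).

Lemma gr_comp_mem i x : pi i x \in gr i.
Proof. exact: memv_pi. Qed.

Lemma gr_comp_id i x : i \in [:: -1; 0; 1] -> x \in gr i -> pi i x = x.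
Proof. by move=> iP xi; apply: daddv_pi_id => //; apply: gr_cap_others. Qed.

Lemma gr_comp_eq0 i x : i \in [:: -1; 0; 1] -> x \in gr_others i -> pi i x = 0.
Proof.
move=> iP xi; have cap0 := gr_cap_others iP.
have cap0' : (gr_others i :&: gr i = 0)%VS by rewrite capvC.
have xU : x \in (gr i + gr_others i)%VS by apply: (subvP (addvSr _ _)).
have /eqP := daddv_pi_add cap0 xU; rewrite (daddv_pi_id cap0')//.
by rewrite -subr_eq0 addrK => /eqP.
Qed.

Lemma gr_compE a b c : a \in gm -> b \in g0 -> c \in g1 ->
  [/\ pi (-1) (a + b + c) = a, pi 0 (a + b + c) = b & pi 1 (a + b + c) = c].
Proof.
move=> am b0 c1; rewrite !linearD/=.
rewrite !(gr_comp_id (i := -1) _ am) ?(gr_comp_id (i := 0) _ b0) ?(gr_comp_id (i := 1) _ c1)//.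
have mU (U V : {vspace g}) x : x \in U -> x \in (U + V)%VS by apply: (subvP (addvSl _ _)).
have mV (U V : {vspace g}) x : x \in V -> x \in (U + V)%VS by apply: (subvP (addvSr _ _)).
split.
- by rewrite !(gr_comp_eq0 (i := -1)) ?addr0// gr_othersN1; [apply: mV|apply: mU].
- by rewrite !(gr_comp_eq0 (i := 0)) ?addr0 ?add0r// gr_others0; [apply: mV|apply: mU].
- by rewrite !(gr_comp_eq0 (i := 1)) ?addr0 ?add0r// gr_others1; [apply: mV|apply: mU].
Qed.

Lemma gr_comp_sum x : x = pi (-1) x + pi 0 x + pi 1 x.
Proof.
have [a [b [c [am b0 c1 ->]]]] := gr_decomp x.
by have [-> -> ->] := gr_compE am b0 c1.
Qed.

Lemma gr_ind (P : g -> Prop) : (forall x y, P x -> P y -> P (x + y)) ->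
  (forall x, x \in gm -> P x) -> (forall x, x \in g0 -> P x) ->
  (forall x, x \in g1 -> P x) -> forall x, P x.
Proof.
move=> PD Pm P0 P1 x; rewrite [x]gr_comp_sum.
by apply: (PD); [apply: PD; [apply: Pm|apply: P0]|apply: P1]; apply: gr_comp_mem.
Qed.

Lemma lie_mm x y : x \in gm -> y \in gm -> lie x y = 0.
Proof. by move=> xm ym; apply/eqP; have := gr_lie xm ym; rewrite gr_out// memv0. Qed.
Lemma lie_11 x y : x \in g1 -> y \in g1 -> lie x y = 0.
Proof. by move=> xm ym; apply/eqP; have := gr_lie xm ym; rewrite gr_out// memv0. Qed.
Lemma lie_m0 x y : x \in gm -> y \in g0 -> lie x y \in gm.
Proof. exact: gr_lie. Qed.
Lemma lie_0m x y : x \in g0 -> y \in gm -> lie x y \in gm.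
Proof. exact: gr_lie. Qed.
Lemma lie_m1 x y : x \in gm -> y \in g1 -> lie x y \in g0.
Proof. exact: gr_lie. Qed.
Lemma lie_1m x y : x \in g1 -> y \in gm -> lie x y \in g0.
Proof. exact: gr_lie. Qed.
Lemma lie_00 x y : x \in g0 -> y \in g0 -> lie x y \in g0.
Proof. exact: gr_lie. Qed.
Lemma lie_01 x y : x \in g0 -> y \in g1 -> lie x y \in g1.
Proof. exact: gr_lie. Qed.
Lemma lie_10 x y : x \in g1 -> y \in g0 -> lie x y \in g1.
Proof. exact: gr_lie. Qed.

Lemma filt0E : filt gr 0 = (g0 + g1)%VS.
Proof. by rewrite /filt !big_cons big_nil /= addv0. Qed.
Lemma filt1E : filt gr 1 = g1.
Proof. by rewrite /filt !big_cons big_nil /= addv0. Qed.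

Lemma mem_filt0 x : (x \in filt gr 0) = (pi (-1) x == 0).
Proof.
apply/idP/eqP; first by rewrite filt0E => x0; apply: gr_comp_eq0 => //; rewrite gr_othersN1.
by move=> x0; rewrite filt0E [x]gr_comp_sum x0 add0r memv_add ?gr_comp_mem.
Qed.

End Gradings.

(** * The grading element and the Killing form on a grading *)

Section GradedSemisimple.
Import VectorInternalTheory.
Variables (R : rcfType) (g : lieAlgType R) (gr : onegrading g).
Implicit Types (x y z A X Y Z : g).
Local Notation gm := (gr (-1)).
Local Notation g0 := (gr 0).
Local Notation g1 := (gr 1).
Local Notation pi := (gr_comp gr).

(** The degree map D is a derivation, so it is the bracket with some E. From D E = [E, E] = 0 the
    components of E in degrees -1 and 1 vanish. *)
Lemma grading_element : exists E, [/\ E \in g0, forall x, x \in gm -> lie E x = - x,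
   forall x, x \in g0 -> lie E x = 0 & forall x, x \in g1 -> lie E x = x].
Proof.
pose D : {linear g -> g} := pi 1 \- pi (-1).
have DE a b c : a \in gm -> b \in g0 -> c \in g1 -> D (a + b + c) = c - a.
  by move=> am b0 c1; rewrite /D/=; have [-> _ ->] := gr_compE am b0 c1.
have Dm x : x \in gm -> D x = - x.
  by move=> xm; rewrite -[x]addr0 -[_ + 0]addr0 DE ?mem0v// !addr0 sub0r.
have D0 x : x \in g0 -> D x = 0.
  by move=> x0; rewrite -[x]addr0 -[x]add0r DE ?mem0v// subr0.
have D1 x : x \in g1 -> D x = x.
  by move=> x1; rewrite -[x]add0r -[0]add0r DE ?mem0v// !add0r subr0.
clearbody D.
have [|E EE] := derivation_inner (gr_semisimple gr) (D := D).
  apply: (gr_ind (gr := gr)) => [a b aE bE y|x xm|x x0|x x1].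
  - by rewrite lieDl !(raddfD D)/= aE bE !lieDl addrACA.
  - apply: (gr_ind (gr := gr)) => [a b aE bE|y ym|y y0|y y1].
    + by rewrite !lieDr !(raddfD D)/= aE bE !lieDr addrACA.
    + by rewrite (Dm x)// (Dm y)// lieNl lieNr !(lie_mm xm ym) linear0 oppr0 addr0.
    + by rewrite (D0 y)// (Dm x)// Dm ?lie_m0// lie0r addr0 lieNl.
    + by rewrite (Dm x)// (D1 y)// D0 ?lie_m1// lieNl addNr.
  - apply: (gr_ind (gr := gr)) => [a b aE bE|y ym|y y0|y y1].
    + by rewrite !lieDr !(raddfD D)/= aE bE !lieDr addrACA.
    + by rewrite (D0 x)// (Dm y)// Dm ?lie_0m// lie0l add0r lieNr.
    + by rewrite (D0 x)// (D0 y)// D0 ?lie_00// lie0l lie0r addr0.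
    + by rewrite (D0 x)// (D1 y)// D1 ?lie_01// lie0l add0r.
  - apply: (gr_ind (gr := gr)) => [a b aE bE|y ym|y y0|y y1].
    + by rewrite !lieDr !(raddfD D)/= aE bE !lieDr addrACA.
    + by rewrite (D1 x)// (Dm y)// D0 ?lie_1m// lieNr subrr.
    + by rewrite (D1 x)// (D0 y)// D1 ?lie_10// lie0r addr0.
    + by rewrite (D1 x)// (D1 y)// !(lie_11 x1 y1) linear0 addr0.
have EDE x : lie E x = D x by rewrite EE.
exists E; split=> [|x xm|x x0|x x1]; last 3 first.
- by rewrite EDE Dm.
- by rewrite EDE D0.
- by rewrite EDE D1.
have DEE : pi 1 E - pi (-1) E = 0.
  have := DE _ _ _ (gr_comp_mem gr (-1) E) (gr_comp_mem gr 0 E) (gr_comp_mem gr 1 E).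
  by rewrite -gr_comp_sum -EDE liexx => <-.
have mN : - pi (-1) E \in gm by rewrite memvN gr_comp_mem.
have [|] := gr_independent mN (mem0v g0) (gr_comp_mem gr 1 E).
  by rewrite addr0 addrC.
move=> /eqP; rewrite oppr_eq0 => /eqP a0 _ c0.
by rewrite [E](gr_comp_sum gr) a0 c0 addr0 add0r gr_comp_mem.
Qed.

(** Invariance of the form under the grading element multiplies it by i + j. *)
Lemma killing_degree i j x y : x \in gr i -> y \in gr j -> i + j != 0 ->
  i \in [:: -1; 0; 1] -> j \in [:: -1; 0; 1] -> killing x y = 0.
Proof.
have [E [E0 Em Ez E1]] := grading_element.
have EI (k : int) z : k \in [:: -1; 0; 1] -> z \in gr k -> lie E z = k%:~R *: z.
  rewrite !inE => /or3P[] /eqP -> zk.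
  - by rewrite Em// scaleN1r.
  - by rewrite Ez// scale0r.
  - by rewrite E1// scale1r.
move=> xi yj ij iP jP.
have := killing_lie x E y; rewrite lieC (EI i)// (EI j)//.
rewrite -scaleN1r !killingZl killingC [killing x _]killingC killingZl => /eqP.
rewrite mulN1r -subr_eq0 -opprD oppr_eq0 -mulrDl mulf_eq0 -intrD intr_eq0 (negPf ij).
by rewrite killingC => /eqP.
Qed.

(** With E the grading element, B(Z, X) = B([E, Z], X) = B(E, [Z, X]) = 0 on g_(-1); on g_0 and g_1
    the form B(Z, .) vanishes by degree. *)
Lemma ad_g1_faithful Z : Z \in g1 -> (forall X, X \in gm -> lie X Z = 0) -> Z = 0.
Proof.
move=> Z1 Z0; apply: (killing_nondegenerate (gr_semisimple gr)).
apply: (gr_ind (gr := gr)) => [a b aE bE|X Xm|A A0|Y Y1].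
- by rewrite killingC killingDl ![killing _ Z]killingC aE bE addr0.
- have [E [E0 Em Ez E1]] := grading_element.
  rewrite -(E1 Z Z1) killing_lie lieC Z0// oppr0.
  by rewrite killingC -(scale0r (0 : g)) killingZl mul0r.
- by rewrite (killing_degree Z1 A0).
- by rewrite (killing_degree Z1 Y1).
Qed.

End GradedSemisimple.

Lemma nilpotent_trace (R : rcfType) n (M : 'M[R]_n) k : M ^+ k = 0 -> \tr M = 0.
Proof.
case: n M => [|n] M Mk; first by rewrite /mxtrace big_ord0.
pose f := real_complex R; apply: (fmorph_inj f); rewrite rmorph0 -trace_map_mx.
set T := map_mx f M.
have Tk : T ^+ k = 0 by rewrite -rmorphXn Mk rmorph0.
have [ts tsE] := closed_field_poly_normal (char_poly T).
move: tsE; rewrite (monicP (char_poly_monic _)) scale1r => tsE.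
have size_ts : size ts = n.+1.
  by apply/eqP; rewrite -eqSS -(size_prod_XsubC ts id) -tsE size_char_poly.
have ts0 : ts = nseq n.+1 0.
  rewrite -size_ts; apply/all_pred1P/allP => z zts; apply/eqP.
  have : eigenvalue T z by rewrite eigenvalue_root_char tsE root_prod_XsubC.
  move=> /eigenvalueP[v vT v0].
  have : v *m T ^+ k = z ^+ k *: v.
    elim: (k) => [|j IH]; first by rewrite !expr0 mulmx1 scale1r.
    by rewrite exprS mulmxA vT -scalemxAl IH scalerA exprS.
  rewrite Tk mulmx0 => /esym/eqP; rewrite scaler_eq0 (negPf v0) orbF expf_eq0.
  by case/andP => _ /eqP.
apply/eqP; rewrite -oppr_eq0 -char_poly_trace// tsE ts0 big_nseq iter_mulr_1.
by rewrite subr0 coefXn ltn_eqF.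
Qed.

Section Coordinates.
Import VectorInternalTheory.
Variables (K : fieldType) (V : vectType K).

(* Coordinates reduce linear identities between vectors to scalar ones, where
   [lra] and [ring] apply. *)
Definition cv (j : 'I_(dim V)) (x : V) : K := v2r x 0 j.

Lemma cv_inj x y : (forall j, cv j x = cv j y) -> x = y.
Proof. by move=> h; apply: v2r_inj; apply/rowP => j; apply: h. Qed.

Lemma cvE j : (forall x y, cv j (x + y) = cv j x + cv j y) *
  (forall x, cv j (- x) = - cv j x) * (forall a x, cv j (a *: x) = a * cv j x) *
  (cv j 0 = 0) * (forall x n, cv j (x *+ n) = cv j x *+ n).
Proof.
do !split=> *; rewrite /cv ?linearD ?linearN ?linearZ ?linear0 ?linearMn ?mxE//.
by rewrite mulmxnE.
Qed.
End Coordinates.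

Section VspaceOfPred.
Import VectorInternalTheory.
Variables (K : fieldType) (V : vectType K).

(** A subspace on which [P] holds is enlarged by one vector at a time, by excluded middle, until the
    dimension stops the process. *)
Lemma vspace_of_pred (P : V -> Prop) : P 0 -> (forall x y, P x -> P y -> P (x + y)) ->
  (forall a x, P x -> P (a *: x)) -> exists U : {vspace V}, forall x, x \in U <-> P x.
Proof.
move=> P0 PD PZ.
pose good (U : {vspace V}) := forall x, x \in U -> P x.
suff grow n : exists2 U, good U & (n <= \dim U)%N \/ (forall x, P x -> x \in U).
  have [U gU [|hU]] := grow (\dim {:V}).+1; last by exists U => x; split; [apply: gU|apply: hU].
  by rewrite ltnNge dimvS ?subvf.
elim: n => [|n [U gU [nU|hU]]]; first by exists 0%VS; [move=> x; rewrite memv0 => /eqP ->|left].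
  have [hU|/existsNP[x /not_implyP[Px /negP xU]]] := pselect (forall x, P x -> x \in U).
    by exists U => //; right.
  exists (U + <[x]>)%VS.
    by move=> _ /memv_addP[u uU [_ /vlineP[a ->] ->]]; apply: PD; [apply: gU|apply: PZ].
  left; apply: leq_ltn_trans nU _; rewrite ltn_neqAle dimvS ?addvSl// andbT.
  apply: contra xU => dU; have /eqP -> : U == (U + <[x]>)%VS.
    by rewrite eqEdim addvSl (eqP dU) leqnn.
  by apply: (subvP (addvSr _ _)); rewrite memv_line.
by exists U => //; right.
Qed.

Lemma minimal_subspace (P : {vspace V} -> Prop) U : P U ->
  exists I, [/\ P I, (I <= U)%VS & forall J, P J -> (J <= I)%VS -> J = I].
Proof.
have [n] := ubnP (\dim U); elim: n U => // n IH U nU PU.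
have [h|/existsNP[J /not_implyP[PJ /not_implyP[JU JnU]]]] :=
  pselect (forall J, P J -> (J <= U)%VS -> J = U); first by exists U.
have dJ : (\dim J < \dim U)%N.
  rewrite ltn_neqAle dimvS// andbT; apply/eqP => dJ; apply: JnU.
  by apply/eqP; rewrite eqEdim JU dJ leqnn.
have [|I [PI IJ Imin]] := IH J _ PJ; first exact: leq_trans dJ _.
by exists I; split=> //; apply: subv_trans JU.
Qed.
End VspaceOfPred.

(** * Simple ideals in a semisimple algebra *)

Section SimpleIdeals.
Import VectorInternalTheory.
Variables (R : rcfType) (g : lieAlgType R).
Hypothesis ss : lie_semisimple g.

(** Let I be a minimal nonzero ideal inside H, and J a minimal nonzero ideal of I, so that [J, J] is
    0 or J. If it is 0, then J lies in the orthogonal of I inside I, an abelian ideal of g, hence 0.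
    Otherwise J is an ideal of g, so J = I, and the minimality of J makes I simple. *)
Lemma ideal_contains_simple (H : {vspace g}) : lie_ideal H -> H <> 0%VS ->
  exists2 I : {vspace g}, lie_simple_ideal I & (I <= H)%VS.
Proof.
move=> iH H0.
have [I [[iI I0] IH Imin]] := @minimal_subspace _ _
  (fun I => lie_ideal I /\ I <> 0%VS) H (conj iH H0).
exists I => //.
have iII x y : x \in I -> y \in I -> lie x y \in I by move=> _ /(iI x).
have [J [[JI iJ J0] _ Jmin]] := @minimal_subspace _ _
  (fun J => [/\ (J <= I)%VS, forall x y : g, x \in I -> y \in J -> lie x y \in J
     & J <> 0%VS]) I (And3 (subvv I) iII I0).
have JJ_J : (lie_prod J J <= J)%VS.
  by apply: lie_prodP => a b aJ bJ; apply: (iJ a b) => //; apply: (subvP JI).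
have iJJ x y : x \in I -> y \in lie_prod J J -> lie x y \in lie_prod J J.
  move=> xI; move: y; apply: lie_prod_ind => [|y z yI zI|a y yI|a b aJ bJ].
  - by rewrite lie0r mem0v.
  - by rewrite lieDr memvD.
  - by rewrite lieZr memvZ.
  have -> : lie x (lie a b) = lie (lie x a) b + lie a (lie x b) by rewrite lie_lie subrK.
  by rewrite memvD// mem_lie_prod// iJ.
have [JJ0|JJ0] := eqVneq (lie_prod J J) 0%VS.
  have abJ a b : a \in J -> b \in J -> lie a b = 0.
    by move=> aJ bJ; apply/eqP; rewrite -memv0 -JJ0 mem_lie_prod.
  have JI0 a y : a \in J -> y \in I -> killing a y = 0.
    (* ad(y) ad(a) maps g into I and its square maps g into J, which is abelian; a third application
       starts with ad(a) and gives 0. *)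
    move=> aJ yI; apply: (@nilpotent_trace _ _ _ 3).
    pose M := admx a *m admx y; have -> : M ^+ 3 = M *m (M *m M) by rewrite 2!exprS expr1.
    apply: linmx_ext => z; rewrite mulmx0 /M !mulmxA !admxP.
    have aI : a \in I by apply: (subvP JI).
    have w1 : lie y (lie a z) \in I by apply: (iI y); rewrite lieC memvN; apply: (iI z).
    have w2 : lie y (lie a (lie y (lie a z))) \in J.
      by apply: (iJ y) => //; rewrite lieC memvN; apply: (iJ _ a).
    by rewrite (abJ _ _ aJ w2) lie0r linear0.
  (* [A] is the orthogonal of I inside I. *)
  have [|||A AP] := @vspace_of_pred _ _ (fun x : g => x \in I /\ forall y, y \in I -> killing x y = 0).
  - split=> [|y _]; first exact: mem0v.
    by rewrite -(scale0r (0 : g)) killingZl mul0r.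
  - by move=> x y [xI x0] [yI y0]; split=> [|z zI]; rewrite ?memvD// killingDl x0// y0// addr0.
  - by move=> a x [xI x0]; split=> [|z zI]; rewrite ?memvZ// killingZl x0// mulr0.
  suff A0 : A = 0%VS.
    case: J0; apply/eqP; rewrite -subv0 -A0; apply/subvP => a aJ; apply/AP.
    by split=> [|y yI]; [apply: (subvP JI)|apply: JI0].
  apply: ss => [x y /AP[yI y0]|].
    apply/AP; split=> [|z zI]; first exact: (iI x).
    by rewrite lieC -scaleN1r killingZl killing_lie y0 ?mulr0//; apply: (iI x).
  exists 1; apply/eqP; rewrite -subv0 /=; apply: lie_prodP => a b /AP[aI a0] /AP[bI b0].
  rewrite memv0; apply/eqP; apply: (killing_nondegenerate ss) => y.
  by rewrite killing_lie a0// lieC memvN; apply: (iI y).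
have JJE : lie_prod J J = J.
  apply: Jmin => //; split=> //; first exact: subv_trans JI.
  exact/eqP.
(* An element of J is a sum of brackets [a, b] with a and b in J; by the Leibniz rule it suffices
   that [x, a] and [x, b] lie in I. *)
have iJg : lie_ideal J.
  move=> x y; rewrite -{1}JJE; move: y; apply: lie_prod_ind => [|y z yI zI|a y yI|a b aJ bJ].
  - by rewrite lie0r mem0v.
  - by rewrite lieDr memvD.
  - by rewrite lieZr memvZ.
  have -> : lie x (lie a b) = lie (lie x a) b + lie a (lie x b) by rewrite lie_lie subrK.
  rewrite memvD//; first by apply: (iJ _ b) => //; apply: (iI x); apply: (subvP JI).
  by rewrite lieC memvN; apply: (iJ _ a) => //; apply: (iI x); apply: (subvP JI).
have JIE : J = I by apply: Imin.
split=> //; first by rewrite -JIE JJE.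
move=> J' J'I iJ'; have [->|J'0] := eqVneq J' 0%VS; [by left|right].
rewrite -JIE; apply: Jmin; last by rewrite JIE.
by split=> //; exact/eqP.
Qed.
End SimpleIdeals.

(** * The action of g_0 on g_(-1) and filtered automorphisms *)

Section Faithful.
Import VectorInternalTheory.
Variables (R : rcfType) (g : lieAlgType R) (gr : onegrading g).
Implicit Types (x y z A X Y Z : g).
Local Notation gm := (gr (-1)).
Local Notation g0 := (gr 0).
Local Notation g1 := (gr 1).
Local Notation pi := (gr_comp gr).

(** The centralizer H of g_(-1) in g_0 is an ideal: for Z in g_1 and y in H, B([Z, y], X) = B(Z,
    [y, X]) = 0 on g_(-1), and the other degrees pair to 0. A nonzero H would contain a simple ideal
    lying in g_0. *)
Lemma ad_g0_faithful A : A \in g0 -> (forall X, X \in gm -> lie A X = 0) -> A = 0.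
Proof.
have [|||H HP] := @vspace_of_pred _ _ (fun A => A \in g0 /\ forall X, X \in gm -> lie A X = 0).
- by split=> [|X _]; rewrite ?mem0v ?lie0l.
- by move=> x y [x0 xX] [y0 yX]; split=> [|X Xm]; rewrite ?memvD// lieDl xX// yX// addr0.
- by move=> a x [x0 xX]; split=> [|X Xm]; rewrite ?memvZ// lieZl xX// scaler0.
move=> A0 AX; suff H0 : H = 0%VS by apply/eqP; rewrite -memv0 -H0; apply/HP.
apply: contrapT => Hn0.
have iH : lie_ideal H.
  move=> x y /HP[y0 yX]; apply/HP; move: x.
  apply: (gr_ind (gr := gr)) => [a b [a0 aX] [b0 bX]|X Xm|B B0|Z Z1].
  - by split=> [|X Xm]; rewrite lieDl ?memvD// lieDl aX// bX// addr0.
  - have -> : lie X y = 0 by rewrite lieC yX// oppr0.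
    by split=> [|X' Xm']; rewrite ?mem0v ?lie0l.
  - split=> [|X Xm]; first exact: lie_00.
    by rewrite lie_lie yX// lie0r yX ?lie_0m// subrr.
  suff -> : lie Z y = 0 by split=> [|X _]; rewrite ?mem0v ?lie0l.
  apply: (killing_nondegenerate (gr_semisimple gr)).
  apply: (gr_ind (gr := gr)) => [a b aE bE|X Xm|B B0|Y Y1].
  - by rewrite killingC killingDl ![killing _ (lie _ _)]killingC aE bE addr0.
  - by rewrite killing_lie yX// killingC -(scale0r (0 : g)) killingZl mul0r.
  - by rewrite (killing_degree (lie_10 Z1 y0) B0).
  - by rewrite (killing_degree (lie_10 Z1 y0) Y1).
have [I sI IH] := ideal_contains_simple (gr_semisimple gr) iH Hn0.
apply: (gr_effective sI); apply: subv_trans IH _; apply/subvP => a aH; have [+ _] := (HP a).1 aH; exact.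
Qed.

(** For Y in g_1 the cube of ad(Y) is 0, so these three terms are the whole exponential series. *)
Definition exp_ad Y x := x + lie Y x + 2^-1 *: lie Y (lie Y x).

Lemma mem_filt0_g0 x : x \in g0 -> x \in filt gr 0.
Proof. by move=> x0; rewrite filt0E (subvP (addvSl _ _)). Qed.
Lemma mem_filt0_g1 x : x \in g1 -> x \in filt gr 0.
Proof. by move=> x0; rewrite filt0E (subvP (addvSr _ _)). Qed.

Lemma filt0_sum x : x \in filt gr 0 -> x = pi 0 x + pi 1 x.
Proof. by rewrite mem_filt0 {2}[x](gr_comp_sum gr) => /eqP ->; rewrite add0r. Qed.

Lemma filt0_lie x y : x \in filt gr 0 -> y \in filt gr 0 -> lie x y \in filt gr 0.
Proof.
move=> /filt0_sum-> /filt0_sum->; rewrite !lieDl !lieDr.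
rewrite (lie_11 (gr_comp_mem gr 1 x) (gr_comp_mem gr 1 y)) addr0.
rewrite !memvD//; first by rewrite mem_filt0_g0 ?lie_00 ?gr_comp_mem.
  by rewrite mem_filt0_g1 ?lie_01 ?gr_comp_mem.
by rewrite mem_filt0_g1 ?lie_10 ?gr_comp_mem.
Qed.

Lemma gr_comp_lie_filt0 x y : x \in filt gr 0 ->
  pi (-1) (lie x y) = lie (pi 0 x) (pi (-1) y).
Proof.
move=> x0; rewrite {1}[y](gr_comp_sum gr) -addrA lieDr (filt0_sum x0) lieDl linearD/=.
have y0 : pi 0 y + pi 1 y \in filt gr 0.
  by apply: memvD; [apply: mem_filt0_g0|apply: mem_filt0_g1]; apply: gr_comp_mem.
have := filt0_lie x0 y0; rewrite {1}(filt0_sum x0) mem_filt0 => /eqP ->.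
rewrite addr0 linearD/=.
have : lie (pi 1 x) (pi (-1) y) \in filt gr 0 by rewrite mem_filt0_g0// lie_1m ?gr_comp_mem.
rewrite mem_filt0 => /eqP ->; rewrite addr0 gr_comp_id//; last first.
  by rewrite lie_0m ?gr_comp_mem.
by rewrite -(filt0_sum x0).
Qed.

Lemma gr_comp_lie_g1 x y : x \in g1 -> pi 0 (lie x y) = lie x (pi (-1) y).
Proof.
move=> x1; rewrite {1}[y](gr_comp_sum gr) !lieDr (lie_11 x1 (gr_comp_mem gr 1 y)) addr0.
have h0 : pi 0 (lie x (pi (-1) y)) = lie x (pi (-1) y).
  by rewrite gr_comp_id// lie_1m ?gr_comp_mem.
have h1 : pi 0 (lie x (pi 0 y)) = 0.
  by rewrite gr_comp_eq0// gr_others0 (subvP (addvSr _ _))// lie_10 ?gr_comp_mem.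
by rewrite linearD/= h0 h1 addr0.
Qed.

Section FilteredAutomorphism.
Variables (b : {linear g -> g}) (e : R).
Hypothesis bM : forall x y, b (lie x y) = lie (b x) (b y).
Hypothesis b0 : forall x, x \in filt gr 0 -> b x \in filt gr 0.
Hypothesis b1 : forall x, x \in g1 -> b x \in g1.
Hypothesis ee : e * e = 1.
Hypothesis be : forall X, X \in gm -> pi (-1) (b X) = e *: X.

(** Comparing b [A, X] with [b A, b X] modulo p shows that A and the g_0-component of b A have the
    same brackets with g_(-1). *)
Lemma filtered_aut_g0 A : A \in g0 -> b A = A + pi 1 (b A).
Proof.
move=> A0.
have bA0 : pi (-1) (b A) = 0.
  by apply/eqP; rewrite -mem_filt0 b0// filt0E (subvP (addvSl _ _)).
rewrite [LHS](gr_comp_sum gr) bA0 add0r; congr (_ + _); apply/eqP; rewrite -subr_eq0; apply/eqP.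
apply: ad_g0_faithful => [|X Xm]; first by rewrite memvB ?gr_comp_mem.
have h := congr1 (pi (-1)) (bM A X); rewrite be ?lie_0m// in h.
have e0 : e != 0 by apply/eqP => e0; move/eqP: ee; rewrite e0 mul0r eq_sym oner_eq0.
apply: (scalerI e0); rewrite scaler0 lieBl scalerBr h.
by rewrite gr_comp_lie_filt0 ?b0 ?mem_filt0_g0// be// lieZr subrr.
Qed.

(** The g_0-components of b [Z, X] and [b Z, b X] give [Z, X] = e [b Z, X], and g_1 is detected by
    its brackets with g_(-1). *)
Lemma filtered_aut_g1 Z : Z \in g1 -> b Z = e *: Z.
Proof.
move=> Z1; apply/eqP; rewrite -subr_eq0; apply/eqP.
apply: (ad_g1_faithful (gr := gr)) => [|X Xm]; first by rewrite memvB ?memvZ// b1.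
have h := congr1 (pi 0) (bM Z X); rewrite gr_comp_lie_g1 ?b1// be// in h.
rewrite filtered_aut_g0 ?lie_1m// linearD/= gr_comp_id ?lie_1m// in h.
rewrite gr_comp_eq0 ?addr0// ?gr_others0 ?(subvP (addvSr _ _)) ?gr_comp_mem// in h.
by rewrite lieBr [lie X (b Z)]lieC lieZr [lie X Z]lieC h lieZr scalerN scalerA ee scale1r opprK addNr.
Qed.
End FilteredAutomorphism.

(* Y is found by applying b to the grading element. *)
Lemma filtered_aut_exp_ad (b : {linear g -> g}) :
  (forall x y, b (lie x y) = lie (b x) (b y)) ->
  (forall x, x \in filt gr 0 -> b x \in filt gr 0) ->
  (forall x, x \in g1 -> b x \in g1) ->
  (forall X, X \in gm -> pi (-1) (b X) = X) ->
  exists2 Y, Y \in g1 & forall x, b x = exp_ad Y x.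
Proof.
move=> bM b0 b1 bm.
have bm1 X : X \in gm -> pi (-1) (b X) = 1 *: X by rewrite scale1r; apply: bm.
have bA A : A \in g0 -> b A = A + pi 1 (b A) by apply: (filtered_aut_g0 bM b0 (mulr1 1) bm1).
have bZ Z : Z \in g1 -> b Z = Z.
  by move=> Z1; rewrite (filtered_aut_g1 bM b0 b1 (mulr1 1) bm1 Z1) scale1r.
have [E [E0 Em Ez E1]] := grading_element gr.
pose Y := - pi 1 (b E); have Y1 : Y \in g1 by rewrite memvN gr_comp_mem.
have bE : b E = E - Y by rewrite /Y opprK; apply: bA.
exists Y => //; apply: (gr_ind (gr := gr)) => [x y xE yE|X Xm|A A0|Z Z1].
- by rewrite linearD/= xE yE /exp_ad !lieDr scalerDr addrACA [X in X + _]addrACA.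
- have := bM E X; rewrite Em// linearN/= bE.
  set c0 := pi 0 (b X); set c1 := pi 1 (b X).
  have c00 : c0 \in g0 by apply: gr_comp_mem.
  have c11 : c1 \in g1 by apply: gr_comp_mem.
  have -> : b X = X + c0 + c1 by have := gr_comp_sum gr (b X); rewrite bm.
  rewrite lieBl !lieDr Em// Ez// E1// addr0 (lie_11 Y1 c11) addr0 => h.
  have Yg0 : lie Y X \in g0 by apply: lie_1m.
  have Yg1 : lie Y c0 \in g1 by apply: lie_10.
  (* Degrees 0 and 1 of b [E, X] = [b E, b X] give c0 = [Y, X] and 2 c1 = [Y, c0], the origin of the
     factor 1/2. *)
  have s0 : 0 + (c0 - lie Y X) + (c1 *+ 2 - lie Y c0) = 0.
    by apply: cv_inj => j; move/(congr1 (cv j)): h; rewrite !cvE; lra.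
  have m0 : c0 - lie Y X \in g0 by rewrite memvB.
  have m1 : c1 *+ 2 - lie Y c0 \in g1 by rewrite memvB// mulr2n memvD.
  have [_ c0E c1E] := gr_independent (mem0v gm) m0 m1 s0.
  have c0Y : c0 = lie Y X by apply/eqP; rewrite -subr_eq0 c0E.
  have c1Y : c1 = 2^-1 *: lie Y (lie Y X).
    move/eqP: c1E; rewrite subr_eq0 c0Y => /eqP <-.
    by rewrite -scaler_nat scalerA mulVf ?scale1r// pnatr_eq0.
  by rewrite /exp_ad -c0Y c0Y -c1Y.
- have := bM E A; rewrite Ez// linear0 bE bA//; set c1 := pi 1 (b A).
  have c11 : c1 \in g1 by apply: gr_comp_mem.
  rewrite lieBl !lieDr Ez// E1// add0r (lie_11 Y1 c11) addr0 => h.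
  rewrite /exp_ad (lie_11 Y1 (lie_10 Y1 A0)) scaler0 addr0; congr (_ + _).
  by apply/eqP; rewrite -subr_eq0 -h.
- by rewrite bZ// /exp_ad (lie_11 Y1 Z1) lie0r scaler0 !addr0.
Qed.

End Faithful.

(** * The eigenvalue argument *)

Section EigenvalueArgument.
Import VectorInternalTheory.
Variables (R : rcfType) (g : lieAlgType R) (gr : onegrading g).
Local Notation gm := (gr (-1)).

(** An element of g_0 is detected by its brackets with the eigenbasis b. Applying ad(A) to
    [w(b_i, b_j), b_l] multiplies it by a_i + a_j + a_l, so its coordinate along b_t is killed by
    the nonzero number a_i + a_j + a_l - a_t. *)
Lemma invariant_bilinear_eq0 (A : g) r (a : r.-tuple R) (w : g -> g -> g) :
  ad_diagonalizable A gm a ->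
  (forall i1 i2 i3 i4 : 'I_r, tnth a i1 + tnth a i2 + tnth a i3 - tnth a i4 != 0) ->
  (forall y, linear (w^~ y)) -> (forall x, linear (w x)) ->
  (forall X Y, X \in gm -> Y \in gm -> w X Y \in gr 0) ->
  (forall X Y, X \in gm -> Y \in gm -> lie A (w X Y) = w (lie A X) Y + w X (lie A Y)) ->
  forall X Y, X \in gm -> Y \in gm -> w X Y = 0.
Proof.
move=> [b bB bA] a0 wl wr w0 wA.
have wDl x y z : w (x + y) z = w x z + w y z.
  by have := wl z 1 x y; rewrite !scale1r.
have wDr x y z : w x (y + z) = w x y + w x z.
  by have := wr x 1 y z; rewrite !scale1r.
have w0l y : w 0 y = 0 by apply: (addrI (w 0 y)); rewrite -wDl !addr0.
have w0r x : w x 0 = 0 by apply: (addrI (w x 0)); rewrite -wDr !addr0.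
have wZl c x y : w (c *: x) y = c *: w x y by rewrite -[c *: x]addr0 wl w0l addr0.
have wZr c x y : w x (c *: y) = c *: w x y by rewrite -[c *: y]addr0 wr w0r addr0.
have bg i : tnth b i \in gm by rewrite (basis_mem bB)// mem_tnth.
have key i j : w (tnth b i) (tnth b j) = 0.
  set wij := w _ _; have wij0 : wij \in gr 0 by apply: w0.
  apply: (ad_g0_faithful (gr := gr)) => // X Xm.
  have Awij : lie A wij = (tnth a i + tnth a j) *: wij.
    by rewrite wA// !bA wZl wZr scalerDl.
  have wbk l : lie wij (tnth b l) = 0.
    set v := lie _ _; have vm : v \in gm by apply: lie_0m.
    have Av : lie A v = (tnth a i + tnth a j + tnth a l) *: v.
      have := lie_lie A wij (tnth b l); rewrite Awij lieZl bA lieZr -/v => /eqP.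
      by rewrite eq_sym subr_eq => /eqP ->; rewrite -scalerDl.
    have vE := coord_basis bB vm.
    have cz t : (tnth a i + tnth a j + tnth a l - tnth a t) * coord b t v = 0.
      have s0 : \sum_(t < r) ((tnth a i + tnth a j + tnth a l - tnth a t) * coord b t v) *: b`_t = 0.
        under eq_bigr => q _ do rewrite mulrBl scalerBl -!scalerA.
        rewrite sumrB -scaler_sumr -vE -Av {1}vE linear_sum -sumrB big1// => q _ /=.
        by rewrite lieZr -tnth_nth bA scalerA mulrC -scalerA subrr.
      by have /freeP/(_ _ s0 t) := basis_free bB.
    rewrite vE big1// => t _; have /eqP := cz t.
    by rewrite mulf_eq0 (negPf (a0 _ _ _ _)) /= => /eqP ->; rewrite scale0r.
  rewrite (coord_basis bB Xm) linear_sum big1// => l _ /=.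
  by rewrite lieZr -tnth_nth wbk scaler0.
move=> X Y Xm Ym; rewrite (coord_basis bB Xm) (coord_basis bB Ym).
have wsuml (F : 'I_r -> g) y : w (\sum_i F i) y = \sum_i w (F i) y.
  by apply: (big_morph (w^~ y)) => [u v|]; [apply: wDl|apply: w0l].
have wsumr (F : 'I_r -> g) x : w x (\sum_i F i) = \sum_i w x (F i).
  by apply: (big_morph (w x)) => [u v|]; [apply: wDr|apply: w0r].
rewrite wsuml big1// => i _; rewrite wsumr big1// => j _.
by rewrite wZl wZr -!tnth_nth key !scaler0.
Qed.
End EigenvalueArgument.

Import numFieldNormedType.Exports.

Local Open Scope classical_set_scope.
Local Open Scope ring_scope.

(** * Smooth maps *)

Section Differentiability.
Context {R : realType}.
Implicit Types V W : normedModType R.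

Lemma is_diff_eps V W (f : V -> W) (x : V) (df : {linear V -> W}) :
  continuous df ->
  (forall e : R, 0 < e -> \forall k \near (0 : V), `|f (k + x) - f x - df k| <= e * `|k|) ->
  is_diff x f df.
Proof.
move=> cdf fe.
have fE : f \o shift x = cst (f x) + df +o_ (0 : V) id.
  apply/eqaddoP => e e0; near=> k => /=; rewrite !fctE/= opprD addrA.
  by near: k; apply: fe.
have dfE : 'd f x = df :> (V -> W) by apply: diff_unique.
by constructor => //; apply/diff_locallyP; rewrite dfE; split.
Unshelve. all: by end_near. Qed.

Lemma differentiable_epsP V W (f : V -> W) (x : V) : differentiable f x ->
  forall e : R, 0 < e -> \forall k \near (0 : V), `|f (k + x) - f x - 'd f x k| <= e * `|k|.
Proof.
move=> /diff_locallyP[_ fE] e e0.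
have /eqaddoP/(_ e e0) := fE.
by apply: filterS => k /=; rewrite !fctE/= opprD addrA.
Qed.

Lemma near_eq_is_diff V W (f h : V -> W) (x : V) :
  (\forall y \near x, f y = h y) -> differentiable f x -> is_diff x h ('d f x).
Proof.
move=> fh df; apply: is_diff_eps; first exact: diff_continuous.
move=> e e0; have := differentiable_epsP df e0.
have fhx := nbhs_singleton fh.
have : \forall k \near (0 : V), f (k + x) = h (k + x).
  have : (fun k => k + x) @ (0 : V) --> x.
    by rewrite -[x in _ --> x]add0r; apply: cvgD; [apply: cvg_id|apply: cvg_cst].
  by move=> /(_ _ fh).
by apply: filterS2 => k; rewrite -fhx => <-.
Qed.

Lemma near_eq_differentiable V W (f h : V -> W) (x : V) :
  (\forall y \near x, f y = h y) -> differentiable f x -> differentiable h x.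
Proof. by move=> fh /(near_eq_is_diff fh)[]. Qed.

Lemma near_eq_diff V W (f h : V -> W) (x : V) :
  (\forall y \near x, f y = h y) -> differentiable f x -> 'd h x = 'd f x :> (V -> W).
Proof. by move=> fh /(near_eq_is_diff fh)[]. Qed.

(** Finite dimension in the form in which it is used: vectors expand along fixed directions with
    continuous linear coefficients. Reals, rows, matrices and products are all covered. *)
Definition findim V := exists (I : finType) (e : I -> V) (c : I -> {linear V -> R}),
  (forall j, continuous (c j)) /\ forall v, v = \sum_j c j v *: e j.

Lemma findim_R : findim R.
Proof.
exists unit, (fun=> 1), (fun=> idfun); split=> [j x|v]; first exact: cvg_id.
by rewrite (big_pred1 tt)/= ?[RHS]mulr1 => [|[]].
Qed.

Lemma coord_linear n (j : 'I_n) : linear_for *%R (fun v : 'rV[R]_n => v 0 j).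
Proof. by move=> a u v; rewrite !mxE. Qed.

Lemma findim_rV n : findim 'rV[R]_n.
Proof.
pose c (j : 'I_n) (v : 'rV[R]_n) : R := v 0 j.
pose cl' j := GRing.isLinear.Build R 'rV[R]_n R *%R (c j) (@coord_linear n j).
pose C j : {linear 'rV[R]_n -> R} := HB.pack (c j) (cl' j).
exists 'I_n, (fun j => delta_mx 0 j), C; split=> [j x|v]; last exact: row_sum_delta.
exact: coord_continuous.
Qed.

Lemma findim_prod V W : findim V -> findim W -> findim (V * W)%type.
Proof.
move=> [I [e [c [cc ce]]]] [J [e' [c' [cc' ce']]]].
pose E (j : I + J) : V * W := match j with inl i => (e i, 0) | inr i => (0, e' i) end.
pose C (j : I + J) : {linear (V * W)%type -> R} :=
  match j with inl i => c i \o fst | inr i => c' i \o snd end.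
exists (I + J)%type, E, C; split=> [[i|i] /= x|[v w]].
- by apply: continuous_comp => //; [exact: cvg_fst|exact: cc].
- by apply: continuous_comp => //; [exact: cvg_snd|exact: cc'].
rewrite big_sumType/=.
rewrite (eq_bigr (fun i => (c i v *: e i, 0))) => [|i _]; last first.
  by congr pair; rewrite scaler0.
rewrite [X in _ + X](eq_bigr (fun i => (0, c' i w *: e' i))) => [|i _]; last first.
  by congr pair; rewrite scaler0.
have pl (F : I -> V) : \sum_i (F i, 0 : W) = (\sum_i F i, 0).
  by apply: (big_ind2 (fun x y => x = (y, 0))) => // _ x2 _ y2 -> ->; congr pair; rewrite addr0.
have pr (F : J -> W) : \sum_i (0 : V, F i) = (0, \sum_i F i).
  by apply: (big_ind2 (fun x y => x = (0, y))) => // _ x2 _ y2 -> ->; congr pair; rewrite addr0.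
by rewrite pl pr -ce -ce'; congr pair; rewrite ?addr0 ?add0r.
Qed.

End Differentiability.

Section DerivativeRules.
Context {R : realType}.
Implicit Types U V W X : normedModType R.

Lemma scale_is_bilinear W :
  bilinear_for (GRing.Scale.Law.clone R W *:%R _) (GRing.Scale.Law.clone R W *:%R _)
    (@GRing.scale R W).
Proof.
split=> [u'|u] a x y /=; first by rewrite scalerDl scalerA.
by rewrite scalerDr !scalerA mulrC.
Qed.
HB.instance Definition _ W := bilinear_isBilinear.Build R R W W _ _ (@GRing.scale R W)
  (@scale_is_bilinear W).

Lemma derive_bilin U V W X (b : {bilinear U -> V -> W}) (f : X -> U) (h : X -> V) x :
  continuous (fun p => b p.1 p.2) -> differentiable f x -> differentiable h x ->
  differentiable (fun y => b (f y) (h y)) x /\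
  forall v, 'D_v (fun y => b (f y) (h y)) x = b (f x) ('D_v h x) + b ('D_v f x) (h x).
Proof.
move=> cb df dh; have dp := differentiable_pair df dh.
have db := differentiable_bilin (f x, h x) cb.
have dc : differentiable ((fun p => b p.1 p.2) \o (fun y => (f y, h y))) x.
  exact: differentiable_comp.
split=> // v; rewrite -[LHS]/('D_v ((fun p => b p.1 p.2) \o (fun y => (f y, h y))) x).
by rewrite deriveE// diff_comp//= diff_bilin//= diff_pair//= !deriveE.
Qed.

Lemma derive_scale V W (a : V -> R) (f : V -> W) x :
  differentiable a x -> differentiable f x ->
  differentiable (fun y => a y *: f y) x /\
  forall v, 'D_v (fun y => a y *: f y) x = a x *: 'D_v f x + 'D_v a x *: f x.
Proof.
move=> da df.
by have := @derive_bilin R W W V (@GRing.scale R W) a f x (@scale_continuous R W) da df.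
Qed.

Lemma derive_comp_lin V W X (l : {linear V -> W}) (f : X -> V) x :
  continuous l -> differentiable f x ->
  differentiable (fun y => l (f y)) x /\ forall v, 'D_v (fun y => l (f y)) x = l ('D_v f x).
Proof.
move=> cl df; have dl : differentiable l (f x) by apply: linear_differentiable.
have dc : differentiable (l \o f) x by apply: differentiable_comp.
split=> // v; rewrite -[LHS]/('D_v (l \o f) x) deriveE// diff_comp//= diff_lin//.
by rewrite deriveE.
Qed.

Lemma derive_compo V W X (h : V -> W) (f : X -> V) x v :
  differentiable f x -> differentiable h (f x) ->
  'D_v (h \o f) x = 'd h (f x) ('D_v f x).
Proof.
move=> df dh; rewrite [LHS]deriveE; last exact: differentiable_comp.
by rewrite diff_comp//= (deriveE v df).
Qed.


End DerivativeRules.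

(** * Calculus of C^k maps *)

Section CkTheory.
Context {R : realType}.
Implicit Types U V W X : normedModType R.

Lemma Ck_ext V W k (U : set V) (f h : V -> W) : open U ->
  (forall x, U x -> f x = h x) -> Ck k U f -> Ck k U h.
Proof.
move=> oU; elim: k f h => [|k IH] f h fh /=.
  move=> cf x Ux; have nfh : \forall y \near x, f y = h y.
    by apply: filterS (open_nbhs_nbhs (conj oU Ux)) => y /fh.
  apply: (cvg_trans _ (_ : f @ x --> h x)); last by rewrite -fh//; apply: cf.
  by apply: near_eq_cvg.
move=> [df Cf]; split=> [x Ux|v].
  apply: near_eq_differentiable (df x Ux).
  by apply: filterS (open_nbhs_nbhs (conj oU Ux)) => y /fh.
apply: IH (Cf v) => x Ux; apply: near_eq_derive.
by apply: filterS (open_nbhs_nbhs (conj oU Ux)) => y /fh.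
Qed.

Lemma Ck_sub V W k (U U' : set V) (f : V -> W) : U' `<=` U -> Ck k U f -> Ck k U' f.
Proof.
move=> UU; elim: k f => [|k IH] f /=; first by move=> h x /UU/h.
by move=> [df Cf]; split=> [x /UU/df//|v]; apply: IH.
Qed.

Lemma CkW V W k (U : set V) (f : V -> W) : Ck k.+1 U f -> Ck k U f.
Proof.
elim: k f => [|k IH] f; first by move=> [df _] x /df/differentiable_continuous.
by move=> [df Cf]; split=> // v; apply: IH.
Qed.

Lemma Ck_cst V W k (U : set V) (a : W) : Ck k U (fun=> a : W).
Proof.
elim: k a => [|k IH] a /=; first by move=> x _; apply: cvg_cst.
split=> [x _|v]; first exact: differentiable_cst.
have -> : 'D_v (fun=> a : W) = (fun=> 0) :> (V -> W) by apply/funext => x; apply: derive_cst.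
exact: IH.
Qed.

Lemma CkD V W k (U : set V) (f h : V -> W) : open U ->
  Ck k U f -> Ck k U h -> Ck k U (fun x => f x + h x).
Proof.
move=> oU; elim: k f h => [|k IH] f h /=.
  by move=> cf ch x Ux; apply: continuousD; [apply: cf|apply: ch].
move=> [df Cf] [dh Ch]; split=> [x Ux|v].
  by apply: differentiableD; [apply: df|apply: dh].
apply: (@Ck_ext _ _ _ _ (fun x => 'D_v f x + 'D_v h x)) => [//|x Ux|]; last exact: IH.
by rewrite -deriveD//; apply: diff_derivable; [apply: df|apply: dh].
Qed.

Lemma Ck_sum V W k (U : set V) (I : Type) (r : seq I) (f : I -> V -> W) : open U ->
  (forall i, Ck k U (f i)) -> Ck k U (fun x => \sum_(i <- r) f i x).
Proof.
move=> oU Cf; elim: r => [|i r IH].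
  by apply: (Ck_ext oU _ (Ck_cst k U 0)) => x _; rewrite big_nil.
by apply: (Ck_ext oU _ (CkD oU (Cf i) IH)) => x _; rewrite big_cons.
Qed.

Lemma Ck_scale V W k (U : set V) (a : V -> R) (f : V -> W) : open U ->
  Ck k U a -> Ck k U f -> Ck k U (fun x => a x *: f x).
Proof.
move=> oU; elim: k a f => [|k IH] a f.
  by move=> ca cf x Ux; apply: cvgZ; [apply: ca|apply: cf].
move=> Ca Cf; have [da Ca'] := Ca; have [df Cf'] := Cf; split=> [x Ux|v].
  by have [] := derive_scale (da x Ux) (df x Ux).
apply: (@Ck_ext _ _ _ _ (fun x => a x *: 'D_v f x + 'D_v a x *: f x)) => [//|x Ux|].
  by have [_ ->] := derive_scale (da x Ux) (df x Ux).
by apply: CkD => //; apply: IH; [exact: CkW|exact: Cf'|exact: Ca'|exact: CkW].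
Qed.

Lemma Ck_lin V W X k (U : set V) (l : {linear W -> X}) (f : V -> W) : open U ->
  continuous l -> Ck k U f -> Ck k U (fun x => l (f x)).
Proof.
move=> oU cl; elim: k f => [|k IH] f.
  by move=> cf x Ux; apply: continuous_comp; [apply: cf|apply: cl].
move=> [df Cf]; split=> [x Ux|v]; first by have [] := derive_comp_lin cl (df x Ux).
apply: (@Ck_ext _ _ _ _ (fun x => l ('D_v f x))) => [//|x Ux|]; last by apply: IH; apply: Cf.
by have [_ ->] := derive_comp_lin cl (df x Ux).
Qed.

(** [Ck] differentiates in fixed directions, whereas the chain rule produces the moving direction
    D_v f. Expanded along the e_i, the derivative is the sum of c_i(D_v f) times (D_(e_i) h) o f, to
    which the induction hypothesis applies. *)
Lemma Ck_comp V W X k (U : set V) (U' : set W) (f : V -> W) (h : W -> X) :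
  findim W -> open U -> open U' -> (forall x, U x -> U' (f x)) ->
  Ck k U f -> Ck k U' h -> Ck k U (h \o f).
Proof.
move=> [I [e [c [cc ce]]]] oU oU' UU'; elim: k f h UU' => [|k IH] f h UU'.
  by move=> cf ch x Ux; apply: continuous_comp; [apply: cf|apply/ch/UU'].
move=> Cf Ch; have [df Cf'] := Cf; have [dh Ch'] := Ch; split=> [x Ux|v].
  by apply: differentiable_comp; [apply: df|apply/dh/UU'].
apply: (@Ck_ext _ _ _ _ (fun x => \sum_i c i ('D_v f x) *: ('D_(e i) h \o f) x)) => [//|x Ux|].
  rewrite derive_compo; [|exact: df|exact/dh/UU'].
  rewrite [in RHS](ce ('D_v f x)) linear_sum; apply: eq_bigr => i _ /=.
  by rewrite linearZ/= (deriveE (e i) (dh _ (UU' _ Ux))).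
apply: Ck_sum => // i; apply: Ck_scale => //; first by apply: Ck_lin; [|exact: cc|exact: Cf'].
by apply: IH => //; [exact: CkW|exact: Ch'].
Qed.

Lemma Ck_pair V W X k (U : set V) (f : V -> W) (h : V -> X) : open U ->
  Ck k U f -> Ck k U h -> Ck k U (fun x => (f x, h x)).
Proof.
move=> oU; elim: k f h => [|k IH] f h.
  by move=> cf ch x Ux; apply: cvg_pair; [apply: cf|apply: ch].
move=> [df Cf] [dh Ch]; split=> [x Ux|v].
  by apply: differentiable_pair; [apply: df|apply: dh].
apply: (@Ck_ext _ _ _ _ (fun x => ('D_v f x, 'D_v h x))) => [//|x Ux|]; last by apply: IH; [apply: Cf|apply: Ch].
have d1 := df x Ux; have d2 := dh x Ux.
rewrite [RHS]deriveE; last exact: differentiable_pair.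
by rewrite diff_pair// (deriveE v d1) (deriveE v d2).
Qed.

Lemma Ck_id V k (U : set V) : Ck k U (@id V).
Proof.
case: k => [|k]; first by move=> x _; apply: cvg_id.
split=> // v; have -> : 'D_v (@id V) = (fun=> v) by apply/funext => x; apply: derive_id.
exact: Ck_cst.
Qed.

End CkTheory.

Section SmoothAt.
Context {R : realType}.
Implicit Types U V W X : normedModType R.

Lemma smooth_at_near_eq V W (f h : V -> W) x : (\forall y \near x, f y = h y) ->
  smooth_at f x -> smooth_at h x.
Proof.
move=> fh [U [oU Ux] Cf]; have : nbhs x [set y | f y = h y] := fh.
rewrite nbhsE => -[U' [oU' U'x] {}fh].
exists (U `&` U') => [|k]; first by split; [apply: openI|].
apply: (@Ck_ext _ _ _ _ _ f) => [|y [_ /fh]//|]; first exact: openI.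
by apply: Ck_sub (Cf k) => y [].
Qed.

Lemma smooth_at_near V W (f : V -> W) x : smooth_at f x ->
  \forall y \near x, smooth_at f y.
Proof.
move=> [U oUx Cf]; apply: filterS (open_nbhs_nbhs oUx) => y Uy.
by exists U => //; split=> //; case: oUx.
Qed.

Lemma smooth_at_differentiable V W (f : V -> W) x : smooth_at f x -> differentiable f x.
Proof. by move=> [U [_ Ux] /(_ 1%N)[+ _]]; apply. Qed.

Lemma smooth_at_continuous V W (f : V -> W) x : smooth_at f x -> {for x, continuous f}.
Proof. by move=> /smooth_at_differentiable/differentiable_continuous. Qed.

Lemma smooth_at_derive V W (f : V -> W) x v : smooth_at f x -> smooth_at ('D_v f) x.
Proof. by move=> [U oU Cf]; exists U => // k; have [_] := Cf k.+1; apply. Qed.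

Lemma smooth_at_cst V W (a : W) (x : V) : smooth_at (fun=> a) x.
Proof. by exists setT; [split; [apply: openT|]|move=> k; apply: Ck_cst]. Qed.

Lemma smooth_at_id V (x : V) : smooth_at (@id V) x.
Proof. by exists setT; [split; [apply: openT|]|move=> k; apply: Ck_id]. Qed.

Lemma smooth_at2 V W X (f : V -> W) (h : V -> X) x : smooth_at f x -> smooth_at h x ->
  exists2 U, open_nbhs x U & forall k, Ck k U f /\ Ck k U h.
Proof.
move=> [U [oU Ux] Cf] [U' [oU' U'x] Ch].
exists (U `&` U') => [|k]; first by split; [apply: openI|].
by split; [apply: Ck_sub (Cf k)|apply: Ck_sub (Ch k)] => y [].
Qed.

Lemma smooth_atD V W (f h : V -> W) x : smooth_at f x -> smooth_at h x ->
  smooth_at (fun y => f y + h y) x.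
Proof.
move=> sf sh; have [U oU C] := smooth_at2 sf sh; exists U => // k.
by have [? ?] := C k; apply: CkD => //; case: oU.
Qed.

Lemma smooth_at_scale V W (a : V -> R) (f : V -> W) x : smooth_at a x -> smooth_at f x ->
  smooth_at (fun y => a y *: f y) x.
Proof.
move=> sf sh; have [U oU C] := smooth_at2 sf sh; exists U => // k.
by have [? ?] := C k; apply: Ck_scale => //; case: oU.
Qed.

Lemma smooth_at_sum V W (I : finType) (f : I -> V -> W) x :
  (forall i, smooth_at (f i) x) -> smooth_at (fun y => \sum_i f i y) x.
Proof.
move=> sf; rewrite /index_enum; elim: (Finite.enum _) => [|i r IH].
  by apply: smooth_at_near_eq (smooth_at_cst 0 x); apply: nearW => y; rewrite big_nil.
apply: smooth_at_near_eq (smooth_atD (sf i) IH).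
by apply: nearW => y; rewrite big_cons.
Qed.

Lemma smooth_at_pair V W X (f : V -> W) (h : V -> X) x : smooth_at f x -> smooth_at h x ->
  smooth_at (fun y => (f y, h y)) x.
Proof.
move=> sf sh; have [U oU C] := smooth_at2 sf sh; exists U => // k.
by have [? ?] := C k; apply: Ck_pair => //; case: oU.
Qed.

Lemma smooth_at_lin V W X (l : {linear W -> X}) (f : V -> W) x : continuous l ->
  smooth_at f x -> smooth_at (fun y => l (f y)) x.
Proof.
move=> cl [U oU Cf]; exists U => // k.
by apply: Ck_lin => //; case: oU.
Qed.

Lemma open_preimage V W (U : set V) (U' : set W) (f : V -> W) : open U -> open U' ->
  (forall x, U x -> {for x, continuous f}) -> open (U `&` f @^-1` U').
Proof.
move=> oU oU' cf; rewrite openE => x [Ux Ufx]; apply: filterI; first exact: open_nbhs_nbhs.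
by apply: (cf x Ux); apply: open_nbhs_nbhs.
Qed.

Lemma smooth_at_comp V W X (f : V -> W) (h : W -> X) x : findim W ->
  smooth_at f x -> smooth_at h (f x) -> smooth_at (h \o f) x.
Proof.
move=> fd [U [oU Ux] Cf] [U' [oU' U'x] Ch].
have oUU : open (U `&` f @^-1` U').
  by apply: open_preimage => // y Uy; apply: (Cf 0%N).
exists (U `&` f @^-1` U') => // k.
apply: (Ck_comp fd oUU oU') (Ch k) => [y []//|].
by apply: Ck_sub (Cf k) => y [].
Qed.

Lemma smooth_at_fst V W (x : V * W) : smooth_at (fst : V * W -> V) x.
Proof.
apply: (@smooth_at_lin _ _ _ (fst : {linear (V * W)%type -> V}) id) (smooth_at_id x).
by move=> y; apply: cvg_fst.
Qed.

Lemma smooth_at_snd V W (x : V * W) : smooth_at (snd : V * W -> W) x.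
Proof.
apply: (@smooth_at_lin _ _ _ (snd : {linear (V * W)%type -> W}) id) (smooth_at_id x).
by move=> y; apply: cvg_snd.
Qed.

End SmoothAt.

(** * Symmetry of second derivatives *)

Section Schwarz.
Context {R : realType}.
Implicit Types U V W X : normedModType R.

Lemma is_derive_line V W (f : V -> W) (y u : V) (s : R) : differentiable f (y + s *: u) ->
  is_derive s (1 : R) (fun s : R => f (y + s *: u)) ('D_u f (y + s *: u)).
Proof.
move=> df.
have dl : is_diff s (fun s : R => y + s *: u) (fun s => s *: u).
  have isD := @is_diffD R R V (cst y) (fun t : R => t *: u) 0 (fun t : R => t *: u) s (is_diff_cst y s) (is_diff_scalel s u).
  by apply: (is_diff_eq isD); apply/funext => t; rewrite fctE add0r.
have dc : differentiable (f \o (fun s : R => y + s *: u)) s.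
  by apply: differentiable_comp => //; case: dl.
apply: DeriveDef; first exact: diff_derivable dc.
have dld : differentiable (fun s : R => y + s *: u) s by case: dl.
rewrite -[LHS]/('D_1 (f \o (fun s : R => y + s *: u)) s) (derive_compo (1 : R) dld df).
by rewrite (deriveE (1 : R) dld) (diff_val (is_diff_def := dl)) scale1r (deriveE u df).
Qed.

Lemma MVT_line V (f : V -> R) (y u : V) (h : R) : 0 < h ->
  (forall s : R, 0 <= s <= h -> differentiable f (y + s *: u)) ->
  exists2 s : R, 0 < s < h & f (y + h *: u) - f y = h * 'D_u f (y + s *: u).
Proof.
move=> h0 df.
have [||s sh] := @MVT R (fun s => f (y + s *: u)) (fun s => 'D_u f (y + s *: u)) 0 h h0.
- by move=> s /itvP sh; apply: is_derive_line; apply: df; rewrite !sh.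
- apply/continuous_in_subspaceT => s; rewrite inE/= in_itv/= => sh.
  have := is_derive_line (df s sh) => -[ds _]; apply: differentiable_continuous.
  exact/derivable1_diffP.
rewrite scale0r addr0 subr0 mulrC => E; by exists s => //; move: sh; rewrite in_itv.
Qed.

Lemma second_difference_bound (F1 F2 F3 F0 A B h e : R) :
  F1 - F2 - (F3 - F0) = h * A * h -> `|B - A| < e ->
  `|F1 - F2 - F3 + F0 - h ^+ 2 * B| <= e * h ^+ 2.
Proof.
move=> E BA; have -> : F1 - F2 - F3 + F0 = h * A * h by rewrite -E; ring.
have -> : h * A * h - h ^+ 2 * B = h ^+ 2 * (A - B) by ring.
rewrite normrM ger0_norm ?sqr_ge0// mulrC ler_wpM2r ?sqr_ge0//.
by rewrite distrC ltW.
Qed.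

Lemma mixed_bound (F0 F1 F2 F3 a b h e : R) : 0 < h ->
  `|F1 - F2 - F3 + F0 - h ^+ 2 * a| <= e / 2 * h ^+ 2 ->
  `|F1 - F3 - F2 + F0 - h ^+ 2 * b| <= e / 2 * h ^+ 2 -> `|a - b| <= e.
Proof.
move=> h0 H1 H2; have hh0 : 0 < h ^+ 2 by rewrite exprn_gt0.
rewrite -(ler_pM2l hh0) -[X in X * `|_|](ger0_norm (ltW hh0)) -normrM.
have -> : h ^+ 2 * (a - b) = (F1 - F3 - F2 + F0 - h ^+ 2 * b) - (F1 - F2 - F3 + F0 - h ^+ 2 * a) by ring.
apply: le_trans (ler_normB _ _) _; apply: le_trans (lerD H2 H1) _.
by rewrite -mulrDl -splitr mulrC.
Qed.

(** The mean value theorem is used twice: in direction u for s |-> f(x + h v + s u) - f(x + s u),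
    then in direction v for D_u f. The second difference is thus h^2 times a mixed derivative at a
    nearby point. *)
Lemma second_difference V (f : V -> R) (x u v : V) : smooth_at f x ->
  forall e : R, 0 < e -> exists2 d : R, 0 < d & forall h, 0 < h < d ->
   `|f (x + h *: u + h *: v) - f (x + h *: u) - f (x + h *: v) + f x
     - h ^+ 2 * 'D_v ('D_u f) x| <= e * h ^+ 2.
Proof.
move=> sf e e0.
have sDf := smooth_at_derive u sf; have sDDf := smooth_at_derive v sDf.
have : \forall y \near x, [/\ differentiable f y, differentiable ('D_u f) y
    & `|'D_v ('D_u f) x - 'D_v ('D_u f) y| < e].
  have n1 := smooth_at_near sf; have n2 := smooth_at_near sDf.
  have /cvgrPdist_lt/(_ e e0) n3 := smooth_at_continuous sDDf.
  near=> y; split; [apply: smooth_at_differentiable; near: y; exact: n1| |near: y; exact: n3].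
  by apply: smooth_at_differentiable; near: y; exact: n2.
move=> /nbhs_normP[r /= r0 near_x].
(* If h c < r, the parallelogram spanned by h u and h v at x stays in the ball of radius r; the
   summand 1 keeps c positive. *)
pose c := `|u| + `|v| + 1; have c0 : 0 < c by rewrite ltr_wpDl// addr_ge0.
exists (r / c); first exact: divr_gt0.
move=> h /andP[h0 hr].
have inb s t : 0 <= s <= h -> 0 <= t <= h -> ball_ Num.norm x r (x + s *: u + t *: v).
  move=> /andP[s0 sh] /andP[t0 th]; rewrite /ball_/= -addrA opprD addrA subrr add0r normrN.
  apply: le_lt_trans (ler_normD _ _) _; rewrite !normrZ !ger0_norm//.
  have : s * `|u| + t * `|v| <= h * `|u| + h * `|v| by rewrite lerD// ler_wpM2r.
  move=> /le_lt_trans; apply; rewrite -mulrDr.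
  by apply: le_lt_trans (_ : h * c < r); rewrite ?ler_pM2l ?lerDl// -ltr_pdivlMr.
have hh : 0 <= h <= h by rewrite lexx ltW.
pose F s := f (x + h *: v + s *: u) - f (x + s *: u).
pose dF s := 'D_u f (x + h *: v + s *: u) - 'D_u f (x + s *: u).
have isF s : 0 <= s <= h -> is_derive s (1 : R) F (dF s).
  move=> sh; apply: is_deriveB; apply: is_derive_line.
    by rewrite addrAC; have [] := near_x _ (inb s h sh hh).
  by have [] := near_x _ (inb s 0 sh _); rewrite ?scale0r ?addr0 ?lexx ?ltW.
have [||s sh] := @MVT R F dF 0 h h0.
- by move=> s /itvP sh; apply: isF; rewrite !sh.
- apply/continuous_in_subspaceT => s; rewrite inE/= in_itv/= => sh.
  have := isF s sh => -[ds _]; apply: differentiable_continuous.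
  exact/derivable1_diffP.
rewrite subr0 /F /dF scale0r !addr0 => E1.
have sh' : 0 <= s <= h by move: sh => /itvP sh; rewrite !sh.
have [|t th] := @MVT_line V ('D_u f) (x + s *: u) v h h0.
  by move=> t th; have [] := near_x _ (inb s t sh' th).
rewrite -addrA [s *: u + _]addrC addrA => E2.
rewrite E2 in E1.
have th' : 0 <= t <= h by case/andP: th => *; rewrite !ltW.
have [_ _ near_st] := near_x _ (inb s t sh' th').
rewrite [x + h *: u + _]addrAC.
exact: (second_difference_bound E1 near_st).
Unshelve. all: by end_near. Qed.

(** The second difference is symmetric in u and v and approximates h^2 times either mixed
    derivative. *)
Lemma schwarz_real V (f : V -> R) (x u v : V) : smooth_at f x ->
  'D_v ('D_u f) x = 'D_u ('D_v f) x.
Proof.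
move=> sf.
have Haux e : 0 < e -> `|('D_v ('D_u f) x : R) - 'D_u ('D_v f) x| <= e.
  move=> e0; have e2 : 0 < e / 2 by apply: divr_gt0.
  have [d1 d10 H1] := second_difference u v sf e2.
  have [d2 d20 H2] := second_difference v u sf e2.
  have m0 : 0 < Num.min d1 d2 by rewrite lt_min d10.
  pose h := Num.min d1 d2 / 2; have h0 : 0 < h by apply: divr_gt0.
  have hm : h < Num.min d1 d2 by rewrite /h ltr_pdivrMr// ltr_pMr// ltr1n.
  move: hm; rewrite lt_min => /andP[hd1 hd2].
  have {}H1 := H1 h; have {}H2 := H2 h; rewrite h0 hd1 in H1; rewrite h0 hd2 in H2.
  have {}H1 := H1 isT; have {}H2 := H2 isT.
  rewrite [x + h *: v + h *: u]addrAC in H2.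
  exact: (mixed_bound h0 H1 H2).
move: Haux; move: ('D_v _ x) ('D_u _ x) => a b Haux.
apply/eqP; rewrite -subr_eq0 -normr_le0; apply/ler_addgt0Pr => e e0.
by rewrite add0r; exact: Haux.
Qed.

Lemma schwarz V W (f : V -> W) (x u v : V) : findim W -> smooth_at f x ->
  'D_v ('D_u f) x = 'D_u ('D_v f) x.
Proof.
move=> [I [e [c [cc ce]]]] sf.
have key u' v' i : c i ('D_v' ('D_u' f) x) = 'D_v' ('D_u' (fun y => c i (f y))) x.
  have dDf : differentiable ('D_u' f) x by apply/smooth_at_differentiable/smooth_at_derive.
  have [_ <-] := derive_comp_lin (cc i) dDf.
  apply: near_eq_derive; apply: filterS (smooth_at_near sf) => y sfy.
  by have [_ ->] := derive_comp_lin (cc i) (smooth_at_differentiable sfy).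
have key2 i : c i ('D_v ('D_u f) x) = c i ('D_u ('D_v f) x).
  by rewrite !key; apply: schwarz_real; apply: smooth_at_lin.
by rewrite (ce ('D_v _ x)) (ce ('D_u _ x)); apply: eq_bigr => i _; rewrite key2.
Qed.

End Schwarz.

(** * Families of linear maps and related vector fields *)

Section PullbackOfForms.
Context {R : realType}.
Implicit Types U V W X : normedModType R.

Lemma derive_sum_fin V W (I : finType) (T : I -> V -> W) x :
  (forall i, differentiable (T i) x) ->
  differentiable (fun y => \sum_i T i y) x /\
  forall v, 'D_v (fun y => \sum_i T i y) x = \sum_i 'D_v (T i) x.
Proof.
move=> dT; rewrite /index_enum; elim: (Finite.enum _) => [|i r [IHd IHD]].
  have -> : (fun y => \sum_(i <- [::]) T i y) = (fun=> 0).
    by apply/funext => y; rewrite big_nil.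
  split=> [|v]; first exact: differentiable_cst.
  by rewrite big_nil; apply: derive_cst.
have -> : (fun y => \sum_(i <- i :: r) T i y) = (fun y => T i y + \sum_(i <- r) T i y).
  by apply/funext => y; rewrite big_cons.
split=> [|v]; first exact: differentiableD.
by rewrite big_cons -IHD; apply: deriveD; apply: diff_derivable.
Qed.

(** A product rule for w(f(y), s(y)), where w is linear in its second argument and differentiable in
    the first for each fixed vector; expanding s along fixed directions reduces it to products of
    scalars and vectors. *)
Lemma derive_form V V' V'' W (w : V'' -> V' -> W) (f : V -> V'') (s : V -> V') x : findim V' ->
  (\forall y \near f x, linear (w y)) ->
  (forall v, differentiable (w^~ v) (f x)) -> differentiable f x -> differentiable s x ->
  differentiable (fun y => w (f y) (s y)) x /\
  forall v, 'D_v (fun y => w (f y) (s y)) x =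
    'D_('D_v f x) (w^~ (s x)) (f x) + w (f x) ('D_v s x).
Proof.
move=> [I [e [c [cc ce]]]] lw dw df ds.
have wE y v : linear (w y) -> w y v = \sum_i c i v *: w y (e i).
  move=> ly; pose wy : {linear V' -> W} := HB.pack (w y) (GRing.isLinear.Build R V' W *:%R (w y) ly).
  rewrite -[w y v]/(wy v) [in LHS](ce v) linear_sum; apply: eq_bigr => i _.
  by rewrite linearZ.
have lwx : linear (w (f x)) by apply: nbhs_singleton lw.
pose T i y := c i (s y) *: w (f y) (e i).
have dT i : differentiable (T i) x /\ forall v, 'D_v (T i) x =
    c i (s x) *: 'D_('D_v f x) (w^~ (e i)) (f x) + c i ('D_v s x) *: w (f x) (e i).
  have [dcs Dcs] := derive_comp_lin (cc i) ds.
  have dwf : differentiable (w^~ (e i) \o f) x by apply: differentiable_comp.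
  have [dTi DTi] := derive_scale dcs dwf.
  split=> // v; rewrite DTi Dcs derive_compo//.
  by rewrite (deriveE _ (dw (e i))).
have nearE : \forall y \near x, \sum_i T i y = w (f y) (s y).
  have : \forall y \near x, linear (w (f y)).
    exact: (differentiable_continuous df) lw.
  by apply: filterS => y ly; rewrite [RHS]wE.
have [dsum Dsum] := derive_sum_fin (fun i => (dT i).1).
split=> [|v]; first exact: near_eq_differentiable nearE dsum.
rewrite -(near_eq_derive v nearE) Dsum.
have nearE' : \forall y \near f x, \sum_i (c i (s x) *: w y (e i)) = w y (s x).
  by apply: filterS lw => y ly; rewrite [RHS]wE.
have dcw i : differentiable (fun y => c i (s x) *: w y (e i)) (f x).
  by apply: differentiableZ; apply: dw.
have [_ Dsum'] := derive_sum_fin dcw.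
rewrite -(near_eq_derive _ nearE') Dsum' (wE (f x) ('D_v s x))// -big_split.
apply: eq_bigr => i _; rewrite (dT i).2; congr (_ + _).
by rewrite [RHS]deriveZ//; apply: diff_derivable; apply: dw.
Qed.

End PullbackOfForms.

Section SmoothInverse.
Context {R : realType}.
Implicit Types U V W X : normedModType R.

Lemma findim_linear_continuous V W (l : {linear V -> W}) : findim V -> continuous l.
Proof.
move=> [I [e [c [cc ce]]]].
have -> : (l : V -> W) = (fun v => \sum_i c i v *: l (e i)).
  by apply/funext => v; rewrite [in LHS](ce v) linear_sum; apply: eq_bigr => i _; rewrite linearZ.
move=> x; apply: differentiable_continuous; apply: (derive_sum_fin _).1 => i.
have dc : differentiable (c i) x by apply: linear_differentiable.
by have [] := derive_scale dc (differentiable_cst (l (e i)) x).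
Qed.

Lemma smooth_atN V W (f : V -> W) x : smooth_at f x -> smooth_at (fun y => - f y) x.
Proof.
move=> sf; apply: smooth_at_near_eq (smooth_at_scale (smooth_at_cst (-1 : R) x) sf).
by apply: nearW => y; rewrite scaleN1r.
Qed.

Lemma smooth_atB V W (f h : V -> W) x : smooth_at f x -> smooth_at h x ->
  smooth_at (fun y => f y - h y) x.
Proof. by move=> sf /smooth_atN; apply: smooth_atD. Qed.

Lemma smooth_atM V (f h : V -> R) x : smooth_at f x -> smooth_at h x ->
  smooth_at (fun y => f y * h y) x.
Proof. exact: smooth_at_scale. Qed.

Lemma smooth_at_prod V (I : finType) (f : I -> V -> R) x :
  (forall i, smooth_at (f i) x) -> smooth_at (fun y => \prod_i f i y) x.
Proof.
move=> sf; rewrite /index_enum; elim: (Finite.enum _) => [|i r IH].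
  by apply: smooth_at_near_eq (@smooth_at_cst R V R 1 x); apply: nearW => y; rewrite big_nil.
apply: smooth_at_near_eq (smooth_atM (sf i) IH).
by apply: nearW => y; rewrite big_cons.
Qed.

Lemma Ck_inv V k (U : set V) (f : V -> R) : open U -> (forall x, U x -> f x != 0) ->
  Ck k U f -> Ck k U (fun x => (f x)^-1).
Proof.
move=> oU f0; elim: k => [|k IH].
  by move=> cf x Ux; apply: cvgV; [apply: f0|apply: cf].
move=> Cf; have CfW := CkW Cf; have [df Cf'] := Cf; split=> [x Ux|v].
  by apply: differentiableV; [apply: df|apply: f0].
apply: (@Ck_ext _ _ _ _ _ (fun x => (- ((f x)^-1 * (f x)^-1)) *: 'D_v f x)) => [//|x Ux|].
  rewrite [RHS]deriveV ?f0//; last by apply: diff_derivable; apply: df.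
  by rewrite expr2 invfM.
apply: Ck_scale => //; last exact: Cf'.
apply: (@Ck_ext _ _ _ _ _ (fun x => (-1 : R) *: ((f x)^-1 *: (f x)^-1))) => [//|x Ux|].
  by rewrite scaleN1r.
by apply: Ck_scale => //; [apply: Ck_cst|apply: Ck_scale => //; apply: IH].
Qed.

Lemma smooth_at_inv V (f : V -> R) x : f x != 0 -> smooth_at f x ->
  smooth_at (fun y => (f y)^-1) x.
Proof.
move=> f0 sf; have : \forall y \near x, f y != 0.
  have cf : f @ x --> f x := smooth_at_continuous sf.
  by apply: (cf [set r : R | r != 0]); apply: open_nbhs_nbhs; split => //; apply: open_neq.
rewrite -[X in X -> _]/(nbhs x [set y | f y != 0]) nbhsE => -[U' [oU' U'x] fn0].
case: sf => U [oU Ux] Cf; exists (U `&` U') => [|k]; first by split; [apply: openI|].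
apply: Ck_inv; [exact: openI|by move=> y [_ /fn0]|].
by apply: Ck_sub (Cf k) => y [].
Qed.

Lemma smooth_at_det V n (M : V -> 'M[R]_n) x : (forall i j, smooth_at (fun y => M y i j) x) ->
  smooth_at (fun y => \det (M y)) x.
Proof.
move=> sM; rewrite /determinant; apply: smooth_at_sum => s.
apply: smooth_atM; first exact: smooth_at_cst.
by apply: smooth_at_prod => i.
Qed.

Lemma smooth_at_invmx V n (M : V -> 'M[R]_n) x : (\forall y \near x, M y \in unitmx) ->
  (forall i j, smooth_at (fun y => M y i j) x) ->
  forall i j, smooth_at (fun y => invmx (M y) i j) x.
Proof.
move=> uM sM i j.
apply: (@smooth_at_near_eq _ _ _ (fun y => (\det (M y))^-1 * \adj (M y) i j)).
  by apply: filterS uM => y uMy; rewrite /invmx uMy [RHS]mxE.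
apply: smooth_atM.
  apply: smooth_at_inv; last exact: smooth_at_det.
  by have := nbhs_singleton uM; rewrite unitmxE unitfE.
apply: (@smooth_at_near_eq _ _ _ (fun y => cofactor (M y) j i)).
  by apply: nearW => y; rewrite mxE.
apply: smooth_atM; first exact: smooth_at_cst.
apply: smooth_at_det => i' j'.
by apply: smooth_at_near_eq (sM (lift j i') (lift i j')); apply: nearW => y; rewrite !mxE.
Qed.

Lemma smooth_at_row V n (f : V -> 'rV[R]_n) x :
  (forall j, smooth_at (fun y => f y 0 j) x) -> smooth_at f x.
Proof.
move=> sf; apply: (@smooth_at_near_eq _ _ _ (fun y => \sum_j f y 0 j *: delta_mx 0 j)).
  by apply: nearW => y; rewrite -row_sum_delta.
by apply: smooth_at_sum => j; apply: smooth_at_scale => //; apply: smooth_at_cst.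
Qed.

Lemma smooth_at_coord V n (f : V -> 'rV[R]_n) x j : smooth_at f x ->
  smooth_at (fun y => f y 0 j) x.
Proof.
move=> sf.
pose l : {linear 'rV[R]_n -> R} := HB.pack (fun v : 'rV[R]_n => v 0 j : R)
  (GRing.isLinear.Build R 'rV[R]_n R *%R (fun v : 'rV[R]_n => v 0 j) (@coord_linear R n j)).
by apply: (@smooth_at_lin _ _ _ _ l) => //; apply: findim_linear_continuous; apply: findim_rV.
Qed.

Lemma smooth_at_form V V' W (w : V -> V' -> W) (s : V -> V') x : findim V' ->
  (\forall y \near x, linear (w y)) -> (forall v, smooth_at (w^~ v) x) -> smooth_at s x ->
  smooth_at (fun y => w y (s y)) x.
Proof.
move=> [I [e [c [cc ce]]]] lw sw ss.
apply: (@smooth_at_near_eq _ _ _ (fun y => \sum_i c i (s y) *: w y (e i))).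
  apply: filterS lw => y ly.
  pose wy : {linear V' -> W} := HB.pack (w y) (GRing.isLinear.Build R V' W *:%R (w y) ly).
  rewrite -[RHS]/(wy (s y)) [in RHS](ce (s y)) linear_sum; apply: eq_bigr => i _.
  by rewrite linearZ.
by apply: smooth_at_sum => i; apply: smooth_at_scale => //; apply: smooth_at_lin.
Qed.

(** Composing w(y) with the inverse frozen at x gives a square matrix M(y), invertible near x, with
    smooth inverse by Cramer's rule; in row notation h(y) z = h(x) z M(y)^(-1). *)
Lemma smooth_at_inverse V n (W : normedModType R) (w : V -> 'rV[R]_n -> W) (h : V -> W -> 'rV[R]_n) x (z : W) :
  findim W ->
  (\forall y \near x, [/\ linear (w y), linear (h y), cancel (w y) (h y) & cancel (h y) (w y)]) ->
  (forall v, smooth_at (w^~ v) x) -> smooth_at (h^~ z) x.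
Proof.
move=> fW near_wh sw.
have [_ lh0 wh0 hw0] := nbhs_singleton near_wh.
pose H : {linear W -> 'rV[R]_n} := HB.pack (h x) (GRing.isLinear.Build R W 'rV[R]_n *:%R (h x) lh0).
pose M y : 'M[R]_n := \matrix_i h x (w y (delta_mx 0 i)).
have ME y v : linear (w y) -> v *m M y = h x (w y v).
  move=> ly; pose wy : {linear 'rV[R]_n -> W} := HB.pack (w y) (GRing.isLinear.Build R 'rV[R]_n W *:%R (w y) ly).
  rewrite -[RHS]/(H (wy v)) [in RHS](row_sum_delta v) !linear_sum/= mulmx_sum_row.
  by apply: eq_bigr => i _; rewrite rowK -[RHS]/(H (wy (v 0 i *: delta_mx 0 i))) !linearZ.
have uM : \forall y \near x, M y \in unitmx.
  apply: filterS near_wh => y [ly lhy why hwy].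
  rewrite -row_free_unit -kermx_eq0; apply/rowV0P => v /sub_kermxP; rewrite ME// => h0.
  have h00 : h x 0 = 0 by exact: (linear0 H).
  have w0 : w y v = 0 by rewrite -[LHS]hw0 h0 -h00 hw0.
  by rewrite -[v]why w0 -[0 in LHS](linear0 (HB.pack (w y) (GRing.isLinear.Build R 'rV[R]_n W *:%R (w y) ly) : {linear 'rV[R]_n -> W})) /= why.
have sM i j : smooth_at (fun y => M y i j) x.
  apply: (@smooth_at_near_eq _ _ _ (fun y => (H (w y (delta_mx 0 i))) 0 j)).
    by apply: nearW => y; rewrite mxE.
  by apply: smooth_at_coord; apply: (@smooth_at_lin _ _ _ _ H) => //; apply: findim_linear_continuous.
apply: (@smooth_at_near_eq _ _ _ (fun y => h x z *m invmx (M y))).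
  near=> y; have [ly lhy why hwy] : [/\ linear (w y), linear (h y), cancel (w y) (h y) & cancel (h y) (w y)].
    by near: y; exact: near_wh.
  have uMy : M y \in unitmx by near: y; exact: uM.
  by apply: (can_inj (mulmxK uMy)); rewrite mulmxKV// ME// hwy.
apply: smooth_at_row => j.
apply: (@smooth_at_near_eq _ _ _ (fun y => \sum_i h x z 0 i * invmx (M y) i j)).
  by apply: nearW => y; rewrite mxE.
apply: smooth_at_sum => i; apply: smooth_atM; first exact: smooth_at_cst.
exact: smooth_at_invmx.
Unshelve. all: by end_near. Qed.

Lemma near_diffE V W (f : V -> W) x v : smooth_at f x -> \forall y \near x, 'D_v f y = 'd f y v.
Proof.
by move=> sf; apply: filterS (smooth_at_near sf) => y /smooth_at_differentiable dfy; rewrite deriveE.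
Qed.

(** Differentiating df(b) = z o f along a gives D_(df a) z = D_a D_b f + df(D_a b). In the
    difference of two such equations the second derivatives of f cancel by [schwarz]. *)
Lemma bracket_related V V' (f : V -> V') (x1 x2 : V -> V) (z1 z2 : V' -> V') x :
  findim V -> findim V' -> smooth_at f x ->
  differentiable x1 x -> differentiable x2 x ->
  differentiable z1 (f x) -> differentiable z2 (f x) ->
  (\forall y \near x, 'd f y (x1 y) = z1 (f y)) ->
  (\forall y \near x, 'd f y (x2 y) = z2 (f y)) ->
  'D_(z1 (f x)) z2 (f x) - 'D_(z2 (f x)) z1 (f x) =
  'd f x ('D_(x1 x) x2 x - 'D_(x2 x) x1 x).
Proof.
move=> fV fV' sf dx1 dx2 dz1 dz2 r1 r2; have df := smooth_at_differentiable sf.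
have half (a b : V -> V) (z : V' -> V') (za : V') : differentiable b x -> differentiable z (f x) ->
    (\forall y \near x, 'd f y (b y) = z (f y)) -> 'd f x (a x) = za ->
    'D_za z (f x) = 'D_(a x) ('D_(b x) f) x + 'd f x ('D_(a x) b x).
  move=> db dz rb raE; rewrite -raE (deriveE _ dz) -(deriveE (a x) df) -(derive_compo (a x) df dz).
  rewrite -(near_eq_derive (a x) (rb : \forall y \near x, _ = (z \o f) y)).
  have dwf v : differentiable (fun y => 'd f y v) x /\
      'D_(a x) (fun y => 'd f y v) x = 'D_(a x) ('D_v f) x.
    have nE := near_diffE v sf; split; last by rewrite (near_eq_derive _ nE).
    by apply: near_eq_differentiable nE _; apply/smooth_at_differentiable/smooth_at_derive.
  have lw : \forall y \near id x, linear ('d f y : V -> V') by apply: nearW => y; apply: linearP.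
  have did : differentiable (@id V) x by apply/smooth_at_differentiable/smooth_at_id.
  have [_ ->] := @derive_form R V V V V' (fun y => 'd f y : V -> V') id b x fV lw (fun v => (dwf v).1) did db.
  by rewrite derive_id (dwf (b x)).2.
rewrite (half x1 x2 z2)//; last exact: nbhs_singleton r1.
rewrite (half x2 x1 z1)//; last exact: nbhs_singleton r2.
by rewrite linearB/= (schwarz (x1 x) (x2 x) fV' sf) opprD addrACA subrr add0r.
Qed.
End SmoothInverse.

Lemma cvg_near (T U : topologicalType) (f : T -> U) (x : T) (y : U) (P : U -> Prop) :
  f @ x --> y -> (\forall z \near y, P z) -> \forall t \near x, P (f t).
Proof. by move=> fxy yP; apply: (fxy P yP). Qed.

(* A locked copy of the differential, to keep unification from unfolding it. *)
Fact dif_key : unit. Proof. exact: tt. Qed.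
Definition dif (R : realType) (V W : normedModType R) (f : V -> W) (x v : V) : W :=
  locked_with dif_key (fun v => 'd f x v) v.

Section Dif.
Context {R : realType}.
Implicit Types V W X : normedModType R.

Lemma difE V W (f : V -> W) (x v : V) : dif f x v = 'd f x v.
Proof. by rewrite /dif unlock. Qed.

Lemma dif_linear V W (f : V -> W) (x : V) : linear (dif f x).
Proof. by move=> a u v; rewrite !difE; apply: linearP. Qed.

HB.instance Definition _ V W (f : V -> W) (x : V) :=
  GRing.isLinear.Build R V W *:%R (dif f x) (dif_linear f x).

Lemma dif_derive V W (f : V -> W) (x v : V) : differentiable f x -> dif f x v = 'D_v f x.
Proof. by move=> df; rewrite difE deriveE. Qed.

Lemma near_eq_dif V W (f h : V -> W) (x v : V) : (\forall y \near x, f y = h y) ->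
  differentiable f x -> dif h x v = dif f x v.
Proof. by move=> fh df; rewrite !difE; apply: (congr1 (fun k => k v) (near_eq_diff fh df)). Qed.

Lemma dif_comp V W X (f : V -> W) (h : W -> X) (x v : V) : differentiable f x ->
  differentiable h (f x) -> dif (h \o f) x v = dif h (f x) (dif f x v).
Proof. by move=> df dh; rewrite !difE; apply: (congr1 (fun k => k v) (diff_comp df dh)). Qed.

Lemma dif_id V (x v : V) : dif id x v = v.
Proof. by rewrite difE; apply: (congr1 (fun k => k v) (diff_val (is_diff_def := is_diff_id x))). Qed.

Lemma dif_cst V W (a : W) (x v : V) : dif (fun=> a) x v = 0.
Proof. by rewrite dif_derive ?derive_cst//; apply: differentiable_cst. Qed.

Lemma smooth_at_dif V W (f : V -> W) x v : smooth_at f x -> smooth_at (fun y => dif f y v) x.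
Proof.
move=> sf; apply: smooth_at_near_eq (smooth_at_derive v sf).
by apply: filterS (smooth_at_near sf) => y /smooth_at_differentiable dfy; rewrite dif_derive.
Qed.

Lemma dif_bracket_related V W (f : V -> W) (x1 x2 : V -> V) (z1 z2 : W -> W) x :
  findim V -> findim W -> smooth_at f x ->
  smooth_at x1 x -> smooth_at x2 x -> smooth_at z1 (f x) -> smooth_at z2 (f x) ->
  (\forall y \near x, dif f y (x1 y) = z1 (f y)) ->
  (\forall y \near x, dif f y (x2 y) = z2 (f y)) ->
  'D_(z1 (f x)) z2 (f x) - 'D_(z2 (f x)) z1 (f x) =
  dif f x ('D_(x1 x) x2 x - 'D_(x2 x) x1 x).
Proof.
move=> fV fW sf s1 s2 t1 t2 r1 r2; rewrite difE; apply: bracket_related => //;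
  try exact: smooth_at_differentiable.
- by apply: filterS r1 => y <-; rewrite difE.
- by apply: filterS r2 => y <-; rewrite difE.
Qed.
End Dif.

(** * Charts and vector fields *)

Section Charts.
Context {R : realType} {n : nat} {M : manifoldType R n}.
Implicit Types a x z : M.
Local Notation ch := (@chart_at R n M).

Lemma chartK a z : psrc (ch a) z -> pbwd (ch a) (ch a z) = z.
Proof. by case: (chart_at_homeo a) => -[_ _ h _] _ _ _ _; apply: h. Qed.

Lemma chart_tgt a z : psrc (ch a) z -> ptgt (ch a) (ch a z).
Proof. by case: (chart_at_homeo a) => -[h _ _ _] _ _ _ _; apply: h. Qed.

Lemma chart_bwd_src a y : ptgt (ch a) y -> psrc (ch a) (pbwd (ch a) y).
Proof. by case: (chart_at_homeo a) => -[_ h _ _] _ _ _ _; apply: h. Qed.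

Lemma chart_bwdK a y : ptgt (ch a) y -> ch a (pbwd (ch a) y) = y.
Proof. by case: (chart_at_homeo a) => -[_ _ _ h] _ _ _ _; apply: h. Qed.

Lemma chart_continuous a z : psrc (ch a) z -> ch a @ z --> ch a z.
Proof. by case: (chart_at_homeo a) => _ _ _ h _; apply: h. Qed.

Lemma chart_bwd_continuous a z : psrc (ch a) z -> pbwd (ch a) @ ch a z --> z.
Proof.
move=> az; rewrite -[X in _ --> X](chartK az).
by case: (chart_at_homeo a) => _ _ _ _ h; apply: h; apply: chart_tgt.
Qed.

Lemma near_chart_src a z : psrc (ch a) z -> \forall y \near z, psrc (ch a) y.
Proof. by case: (chart_at_homeo a) => _ o _ _ _ az; apply: open_nbhs_nbhs. Qed.

Lemma near_chart_tgt a z : psrc (ch a) z -> \forall y \near ch a z, ptgt (ch a) y.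
Proof.
by case: (chart_at_homeo a) => _ _ o _ _ az; apply: open_nbhs_nbhs; split => //; apply: chart_tgt.
Qed.

End Charts.

(** * Coordinate representatives and tangent maps *)

Section Representatives.
Context {R : realType}.

(** The charts at a and b are arbitrary, not the preferred ones at the argument and its value:
    derivatives need charts that stay fixed while the point moves. *)
Definition rep n m (M : manifoldType R n) (N : manifoldType R m) (a : M) (b : N)
  (f : M -> N) : 'rV[R]_n -> 'rV[R]_m := chart_at b \o f \o pbwd (chart_at a).

Lemma rep_id_smooth n (M : manifoldType R n) (a b z : M) : psrc (chart_at a) z ->
  psrc (chart_at b) z -> smooth_at (rep a b id) (chart_at a z).
Proof. exact: chart_at_smooth. Qed.

Lemma rep_near_eq n m (M : manifoldType R n) (N : manifoldType R m) (f h : M -> N) a b z : psrc (chart_at a) z ->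
  (\forall y \near z, f y = h y) ->
  \forall y \near chart_at a z, rep a b f y = rep a b h y.
Proof.
move=> az fh; have := cvg_near (chart_bwd_continuous az) fh.
by apply: filterS => y /= e; rewrite /rep /= e.
Qed.

Lemma repE n m (M : manifoldType R n) (N : manifoldType R m) (f : M -> N) a b z : psrc (chart_at a) z -> rep a b f (chart_at a z) = chart_at b (f z).
Proof. by move=> az; rewrite /rep/= chartK. Qed.

Section Rep.
Context {n m l : nat} {M : manifoldType R n} {N : manifoldType R m} {L : manifoldType R l}.

Lemma near_rep_comp (f : M -> N) (h : N -> L) a b c z : {for z, continuous f} ->
  psrc (chart_at a) z -> psrc (chart_at b) (f z) ->
  \forall y \near chart_at a z, (rep b c h \o rep a b f) y = rep a c (h \o f) y.
Proof.
move=> cf az bfz; have n1 : \forall y \near z, psrc (chart_at b) (f y) := cvg_near cf (near_chart_src bfz).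
have n2 := cvg_near (chart_bwd_continuous az) n1.
by apply: filterS n2 => y /= by_; rewrite /rep /= chartK.
Qed.

(** The composite is a separate variable k tied by an equation, so that the lemma also covers
    changes of charts, where f or h is the identity and k is the other map itself. *)
Lemma rep_comp (f : M -> N) (h : N -> L) (k : M -> L) a b c z : k = h \o f ->
  {for z, continuous f} -> psrc (chart_at a) z -> psrc (chart_at b) (f z) ->
  smooth_at (rep a b f) (chart_at a z) -> smooth_at (rep b c h) (chart_at b (f z)) ->
  smooth_at (rep a c k) (chart_at a z) /\
  forall v, dif (rep a c k) (chart_at a z) v =
    dif (rep b c h) (chart_at b (f z)) (dif (rep a b f) (chart_at a z) v).
Proof.
move=> -> cf az bfz sf sh; have nE := near_rep_comp h c cf az bfz.
rewrite -(repE f b az) in sh *.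
have sc : smooth_at (rep b c h \o rep a b f) (chart_at a z).
  by apply: smooth_at_comp => //; apply: findim_rV.
split=> [|v]; first exact: smooth_at_near_eq nE sc.
rewrite (near_eq_dif v nE (smooth_at_differentiable sc)).
by rewrite dif_comp//; exact: smooth_at_differentiable.
Qed.
End Rep.

Section Msmooth.
Context {n m l : nat} {M : manifoldType R n} {N : manifoldType R m} {L : manifoldType R l}.

(** The change of coordinates of the tangent space at z, from the chart at a to the chart at b. *)
Definition trans q (Q : manifoldType R q) (a b z : Q) : 'rV[R]_q -> 'rV[R]_q :=
  dif (rep a b id) (chart_at a z).
HB.instance Definition _ q (Q : manifoldType R q) (a b z : Q) :=
  GRing.isLinear.Build R 'rV[R]_q 'rV[R]_q *:%R (trans a b z)
    (dif_linear (rep a b id) (chart_at a z)).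

Definition tmap (f : M -> N) (z : M) : 'rV[R]_n -> 'rV[R]_m :=
  dif (rep z (f z) f) (chart_at z z).
HB.instance Definition _ (f : M -> N) (z : M) :=
  GRing.isLinear.Build R 'rV[R]_n 'rV[R]_m *:%R (tmap f z)
    (dif_linear (rep z (f z) f) (chart_at z z)).

Lemma tmapE (f : M -> N) z v : mdiff f z v = tmap f z v.
Proof. by rewrite /tmap difE. Qed.

Lemma trans_id q (Q : manifoldType R q) (a z : Q) v : psrc (chart_at a) z -> trans a a z v = v.
Proof.
move=> az; rewrite /trans; have nE : \forall y \near chart_at a z, id y = rep a a id y.
  by apply: filterS (near_chart_tgt az) => y ty; rewrite /rep/= chart_bwdK.
have did : differentiable (@id 'rV[R]_q) (chart_at a z) by apply/smooth_at_differentiable/smooth_at_id.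
by rewrite (near_eq_dif v nE did) dif_id.
Qed.

Lemma trans_comp q (Q : manifoldType R q) (a b c z : Q) v : psrc (chart_at a) z ->
  psrc (chart_at b) z -> psrc (chart_at c) z ->
  trans b c z (trans a b z v) = trans a c z v.
Proof.
move=> az bz cz; rewrite /trans.
have [_ h] := @rep_comp _ _ _ Q Q Q id id id a b c z erefl (fun _ h => h) az bz
  (rep_id_smooth az bz) (rep_id_smooth bz cz).
exact: esym (h v).
Qed.

Lemma transK q (Q : manifoldType R q) (a b z : Q) : psrc (chart_at a) z ->
  psrc (chart_at b) z -> cancel (trans a b z) (trans b a z).
Proof. by move=> az bz v; rewrite trans_comp// trans_id. Qed.

Lemma msmooth_rep (f : M -> N) a b z : msmooth_at f z -> psrc (chart_at a) z ->
  psrc (chart_at b) (f z) -> smooth_at (rep a b f) (chart_at a z) /\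
  forall v, dif (rep a b f) (chart_at a z) v = trans (f z) b (f z) (tmap f z (trans a z z v)).
Proof.
move=> [cf sf] az bfz; have zz := chart_at_src z; have fzz := chart_at_src (f z).
have [s1 d1] := @rep_comp _ _ _ M M N id f f a z (f z) z erefl (fun _ h => h) az zz (rep_id_smooth az zz) sf.
have [s2 d2] := @rep_comp _ _ _ M N N f id f a (f z) b z erefl cf az fzz s1 (rep_id_smooth fzz bfz).
split=> // v; apply: etrans (d2 v) _; rewrite /trans /tmap; congr dif; exact: d1.
Qed.

Lemma msmooth_near_eq (f h : M -> N) z : (\forall y \near z, f y = h y) -> msmooth_at f z ->
  msmooth_at h z /\ forall v, tmap h z v = tmap f z v.
Proof.
move=> fh [cf sf]; have fhz := nbhs_singleton fh.
have nE := rep_near_eq (f z) (chart_at_src z) fh.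
split; last first.
  by move=> v; rewrite /tmap -fhz; apply: near_eq_dif nE _; apply: smooth_at_differentiable.
split; last by rewrite -fhz; apply: smooth_at_near_eq nE sf.
change (h @ z --> h z); rewrite -fhz; apply: cvg_trans cf.
by apply: near_eq_cvg.
Qed.

Lemma msmooth_id z : msmooth_at (@id M) z.
Proof. by split; [exact: cvg_id|apply: rep_id_smooth; apply: chart_at_src]. Qed.

Lemma msmooth2_rep (f : M -> N -> L) a a' b x y : msmooth2_at f x y ->
  psrc (chart_at a) x -> psrc (chart_at a') y -> psrc (chart_at b) (f x y) ->
  smooth_at (fun z : 'rV[R]_n * 'rV[R]_m =>
    chart_at b (f (pbwd (chart_at a) z.1) (pbwd (chart_at a') z.2)))
    (chart_at a x, chart_at a' y).
Proof.
move=> [cf sf] ax ay bf.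
have xx := chart_at_src x; have yy := chart_at_src y; have ff := chart_at_src (f x y).
pose F := fun z : 'rV[R]_n * 'rV[R]_m =>
  chart_at (f x y) (f (pbwd (chart_at x) z.1) (pbwd (chart_at y) z.2)).
pose A := fun z : 'rV[R]_n * 'rV[R]_m => (rep a x id z.1, rep a' y id z.2).
have sA : smooth_at A (chart_at a x, chart_at a' y).
  apply: smooth_at_pair.
    apply: (@smooth_at_comp _ _ _ _ fst (rep a x id)); first exact: findim_rV.
      exact: smooth_at_fst.
    exact: rep_id_smooth.
  apply: (@smooth_at_comp _ _ _ _ snd (rep a' y id)); first exact: findim_rV.
    exact: smooth_at_snd.
  exact: rep_id_smooth.
have AE : A (chart_at a x, chart_at a' y) = (chart_at x x, chart_at y y).
  by rewrite /A/= !repE.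
have FE : F (chart_at x x, chart_at y y) = chart_at (f x y) (f x y) by rewrite /F /= !chartK.
have sFA : smooth_at (F \o A) (chart_at a x, chart_at a' y).
  by apply: smooth_at_comp; [apply: findim_prod; apply: findim_rV|exact: sA|rewrite AE].
have sBFA : smooth_at (rep (f x y) b id \o (F \o A)) (chart_at a x, chart_at a' y).
  apply: smooth_at_comp => //; first exact: findim_rV.
  by rewrite /= AE FE; apply: rep_id_smooth.
apply: smooth_at_near_eq sBFA.
have n1 : \forall z \near (x, y), psrc (chart_at (f x y)) (f z.1 z.2).
  exact: (cvg_near cf (near_chart_src ff)).
have n2 : \forall z \near (x, y), psrc (chart_at x) z.1 /\ psrc (chart_at y) z.2.
  have := (near_chart_src xx, near_chart_src yy) => -[h1 h2].
  by exists ([set z | psrc (chart_at x) z], [set z | psrc (chart_at y) z]) => //= -[p q] [].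
have cb : (fun z : 'rV[R]_n * 'rV[R]_m => (pbwd (chart_at a) z.1, pbwd (chart_at a') z.2))
    @ (chart_at a x, chart_at a' y) --> (x, y).
  apply: cvg_pair.
    by apply: (@cvg_comp _ _ _ fst (pbwd (chart_at a))); [exact: cvg_fst|exact: chart_bwd_continuous].
  by apply: (@cvg_comp _ _ _ snd (pbwd (chart_at a'))); [exact: cvg_snd|exact: chart_bwd_continuous].
apply: filterS2 (cvg_near cb n1) (cvg_near cb n2) => z h1 [h2 h3].
by rewrite /F /A /rep /= !chartK.
Qed.

Lemma msmooth2_fix1 (f : M -> N -> L) x y : msmooth2_at f x y -> msmooth_at (f x) y.
Proof.
move=> sf; have s := msmooth2_rep sf (chart_at_src x) (chart_at_src y) (chart_at_src (f x y)).
case: sf => cf _; split.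
  apply: (@continuous_comp _ _ _ (fun y => (x, y)) (fun z => f z.1 z.2)) => //.
  by apply: cvg_pair; [apply: cvg_cst|apply: cvg_id].
have sp : smooth_at (fun z : 'rV[R]_m => (chart_at x x, z)) (chart_at y y).
  by apply: smooth_at_pair; [apply: smooth_at_cst|apply: smooth_at_id].
have sc := smooth_at_comp (findim_prod (findim_rV _) (findim_rV _)) sp s.
rewrite (_ : _ \o _ = (chart_at (f x y) \o f x) \o pbwd (chart_at y)) in sc => //.
by apply/funext => z /=; rewrite chartK//; apply: chart_at_src.
Qed.

Lemma msmooth2_fix2 (f : M -> N -> L) x y : msmooth2_at f x y -> msmooth_at (f^~ y) x.
Proof.
move=> sf; have s := msmooth2_rep sf (chart_at_src x) (chart_at_src y) (chart_at_src (f x y)).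
case: sf => cf _; split.
  apply: (@continuous_comp _ _ _ (fun x => (x, y)) (fun z => f z.1 z.2)) => //.
  by apply: cvg_pair; [apply: cvg_id|apply: cvg_cst].
have sp : smooth_at (fun z : 'rV[R]_n => (z, chart_at y y)) (chart_at x x).
  by apply: smooth_at_pair; [apply: smooth_at_id|apply: smooth_at_cst].
have sc := smooth_at_comp (findim_prod (findim_rV _) (findim_rV _)) sp s.
rewrite (_ : _ \o _ = (chart_at (f x y) \o f^~ y) \o pbwd (chart_at x)) in sc => //.
by apply/funext => z /=; rewrite chartK//; apply: chart_at_src.
Qed.

End Msmooth.

Lemma tmap_id n (M : manifoldType R n) (z : M) v : tmap (@id M) z v = v.
Proof. exact: (trans_id v (chart_at_src z)). Qed.

Lemma msmooth_comp n m l (M : manifoldType R n) (N : manifoldType R m) (L : manifoldType R l)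
    (f : M -> N) (h : N -> L) z : msmooth_at f z -> msmooth_at h (f z) ->
  msmooth_at (h \o f) z /\ forall v, tmap (h \o f) z v = tmap h (f z) (tmap f z v).
Proof.
move=> [cf sf] [chf sh].
have [s1 d1] := rep_comp erefl cf (chart_at_src z) (chart_at_src (f z)) sf sh.
by split=> //; split=> //; apply: continuous_comp.
Qed.

End Representatives.

(** * Brackets of vector fields on manifolds *)

Section VectorFieldTheory.
Context {R : realType}.

Definition smooth_field n (M : manifoldType R n) (xi : M -> 'rV[R]_n) (z : M) :=
  forall a, psrc (chart_at a) z -> smooth_at (vf_coord (chart_at a) xi) (chart_at a z).

Lemma vf_coordE n (M : manifoldType R n) (xi : M -> 'rV[R]_n) (a z : M) :
  psrc (chart_at a) z -> vf_coord (chart_at a) xi (chart_at a z) = trans z a z (xi z).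
Proof. by move=> az; rewrite /vf_coord chartK// /trans difE. Qed.

Lemma vf_coord_self n (M : manifoldType R n) (xi : M -> 'rV[R]_n) (z : M) :
  vf_coord (chart_at z) xi (chart_at z z) = xi z.
Proof. by rewrite vf_coordE ?trans_id//; apply: chart_at_src. Qed.

Lemma near_chart n (M : manifoldType R n) (a z : M) (P : 'rV[R]_n -> Prop) :
  psrc (chart_at a) z -> (\forall w \near z, psrc (chart_at a) w -> P (chart_at a w)) ->
  \forall y \near chart_at a z, P y.
Proof.
move=> az nP; have n1 := cvg_near (chart_bwd_continuous az) nP.
apply: filterS2 n1 (near_chart_tgt az) => y h ty.
by rewrite -(chart_bwdK ty); apply: h; apply: chart_bwd_src.
Qed.

(** [vf_bracket] at z uses the preferred chart at z, which need not depend continuously on z; to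
    differentiate the bracket in z it is computed in a fixed chart. *)
Definition chart_bracket n (M : manifoldType R n) (xi eta : M -> 'rV[R]_n) (a z : M) : 'rV[R]_n :=
  'D_(vf_coord (chart_at a) xi (chart_at a z)) (vf_coord (chart_at a) eta) (chart_at a z)
  - 'D_(vf_coord (chart_at a) eta (chart_at a z)) (vf_coord (chart_at a) xi) (chart_at a z).

Section Related.
Context {n m : nat} {M : manifoldType R n} {N : manifoldType R m}.

Lemma chart_bracket_related (f : M -> N) (xi1 xi2 : M -> 'rV[R]_n) (z1 z2 : N -> 'rV[R]_m) a b z :
  psrc (chart_at a) z -> psrc (chart_at b) (f z) ->
  (\forall y \near z, msmooth_at f y) ->
  smooth_field xi1 z -> smooth_field xi2 z -> smooth_field z1 (f z) -> smooth_field z2 (f z) ->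
  (\forall y \near z, tmap f y (xi1 y) = z1 (f y)) ->
  (\forall y \near z, tmap f y (xi2 y) = z2 (f y)) ->
  chart_bracket z1 z2 b (f z) = dif (rep a b f) (chart_at a z) (chart_bracket xi1 xi2 a z).
Proof.
move=> az bfz sf s1 s2 t1 t2 r1 r2.
have sfz := nbhs_singleton sf; have cf : {for z, continuous f} by case: sfz.
have [srep _] := msmooth_rep sfz az bfz.
have rz := repE f b az.
have key (xi : M -> 'rV[R]_n) (zeta : N -> 'rV[R]_m) : (\forall y \near z, tmap f y (xi y) = zeta (f y)) ->
    \forall y \near chart_at a z, dif (rep a b f) y (vf_coord (chart_at a) xi y)
      = vf_coord (chart_at b) zeta (rep a b f y).
  move=> r; apply: near_chart => //.
  have bn := cvg_near cf (near_chart_src bfz).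
  near=> w => aw.
  have bfw : psrc (chart_at b) (f w) by near: w; exact: bn.
  have sw : msmooth_at f w by near: w; exact: sf.
  have [_ dw] := msmooth_rep sw aw bfw.
  rewrite dw (vf_coordE _ aw) repE// (vf_coordE _ bfw).
  rewrite transK//; last exact: chart_at_src.
  by congr trans; near: w; exact: r.
have h := @dif_bracket_related _ _ _ (rep a b f) _ _ _ _ (chart_at a z) (findim_rV n) (findim_rV m)
  srep (s1 _ az) (s2 _ az) _ _ (key _ _ r1) (key _ _ r2).
rewrite rz in h; apply: h; [exact: t1|exact: t2].
Unshelve. all: by end_near. Qed.

Lemma vf_bracket_related (f : M -> N) (xi1 xi2 : M -> 'rV[R]_n) (z1 z2 : N -> 'rV[R]_m) z :
  (\forall y \near z, msmooth_at f y) ->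
  smooth_field xi1 z -> smooth_field xi2 z -> smooth_field z1 (f z) -> smooth_field z2 (f z) ->
  (\forall y \near z, tmap f y (xi1 y) = z1 (f y)) ->
  (\forall y \near z, tmap f y (xi2 y) = z2 (f y)) ->
  vf_bracket z1 z2 (f z) = tmap f z (vf_bracket xi1 xi2 z).
Proof. by move=> *; apply: chart_bracket_related => //; apply: chart_at_src. Qed.
End Related.

(** The identity map, read in two charts, relates each field to itself. *)
Lemma chart_bracketE n (M : manifoldType R n) (xi eta : M -> 'rV[R]_n) (a z : M) :
  psrc (chart_at a) z -> smooth_field xi z -> smooth_field eta z ->
  chart_bracket xi eta a z = trans z a z (vf_bracket xi eta z).
Proof.
move=> az sx se; have zz := chart_at_src z.
rewrite (@chart_bracket_related _ _ M M id xi eta xi eta z a z) //.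
- by apply: nearW => y; apply: msmooth_id.
- by apply: nearW => y; apply: tmap_id.
- by apply: nearW => y; apply: tmap_id.
Qed.

End VectorFieldTheory.

Section VecCoordinates.
Context {K : fieldType} {g : vectType K}.

(** Derivatives of functions with values in the Lie algebra are taken in these coordinates, which
    live in a normed space. *)
Definition vec (x : g) : 'rV[K]_(\dim {:g}) := \row_j coord (vbasis {:g}) j x.
Definition unvec (r : 'rV[K]_(\dim {:g})) : g := \sum_j r 0 j *: (vbasis {:g})`_j.

Lemma vec_linear : linear vec.
Proof. by move=> a x y; apply/rowP => j; rewrite !mxE linearP. Qed.
HB.instance Definition _ := GRing.isLinear.Build K g 'rV[K]_(\dim {:g}) *:%R vec vec_linear.

Lemma unvec_linear : linear unvec.
Proof.
move=> a x y; rewrite /unvec scaler_sumr -big_split; apply: eq_bigr => j _ /=.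
by rewrite !mxE scalerDl scalerA.
Qed.
HB.instance Definition _ := GRing.isLinear.Build K 'rV[K]_(\dim {:g}) g *:%R unvec unvec_linear.

Lemma vecK : cancel vec unvec.
Proof.
by move=> x; rewrite [RHS](coord_vbasis (memvf x)); apply: eq_bigr => j _; rewrite mxE.
Qed.

Lemma unvecK : cancel unvec vec.
Proof.
move=> r; apply/rowP => j; rewrite mxE linear_sum (bigD1 j)//= linearZ/=.
rewrite coord_free ?(basis_free (vbasisP _))// eqxx mulr1 big1 ?addr0// => i ij.
by rewrite linearZ/= coord_free ?(basis_free (vbasisP _))// (negPf ij) mulr0.
Qed.

Lemma vec_inj : injective vec. Proof. exact: can_inj vecK. Qed.

End VecCoordinates.

(** * Constant fields of a Cartan connection and the curvature *)

Section CartanFields.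
Context {R : realType} {n k m N : nat} {G : lieGroupType R n}.
Context {g : lieAlgType R} {L : lie_algebra_of G g} {gr : onegrading g}.
Context {P : lieGroupType R k} {i : parabolic_subgroup L gr P}.
Context {M : manifoldType R m} {E : manifoldType R N}.
Variable geo : parabolic_geometry i M E.

Lemma omegaV_linear u : linear (omegaV geo u).
Proof.
move=> a X Y; apply: (can_inj (omegaK geo u)).
by rewrite linearP !(omegaVK geo).
Qed.

Definition eta (X : g) (u : E) : 'rV[R]_N := omegaV geo u X.

Definition omega_chart (a : E) (y v : 'rV[R]_N) : 'rV[R]_(\dim {:g}) :=
  vec (omega geo (pbwd (chart_at a) y) (trans a (pbwd (chart_at a) y) (pbwd (chart_at a) y) v)).

Lemma omega_chart_linear a y : linear (omega_chart a y).
Proof. by move=> c u v; rewrite /omega_chart !linearP. Qed.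

Lemma omega_chart_smooth a z v : psrc (chart_at a) z -> smooth_at (omega_chart a ^~ v) (chart_at a z).
Proof.
move=> az; apply: smooth_at_row => j.
have sw := @omega_smooth _ _ _ _ _ _ _ _ _ _ _ _ _ geo a z v j az.
apply: smooth_at_near_eq sw; apply: filterS (near_chart_tgt az) => y ty.
by rewrite /omega_chart mxE /trans difE chart_bwdK.
Qed.

Lemma omega_chart_eta a z X : psrc (chart_at a) z ->
  omega_chart a (chart_at a z) (vf_coord (chart_at a) (eta X) (chart_at a z)) = vec X.
Proof.
move=> az; rewrite /omega_chart vf_coordE// chartK// transK//; last exact: chart_at_src.
by rewrite /eta omegaVK.
Qed.

(** In a chart [omega] is smooth and pointwise invertible, and constant fields are its inverse
    applied to fixed vectors. *)
Lemma eta_smooth X z : smooth_field (eta X) z.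
Proof.
move=> a az.
pose h (y : 'rV[R]_N) (r : 'rV[R]_(\dim {:g})) : 'rV[R]_N := vf_coord (chart_at a) (eta (unvec r)) y.
have -> : vf_coord (chart_at a) (eta X) = h^~ (vec X) by rewrite /h vecK.
apply: (@smooth_at_inverse _ _ _ _ (omega_chart a) h) => //; first exact: findim_rV.
  apply: near_chart => //; apply: nearW => w aw; have ww := chart_at_src w; split.
  - exact: omega_chart_linear.
  - by move=> c r r'; rewrite /h !vf_coordE// /eta linearP omegaV_linear linearP.
  - move=> v; rewrite /h vf_coordE// /omega_chart chartK// /eta vecK omegaK.
    by rewrite transK.
  - by move=> r; rewrite /h omega_chart_eta// unvecK.
by move=> v; apply: omega_chart_smooth.
Qed.

Lemma curvature_bracket u X Y :
  curvature geo u X Y = lie X Y - omega geo u (vf_bracket (eta X) (eta Y) u).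
Proof. by []. Qed.

(** f carries the constant field of X to that of T X, and brackets of related fields are related.
    Right translations and the maps phi(w) h^(-1) are both of this kind. *)
Lemma curvature_natural (f : E -> E) (T : g -> g) u :
  (forall X Y, T (lie X Y) = lie (T X) (T Y)) -> linear T ->
  (\forall w \near u, msmooth_at f w) ->
  (\forall w \near u, forall v, omega geo (f w) (tmap f w v) = T (omega geo w v)) ->
  forall X Y, curvature geo (f u) (T X) (T Y) = T (curvature geo u X Y).
Proof.
move=> TM lT sf fw X Y; rewrite !curvature_bracket.
have TB x y : T (x - y) = T x - T y.
  by rewrite -scaleN1r addrC lT scaleN1r addrC.
rewrite TB TM; congr (_ - _).
have rel Z : \forall w \near u, tmap f w (eta Z w) = eta (T Z) (f w).
  apply: filterS fw => w h; apply: (can_inj (omegaK geo (f w))).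
  by rewrite h /eta !omegaVK.
rewrite (vf_bracket_related sf (@eta_smooth X u) (@eta_smooth Y u) (@eta_smooth (T X) (f u))
  (@eta_smooth (T Y) (f u)) (rel X) (rel Y)).
exact: (nbhs_singleton fw).
Qed.

End CartanFields.

Lemma near_all (T : topologicalType) (x : T) (P : T -> Prop) :
  (forall y, P y) -> \forall y \near x, P y.
Proof. by move=> h; apply: nearW. Qed.

Lemma lincomb_sub (K : fieldType) (V : lmodType K) (c : K) (a a' b b' : V) :
  c *: a + a' - (c *: b + b') = c *: (a - b) + (a' - b').
Proof. by rewrite scalerBr opprD addrACA. Qed.

Section CurvatureSmooth.
Context {R : realType} {n k m N : nat} {G : lieGroupType R n}.
Context {g : lieAlgType R} {L : lie_algebra_of G g} {gr : onegrading g}.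
Context {P : lieGroupType R k} {i : parabolic_subgroup L gr P}.
Context {M : manifoldType R m} {E : manifoldType R N}.
Variable geo : parabolic_geometry i M E.

Lemma curvature_smooth a u X Y : psrc (chart_at a) u ->
  smooth_at (fun y => vec (curvature geo (pbwd (chart_at a) y) X Y)) (chart_at a u).
Proof.
move=> au.
pose ec Z := vf_coord (chart_at a) (eta geo Z).
have sec Z : smooth_at (ec Z) (chart_at a u) by apply: eta_smooth.
pose br y := dif (ec Y) y (ec X y) - dif (ec X) y (ec Y y).
have sbr : smooth_at br (chart_at a u).
  by apply: smooth_atB; apply: smooth_at_form => //;
    [exact: findim_rV|apply: near_all => y; exact: dif_linear|move=> v; exact: smooth_at_dif
    |exact: findim_rV|apply: near_all => y; exact: dif_linear|move=> v; exact: smooth_at_dif].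
have sw : smooth_at (fun y => vec (lie X Y) - omega_chart geo a y (br y)) (chart_at a u).
  apply: smooth_atB; first exact: smooth_at_cst.
  apply: smooth_at_form => //; first exact: findim_rV.
    by apply: near_all => y; apply: omega_chart_linear.
  by move=> v; apply: omega_chart_smooth.
apply: smooth_at_near_eq sw; apply: near_chart => //.
have n1 := smooth_at_near (sec X); have n2 := smooth_at_near (sec Y).
have n1' := cvg_near (chart_continuous au) n1; have n2' := cvg_near (chart_continuous au) n2.
near=> w => aw.
have s1 : smooth_at (ec X) (chart_at a w) by near: w; exact: n1'.
have s2 : smooth_at (ec Y) (chart_at a w) by near: w; exact: n2'.
rewrite chartK// curvature_bracket linearB; congr (_ - _).
have -> : br (chart_at a w) = chart_bracket (eta geo X) (eta geo Y) a w.
  by rewrite /br /chart_bracket !dif_derive//; apply: smooth_at_differentiable.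
rewrite chart_bracketE//; [|exact: eta_smooth|exact: eta_smooth].
by rewrite /omega_chart chartK// transK//; apply: chart_at_src.
Unshelve. all: by end_near. Qed.

Lemma vf_coord_eta_linear a y c X Y : vf_coord (chart_at a) (eta geo (c *: X + Y)) y =
  c *: vf_coord (chart_at a) (eta geo X) y + vf_coord (chart_at a) (eta geo Y) y.
Proof. by rewrite /vf_coord /eta omegaV_linear linearP. Qed.

Lemma vf_bracket_eta_linearl u Y c X X' :
  vf_bracket (eta geo (c *: X + X')) (eta geo Y) u =
  c *: vf_bracket (eta geo X) (eta geo Y) u + vf_bracket (eta geo X') (eta geo Y) u.
Proof.
have uu := chart_at_src u.
have dec Z : differentiable (vf_coord (chart_at u) (eta geo Z)) (chart_at u u).
  by apply: smooth_at_differentiable; apply: eta_smooth.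
rewrite /vf_bracket vf_coord_eta_linear.
have -> : vf_coord (chart_at u) (eta geo (c *: X + X')) =
    (fun y => c *: vf_coord (chart_at u) (eta geo X) y + vf_coord (chart_at u) (eta geo X') y).
  by apply/funext => y; rewrite vf_coord_eta_linear.
have dF : differentiable (fun y => c *: vf_coord (chart_at u) (eta geo X) y + vf_coord (chart_at u) (eta geo X') y) (chart_at u u).
  by apply: differentiableD; [apply: differentiableZ|]; apply: dec.
have dFE v : dif (fun y => c *: vf_coord (chart_at u) (eta geo X) y + vf_coord (chart_at u) (eta geo X') y) (chart_at u u) v
    = c *: dif (vf_coord (chart_at u) (eta geo X)) (chart_at u u) v + dif (vf_coord (chart_at u) (eta geo X')) (chart_at u u) v.
  rewrite (dif_derive _ dF) (dif_derive _ (dec X)) (dif_derive _ (dec X')).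
  rewrite [LHS]deriveD; [|by apply: diff_derivable; apply: differentiableZ|exact: diff_derivable].
  by rewrite deriveZ//; apply: diff_derivable.
rewrite -(dif_derive _ dF) dFE -!(dif_derive _ (dec _)) dif_linear.
exact: lincomb_sub.
Qed.

Lemma vf_bracketC q (Q : manifoldType R q) (xi zeta : Q -> 'rV[R]_q) z :
  vf_bracket xi zeta z = - vf_bracket zeta xi z.
Proof. by rewrite /vf_bracket opprB. Qed.

Lemma curvature_skew u X Y : curvature geo u X Y = - curvature geo u Y X.
Proof. by rewrite !curvature_bracket vf_bracketC linearN lieC opprB opprK addrC. Qed.

Lemma curvature_linearl u Y : linear (fun X => curvature geo u X Y).
Proof.
move=> c X X'; rewrite !curvature_bracket vf_bracket_eta_linearl linearP lieDl lieZl.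
exact: lincomb_sub.
Qed.

Lemma curvature_linearr u X : linear (curvature geo u X).
Proof.
move=> c Y Y'; rewrite curvature_skew curvature_linearl opprD -scalerN.
by rewrite (curvature_skew u X Y) (curvature_skew u X Y').
Qed.
End CurvatureSmooth.

Section Partials.
Context {R : realType}.
Implicit Types V W X : normedModType R.

Lemma smooth_at_slice2 V W X (F : V * W -> X) p q : findim V -> findim W ->
  smooth_at F (p, q) -> smooth_at (fun q => F (p, q)) q /\
  forall v, dif (fun q => F (p, q)) q v = dif F (p, q) (0, v).
Proof.
move=> fV fW sF.
have sp : smooth_at (fun q : W => (p, q)) q by apply: smooth_at_pair; [apply: smooth_at_cst|apply: smooth_at_id].
split; first exact: (smooth_at_comp (findim_prod fV fW) sp sF).
move=> v; rewrite -[LHS]/(dif (F \o (fun q => (p, q))) q v) dif_comp; try exact: smooth_at_differentiable.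
congr dif; rewrite difE.
have dc : differentiable (fun _ : W => p) q by apply: differentiable_cst.
have di : differentiable (@id W) q by apply: smooth_at_differentiable; apply: smooth_at_id.
rewrite (congr1 (fun k => k v) (diff_pair dc di)) /=; congr pair.
  by rewrite -difE dif_cst.
by rewrite -difE dif_id.
Qed.

Lemma smooth_at_slice1 V W X (F : V * W -> X) p q : findim V -> findim W ->
  smooth_at F (p, q) -> smooth_at (fun p => F (p, q)) p /\
  forall v, dif (fun p => F (p, q)) p v = dif F (p, q) (v, 0).
Proof.
move=> fV fW sF.
have sp : smooth_at (fun p : V => (p, q)) p by apply: smooth_at_pair; [apply: smooth_at_id|apply: smooth_at_cst].
split; first exact: (smooth_at_comp (findim_prod fV fW) sp sF).
move=> v; rewrite -[LHS]/(dif (F \o (fun p => (p, q))) p v) dif_comp; try exact: smooth_at_differentiable.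
congr dif; rewrite difE.
have dc : differentiable (fun _ : V => q) p by apply: differentiable_cst.
have di : differentiable (@id V) p by apply: smooth_at_differentiable; apply: smooth_at_id.
rewrite (congr1 (fun k => k v) (diff_pair di dc)) /=; congr pair.
  by rewrite -difE dif_id.
by rewrite -difE dif_cst.
Qed.

Lemma mixed_partials V W X (F : V * W -> X) p q u v : findim V -> findim W -> findim X ->
  smooth_at F (p, q) ->
  dif (fun q => dif F (p, q) (v, 0)) q u = dif (fun p => dif F (p, q) (0, u)) p v.
Proof.
move=> fV fW fX sF.
have s1 := smooth_at_dif (v, 0) sF; have s2 := smooth_at_dif (0, u) sF.
have [_ ->] := smooth_at_slice2 fV fW s1.
have [_ ->] := smooth_at_slice1 fV fW s2.
have key w w' : dif (fun z => dif F z w) (p, q) w' = 'D_w' ('D_w F) (p, q).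
  rewrite dif_derive; last by apply: smooth_at_differentiable; apply: smooth_at_dif.
  apply: near_eq_derive; apply: filterS (smooth_at_near sF) => z /smooth_at_differentiable dz.
  by rewrite dif_derive.
by rewrite !key; apply: schwarz.
Qed.
End Partials.

Lemma eq_dif (R : realType) (V W : normedModType R) (f h : V -> W) x v : f = h -> dif f x v = dif h x v.
Proof. by move=> ->. Qed.

Lemma eq_tmap (R : realType) n m (M : manifoldType R n) (N : manifoldType R m) (f h : M -> N) x v :
  f = h -> tmap f x v = tmap h x v.
Proof. by move=> ->. Qed.

Lemma dif_rep (R : realType) n m (M : manifoldType R n) (N : manifoldType R m) (f : M -> N) z v :
  dif (rep z (f z) f) (chart_at z z) v = tmap f z v.
Proof. by []. Qed.

(** * Lie groups *)

Section LieGroupTheory.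
Context {R : realType} {n : nat} (G : lieGroupType R n).
Local Notation e0 := (chart_at (1%g : G) 1%g).
Local Notation src1 := (chart_at_src (1%g : G)).

(** The multiplication near (a, 1), with the left factor and the product read in the chart at a. Its
    partial derivative in the second variable at 1 is a left-invariant field in coordinates. *)
Definition mul_chart (a : G) (z : 'rV[R]_n * 'rV[R]_n) : 'rV[R]_n :=
  chart_at a (pbwd (chart_at a) z.1 * pbwd (chart_at (1%g : G)) z.2)%g.

Lemma mul_chart_smooth a w : psrc (chart_at a) w -> smooth_at (mul_chart a) (chart_at a w, e0).
Proof.
move=> aw; apply: (msmooth2_rep (@mul_smooth _ _ G w 1%g)) => //; last by rewrite mulg1.
exact: src1.
Qed.

Lemma msmooth_mull (w y : G) : msmooth_at (fun y : G => (w * y)%g) y.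
Proof. exact: (msmooth2_fix1 (mul_smooth w y)). Qed.

Lemma msmooth_mulr (w y : G) : msmooth_at (fun y : G => (y * w)%g) y.
Proof. exact: (msmooth2_fix2 (mul_smooth y w)). Qed.

Lemma left_invariantE (v : 'rV[R]_n) (w : G) :
  left_invariant v w = tmap (fun y : G => (w * y)%g) 1%g v.
Proof. by rewrite -tmapE. Qed.

Lemma left_invariant_chart a w v : psrc (chart_at a) w ->
  vf_coord (chart_at a) (left_invariant v) (chart_at a w) = dif (mul_chart a) (chart_at a w, e0) (0, v).
Proof.
move=> aw; rewrite vf_coordE// left_invariantE.
have s1 := src1.
have aw1 : psrc (chart_at a) (w * 1)%g by rewrite mulg1.
have [_ d] := msmooth_rep (msmooth_mull w 1%g) s1 aw1.
have [_ <-] := smooth_at_slice2 (findim_rV n) (findim_rV n) (mul_chart_smooth aw).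
have dv := d v; rewrite (trans_id v s1) mulg1 in dv.
apply: etrans (esym dv) _; apply: eq_dif; apply/funext => q; by rewrite /rep /mul_chart /= chartK.
Qed.

Lemma left_invariant_smooth v w : smooth_field (@left_invariant R n G v) w.
Proof.
move=> a aw.
have s := smooth_at_dif (0, v) (mul_chart_smooth aw).
have [s1 _] := smooth_at_slice1 (findim_rV n) (findim_rV n) s.
apply: smooth_at_near_eq s1; apply: near_chart => //; apply: near_all => w' aw'.
by rewrite left_invariant_chart.
Qed.

Lemma left_invariant1 v : left_invariant v (1%g : G) = v.
Proof.
rewrite left_invariantE; have -> : (fun y : G => (1 * y)%g) = id by apply/funext => y; rewrite mul1g.
exact: tmap_id.
Qed.

Local Notation lq := (fun v p => dif (mul_chart 1%g) (p, e0) (0, v)).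

Lemma lieg_bracketE (a b : 'rV[R]_n) :
  lieg_bracket G a b = dif (lq b) e0 a - dif (lq a) e0 b.
Proof.
have s1 := src1.
have slq v : smooth_at (lq v) e0.
  have s := smooth_at_dif (0, v) (mul_chart_smooth s1).
  by have [] := smooth_at_slice1 (findim_rV n) (findim_rV n) s.
have nE v : \forall y \near e0, vf_coord (chart_at (1%g : G)) (left_invariant v) y = lq v y.
  by apply: near_chart => //; apply: near_all => w' aw'; rewrite left_invariant_chart.
rewrite /lieg_bracket /vf_bracket !vf_coord_self !left_invariant1.
rewrite (near_eq_derive a (nE b)) (near_eq_derive b (nE a)).
by rewrite !dif_derive//; apply: smooth_at_differentiable.
Qed.

Definition conj_map (a b : G) : G := (a * b * a^-1)%g.
Definition adc (a : G) : 'rV[R]_n -> 'rV[R]_n := tmap (conj_map a) 1%g.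
HB.instance Definition _ a := GRing.isLinear.Build R 'rV[R]_n 'rV[R]_n *:%R (adc a)
  (dif_linear (rep (1%g : G) (conj_map a 1%g) (conj_map a)) (chart_at (1%g : G) 1%g)).

Lemma conj_map1 a : conj_map a 1%g = 1%g.
Proof. by rewrite /conj_map mulg1 mulgV. Qed.

Lemma msmooth_conj a y : msmooth_at (conj_map a) y.
Proof. exact: (msmooth_comp (msmooth_mull a y) (msmooth_mulr a^-1%g (a * y)%g)).1. Qed.

Lemma adcM a b v : adc (a * b)%g v = adc a (adc b v).
Proof.
have -> : adc (a * b)%g = tmap (conj_map a \o conj_map b) 1%g.
  by apply/funext => v'; apply: eq_tmap; apply/funext => y; rewrite /conj_map /= invgM !mulgA.
have [_ ->] := msmooth_comp (msmooth_conj b 1%g) (msmooth_conj a (conj_map b 1%g)).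
by rewrite conj_map1.
Qed.

Lemma adc1 v : adc 1%g v = v.
Proof.
have -> : adc 1%g = tmap (@id G) 1%g.
  by apply/funext => v'; apply: eq_tmap; apply/funext => y; rewrite /conj_map mul1g invg1 mulg1.
exact: tmap_id.
Qed.

Lemma adc_left_invariant a v w :
  tmap (conj_map a) w (left_invariant v w) = left_invariant (adc a v) (conj_map a w).
Proof.
rewrite !left_invariantE.
have [_ h1] := msmooth_comp (msmooth_mull w 1%g) (msmooth_conj a (w * 1)%g).
have [_ h2] := msmooth_comp (msmooth_conj a 1%g) (msmooth_mull (conj_map a w) (conj_map a 1%g)).
rewrite mulg1 in h1; rewrite conj_map1 in h2.
apply: etrans (esym (h1 v)) _; apply: etrans _ (h2 v); apply: eq_tmap; apply/funext => y.
by rewrite /conj_map /= !mulgA mulgVK.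
Qed.

(** Conjugation by a carries the left-invariant field of v to that of Ad_a v. *)
Lemma adc_bracket a u v : adc a (lieg_bracket G u v) = lieg_bracket G (adc a u) (adc a v).
Proof.
have h := @vf_bracket_related _ _ _ _ _ (conj_map a) (left_invariant u) (left_invariant v)
  (left_invariant (adc a u)) (left_invariant (adc a v)) 1%g.
rewrite conj_map1 in h; apply: esym; apply: h.
- by apply: near_all => y; apply: msmooth_conj.
- exact: left_invariant_smooth.
- exact: left_invariant_smooth.
- exact: left_invariant_smooth.
- exact: left_invariant_smooth.
- by apply: near_all => w; apply: adc_left_invariant.
- by apply: near_all => w; apply: adc_left_invariant.
Qed.

Definition conj_chart (z : 'rV[R]_n * 'rV[R]_n) : 'rV[R]_n :=
  chart_at (1%g : G) (conj_map (pbwd (chart_at (1%g : G)) z.1) (pbwd (chart_at (1%g : G)) z.2)).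

Lemma conj_chart_smooth : smooth_at conj_chart (e0, e0).
Proof.
have s1 := src1.
pose iv := rep (1%g : G) (1%g : G) (fun a : G => a^-1%g).
have siv : smooth_at iv e0.
  by have [] := msmooth_rep (@inv_smooth _ _ G 1%g) s1 (_ : psrc (chart_at (1%g : G)) 1^-1%g);
    rewrite ?invg1.
have ive : iv e0 = e0 by rewrite /iv repE// invg1.
have smm := mul_chart_smooth s1.
have mme : mul_chart 1%g (e0, e0) = e0 by rewrite /mul_chart /= chartK// mulg1.
have fn := findim_rV (R := R) n; have fnn := findim_prod fn fn.
pose H z := mul_chart 1%g (mul_chart 1%g z, iv z.1).
have sH : smooth_at H (e0, e0).
  apply: (@smooth_at_comp _ _ _ _ (fun z => (mul_chart 1%g z, iv z.1)) (mul_chart 1%g)) => //.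
    apply: smooth_at_pair => //; apply: (@smooth_at_comp _ _ _ _ fst iv) => //.
    exact: smooth_at_fst.
  by rewrite /= mme ive.
apply: smooth_at_near_eq sH.
have cmul : {for ((1%g : G), (1%g : G)), continuous (fun z : G * G => (z.1 * z.2)%g)}.
  by have [] := @mul_smooth _ _ G 1%g 1%g.
have cinv : {for (1%g : G), continuous (fun a : G => a^-1%g)} by have [] := @inv_smooth _ _ G 1%g.
have m1 : \forall z \near ((1%g : G), (1%g : G)), psrc (chart_at (1%g : G)) (z.1 * z.2)%g.
  by apply: (cvg_near cmul); rewrite mulg1; apply: near_chart_src.
have m2 : \forall z \near (1%g : G), psrc (chart_at (1%g : G)) (z^-1)%g.
  by apply: (cvg_near cinv); rewrite invg1; apply: near_chart_src.
have cb : (fun z : 'rV[R]_n * 'rV[R]_n => (pbwd (chart_at (1%g : G)) z.1, pbwd (chart_at (1%g : G)) z.2))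
    @ (e0, e0) --> ((1%g : G), (1%g : G)).
  apply: cvg_pair.
    by apply: (@cvg_comp _ _ _ fst (pbwd (chart_at (1%g : G)))); [exact: cvg_fst|exact: chart_bwd_continuous].
  by apply: (@cvg_comp _ _ _ snd (pbwd (chart_at (1%g : G)))); [exact: cvg_snd|exact: chart_bwd_continuous].
have cb1 : (fun z : 'rV[R]_n * 'rV[R]_n => pbwd (chart_at (1%g : G)) z.1) @ (e0, e0) --> (1%g : G).
  by apply: (@cvg_comp _ _ _ fst (pbwd (chart_at (1%g : G)))); [exact: cvg_fst|exact: chart_bwd_continuous].
apply: filterS2 (cvg_near cb m1) (cvg_near cb1 m2) => z h1 h2.
by rewrite /H /conj_chart /mul_chart /iv /rep /conj_map /= !chartK.
Qed.

Lemma conj_chart_dif w v : psrc (chart_at (1%g : G)) w ->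
  smooth_at conj_chart (chart_at (1%g : G) w, e0) ->
  dif conj_chart (chart_at (1%g : G) w, e0) (0, v) = adc w v.
Proof.
move=> w1 sw; have s1 := src1.
have cw1 : psrc (chart_at (1%g : G)) (conj_map w 1%g) by rewrite conj_map1.
have [_ <-] := smooth_at_slice2 (findim_rV n) (findim_rV n) sw.
rewrite /adc -dif_rep conj_map1; apply: eq_dif; apply/funext => q; by rewrite /rep /conj_chart /= chartK.
Qed.

Lemma near_adc v : \forall p \near e0, dif conj_chart (p, e0) (0, v) =
   adc (pbwd (chart_at (1%g : G)) p) v.
Proof.
apply: near_chart; first exact: src1.
have sn := smooth_at_near conj_chart_smooth.
have cp : (fun w : G => (chart_at (1%g : G) w, e0)) @ (1%g : G) --> (e0, e0).
  have sp : smooth_at (fun p : 'rV[R]_n => (p, e0)) e0.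
    by apply: smooth_at_pair; [apply: smooth_at_id|apply: smooth_at_cst].
  exact: cvg_comp (chart_continuous src1) (smooth_at_continuous sp).
apply: filterS (cvg_near cp sn) => w sw w1.
by rewrite (chartK w1); exact: conj_chart_dif.
Qed.

Lemma adc_smooth v : smooth_at (fun p => adc (pbwd (chart_at (1%g : G)) p) v) e0.
Proof.
apply: smooth_at_near_eq (near_adc v) _.
have s := smooth_at_dif (0, v) conj_chart_smooth.
by have [] := smooth_at_slice1 (findim_rV n) (findim_rV n) s.
Qed.

(* Differentiating (w y w^-1) w = w y in y and then in w at the identity. *)
Lemma adc_derivative u v :
  dif (fun p => adc (pbwd (chart_at (1%g : G)) p) v) e0 u = lieg_bracket G u v.
Proof.
have s1 := src1; have fn := findim_rV (R := R) n.
have smm := mul_chart_smooth s1.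
have near_mm1 : \forall p \near e0, smooth_at (mul_chart 1%g) (e0, p).
  have cp : (fun p : 'rV[R]_n => (e0, p)) @ e0 --> (e0, e0).
    have sp : smooth_at (fun p : 'rV[R]_n => (e0, p)) e0.
      by apply: smooth_at_pair; [apply: smooth_at_cst|apply: smooth_at_id].
    exact: (smooth_at_continuous sp).
  exact: (cvg_near cp (smooth_at_near smm)).
pose A p := adc (pbwd (chart_at (1%g : G)) p) v.
have rel : \forall p \near e0, dif (mul_chart 1%g) (e0, p) (A p, 0) = lq v p.
  apply: near_chart => //.
  have := cvg_near (chart_continuous s1) near_mm1.
  apply: filterS => w sw w1; rewrite /A chartK// -left_invariant_chart// vf_coordE// left_invariantE.
  have [_ <-] := smooth_at_slice1 fn fn sw.
  have w1' : psrc (chart_at (1%g : G)) (1 * w)%g by rewrite mul1g.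
  have [_ d] := msmooth_rep (msmooth_mulr w 1%g) s1 w1'.
  have -> : (fun p => mul_chart 1%g (p, chart_at (1%g : G) w)) = rep (1%g : G) (1%g : G) (fun y : G => (y * w)%g).
    by apply/funext => q; rewrite /rep /mul_chart /= chartK.
  have d' := d (adc w v); rewrite (trans_id _ s1) mul1g in d'; apply: etrans d' _; congr trans.
  have [_ h] := msmooth_comp (msmooth_conj w 1%g) (msmooth_mulr w (conj_map w 1%g)).
  rewrite conj_map1 in h; apply: etrans (esym (h v)) _; apply: eq_tmap; apply/funext => y.
  by rewrite /conj_map /= mulgVK.
have lw : \forall p \near id e0, linear (fun z : 'rV[R]_n => dif (mul_chart 1%g) (e0, p) (z, 0)).
  apply: near_all => p c x y; rewrite -dif_linear; congr dif.
  by rewrite -[RHS]/(c *: x + y, c *: (0 : 'rV[R]_n) + 0) scaler0 addr0.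
have sw z : smooth_at (fun p => dif (mul_chart 1%g) (e0, p) (z, 0)) e0.
  by have [] := smooth_at_slice2 fn fn (smooth_at_dif (z, 0) smm).
have dA : differentiable A e0 by apply: smooth_at_differentiable; apply: adc_smooth.
have did : differentiable (@id 'rV[R]_n) e0 by apply: smooth_at_differentiable; apply: smooth_at_id.
have [dF DF] := @derive_form _ _ _ _ _ (fun p z => dif (mul_chart 1%g) (e0, p) (z, 0)) id A e0 fn lw
  (fun z => smooth_at_differentiable (sw z)) did dA.
have slq w : smooth_at (lq w) e0.
  by have [] := smooth_at_slice1 fn fn (smooth_at_dif (0, w) smm).
have A1 : A e0 = v by rewrite /A chartK// adc1.
have e1 : dif (mul_chart 1%g) (e0, e0) ('D_u A e0, 0) = 'D_u A e0.
  have [_ <-] := smooth_at_slice1 fn fn smm.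
  have nid : \forall y \near e0, id y = mul_chart 1%g (y, e0).
    apply: filterS (near_chart_tgt s1) => y ty.
    by rewrite /mul_chart /= chartK// mulg1 chart_bwdK.
  have e v' : dif (fun p => mul_chart 1%g (p, e0)) e0 v' = dif id e0 v' by exact: near_eq_dif.
  by rewrite e dif_id.
have e2 : 'D_u (fun y => dif (mul_chart 1%g) (e0, y) (A y, 0)) e0 = dif (lq v) e0 u.
  rewrite (near_eq_derive u rel) dif_derive//; exact: smooth_at_differentiable.
have e3 : 'D_('D_u id e0) (fun x => dif (mul_chart 1%g) (e0, x) (A e0, 0)) e0 = dif (lq u) e0 v.
  rewrite derive_id A1 -dif_derive; last exact: smooth_at_differentiable.
  exact: mixed_partials.
have e4 : dif (lq v) e0 u = dif (lq u) e0 v + 'D_u A e0.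
  by apply: etrans (esym e2) _; apply: etrans (DF u) _; apply: (congr2 +%R e3 e1).
have e5 : dif A e0 u = 'D_u A e0 by exact: dif_derive.
by apply: (etrans e5); rewrite lieg_bracketE e4 addrAC subrr add0r.
Qed.

End LieGroupTheory.

Lemma dif_lin (R : realType) (V W : normedModType R) (l : {linear V -> W}) x v :
  continuous l -> dif l x v = l v.
Proof. by move=> cl; rewrite difE diff_lin. Qed.

Lemma dif_comp_lin (R : realType) (V W X : normedModType R) (l : {linear V -> W}) (f : X -> V) x v :
  continuous l -> differentiable f x -> dif (fun y => l (f y)) x v = l (dif f x v).
Proof.
move=> cl df; rewrite -(dif_lin (f x) _ cl) -dif_comp//.
by apply: linear_differentiable.
Qed.

Lemma dif_rep_at (R : realType) n m (M : manifoldType R n) (N : manifoldType R m) (f : M -> N) z y v :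
  f z = y -> dif (rep z y f) (chart_at z z) v = tmap f z v.
Proof. by move=> <-. Qed.

(** * The adjoint representation of G and of P *)

Section AdTheory.
Context {R : realType} {n : nat} {G : lieGroupType R n}.
Context {g : lieAlgType R} (L : lie_algebra_of G g).

Lemma lieGV_linear : linear (lieGV L).
Proof.
by move=> a x y; apply: (can_inj (lieGK L)); rewrite linearP !(lieGVK L).
Qed.

Lemma AdE a x : Ad L a x = lieG L (adc a (lieGV L x)).
Proof. by rewrite /Ad tmapE. Qed.

Lemma AdM a b x : Ad L (a * b)%g x = Ad L a (Ad L b x).
Proof. by rewrite !AdE lieGK adcM. Qed.

Lemma Ad1 x : Ad L 1%g x = x.
Proof. by rewrite AdE adc1 lieGVK. Qed.

Lemma Ad_linear a : linear (Ad L a).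
Proof. by move=> c x y; rewrite !AdE lieGV_linear !linearP. Qed.

Lemma Ad_lie a x y : Ad L a (lie x y) = lie (Ad L a x) (Ad L a y).
Proof.
rewrite !AdE -lieG_bracket -adc_bracket; congr (lieG L (adc a _)).
by apply: (can_inj (lieGK L)); rewrite lieGVK lieG_bracket !lieGVK.
Qed.

End AdTheory.

Section AdPTheory.
Context {R : realType} {n k : nat} {G : lieGroupType R n}.
Context {g : lieAlgType R} {L : lie_algebra_of G g} {gr : onegrading g}.
Context {P : lieGroupType R k} (i : parabolic_subgroup L gr P).
Implicit Types h : P.
Local Notation e0 := (chart_at (1%g : P) 1%g).

Lemma incl1 : incl i 1%g = 1%g.
Proof.
have h : (incl i 1 * incl i 1 = incl i 1)%g by rewrite -inclM mulg1.
by rewrite -[RHS](mulVg (incl i 1%g)) -{3}h mulKg.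
Qed.

Lemma AdPM h h' x : AdP i (h * h')%g x = AdP i h (AdP i h' x).
Proof. by rewrite /AdP inclM AdM. Qed.

Lemma AdP1 x : AdP i 1%g x = x.
Proof. by rewrite /AdP incl1 Ad1. Qed.

Lemma AdP_linear h : linear (AdP i h).
Proof. exact: Ad_linear. Qed.
HB.instance Definition _ h := GRing.isLinear.Build R g g *:%R (AdP i h) (AdP_linear h).

Lemma AdP_lie h x y : AdP i h (lie x y) = lie (AdP i h x) (AdP i h y).
Proof. exact: Ad_lie. Qed.

Lemma AdPK h x : AdP i h^-1%g (AdP i h x) = x.
Proof. by rewrite -AdPM mulVg AdP1. Qed.

Lemma AdPKV h x : AdP i h (AdP i h^-1%g x) = x.
Proof. by rewrite -AdPM mulgV AdP1. Qed.

Lemma AdP_filt h j x : x \in filt gr j -> AdP i h x \in filt gr j.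
Proof. by apply: (incl_sub (p := i)); exists h. Qed.

Lemma AdP_gm1 h x : gr_comp gr (-1) (AdP i h x) = gr_comp gr (-1) (AdP i h (gr_comp gr (-1) x)).
Proof.
apply/eqP; rewrite -subr_eq0 -linearB/= -(raddfB (AdP i h))/= -mem_filt0; apply: AdP_filt.
by rewrite mem_filt0 linearB/= (gr_comp_id _ (gr_comp_mem gr (-1) x))// subrr.
Qed.

Lemma AdP_g1 h x : x \in gr 1 -> AdP i h x \in gr 1.
Proof. by rewrite -!filt1E; apply: AdP_filt. Qed.

Lemma liePE b : lieP i b = lieG L (tmap (incl i) 1%g b).
Proof. by rewrite /lieP tmapE. Qed.

Lemma lieP_linear : linear (lieP i).
Proof. by move=> c a b; rewrite !liePE !linearP. Qed.
HB.instance Definition _ := GRing.isLinear.Build R 'rV[R]_k g *:%R (lieP i) lieP_linear.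

Lemma lieP_inj : injective (lieP i).
Proof. by move=> a b /(can_inj (lieGK L)); apply: incl_immersion. Qed.

Lemma lieP_filt0 b : lieP i b \in filt gr 0.
Proof. by apply/(incl_lie i); exists b. Qed.

Lemma lieP_surj x : x \in filt gr 0 -> exists b, lieP i b = x.
Proof. by move=> /(incl_lie i)[b ->]; exists b. Qed.

Lemma AdP_chart x : smooth_at (fun p => vec (AdP i (pbwd (chart_at (1%g : P)) p) x)) e0 /\
  forall b, dif (fun p => vec (AdP i (pbwd (chart_at (1%g : P)) p) x)) e0 b = vec (lie (lieP i b) x).
Proof.
have s1 := chart_at_src (1%g : P); have sG := chart_at_src (1%g : G).
pose y := lieGV L x.
pose l : {linear 'rV[R]_n -> 'rV[R]_(\dim {:g})} := vec \o lieG L.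
have cl : continuous l by apply: findim_linear_continuous; apply: findim_rV.
have sa := @adc_smooth _ _ G y; have da u := @adc_derivative _ _ G u y.
set f := fun p : 'rV[R]_n => _ in sa da.
have sI : smooth_at (rep (1%g : P) (1%g : G) (incl i)) e0.
  by have [] := msmooth_rep (incl_smooth i 1%g) s1 (_ : psrc (chart_at (1%g : G)) (incl i 1%g));
    rewrite ?incl1.
have rI : rep (1%g : P) (1%g : G) (incl i) e0 = chart_at (1%g : G) 1%g by rewrite repE// incl1.
have nE : \forall p \near e0, l (f (rep (1%g : P) (1%g : G) (incl i) p)) =
    vec (AdP i (pbwd (chart_at (1%g : P)) p) x).
  have [ci _] := incl_smooth i 1%g.
  have n1 : \forall w \near (1%g : P), psrc (chart_at (1%g : G)) (incl i w).
    by apply: (cvg_near ci); rewrite incl1; apply: near_chart_src.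
  apply: filterS (cvg_near (chart_bwd_continuous s1) n1) => p hp.
  by rewrite /l /f /rep /= chartK// /AdP AdE.
have sfI : smooth_at (fun p => f (rep (1%g : P) (1%g : G) (incl i) p)) e0.
  apply: (smooth_at_comp (findim_rV n) sI); rewrite rI; exact: sa.
have slf := smooth_at_lin cl sfI.
split; first exact: smooth_at_near_eq nE slf.
move=> b; apply: etrans (near_eq_dif _ (filterS _ nE) (smooth_at_differentiable slf)) _; first by [].
apply: etrans (dif_comp_lin _ cl (smooth_at_differentiable sfI)) _.
have e1 : dif (fun p => f (rep (1%g : P) (1%g : G) (incl i) p)) e0 b = lieg_bracket G (tmap (incl i) 1%g b) y.
  have d1 : differentiable (rep (1%g : P) (1%g : G) (incl i)) e0 by apply: smooth_at_differentiable.
  have d2 : differentiable f (rep (1%g : P) (1%g : G) (incl i) e0).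
    by rewrite rI; apply: smooth_at_differentiable.
  apply: etrans (dif_comp _ d1 d2) _; rewrite rI; apply: etrans (da _) _.
  exact: (congr1 (fun z => lieg_bracket G z y) (dif_rep_at b incl1)).
by rewrite e1 /l /= lieG_bracket liePE lieGVK.
Qed.

End AdPTheory.

Lemma dif_comp_at (R : realType) (V W X : normedModType R) (f : V -> W) (h : W -> X) x y v :
  f x = y -> differentiable f x -> differentiable h y ->
  differentiable (h \o f) x /\ dif (h \o f) x v = dif h y (dif f x v).
Proof.
move=> <- df dh; split; last exact: dif_comp.
exact: differentiable_comp.
Qed.

Lemma dif_pair (R : realType) (V W X : normedModType R) (f : X -> V) (h : X -> W) x v :
  differentiable f x -> differentiable h x ->
  dif (fun y => (f y, h y)) x v = (dif f x v, dif h x v).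
Proof. by move=> df dh; rewrite !difE; exact: (congr1 (fun k => k v) (diff_pair df dh)). Qed.

(** * Cartan geometries *)

Section BundleTheory.
Context {R : realType} {k m N : nat} {P : lieGroupType R k}.
Context {M : manifoldType R m} {E : manifoldType R N}.
Variable B : principal_bundle P M E.
Local Notation "u ** h" := (bact B u h) (at level 40, left associativity).
Local Notation p := (bproj B).

Lemma bact_inj u : injective (bact B u).
Proof.
move=> h h' e; have [U [tau [theta [[_ Ux] _ _ th]]]] := locally_trivial B (p u).
by have := congr1 tau e; rewrite !th// => /mulgI.
Qed.

Lemma bact_trans u w : p u = p w -> exists h, w = u ** h.
Proof.
move=> e; have [U [tau [theta [[_ Ux] tr _ th]]]] := locally_trivial B (p u).
have [Uu Uw] : U (p u) /\ U (p w) by rewrite -e.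
exists ((tau u)^-1 * tau w)%g.
have [|_ <-] := tr (u ** ((tau u)^-1 * tau w)%g); first by rewrite bproj_bact.
by rewrite bproj_bact e th// mulgA mulgV mul1g; have [_ ->] := tr w Uw.
Qed.

Lemma bactK u h : u ** h ** h^-1%g = u.
Proof. by rewrite -bactM mulgV bact1. Qed.

Lemma msmooth_bact h u : msmooth_at (fun w => w ** h) u.
Proof. exact: (msmooth2_fix2 (bact_smooth B u h)). Qed.

Lemma msmooth_orbit u h : msmooth_at (bact B u) h.
Proof. exact: (msmooth2_fix1 (bact_smooth B u h)). Qed.

(** In a local trivialization the base component of v is 0, so v comes from its component along P at
    tau(u); left translation by tau(u)^(-1) brings that to the identity and yields b. *)
Lemma vertical_fundamental u v : tmap p u v = 0 -> exists b, v = tmap (bact B u) 1%g b.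
Proof.
move=> pv0; have [U [tau [theta [[oU Ux] tr trV th]]]] := locally_trivial B (p u).
have [stau eu] := tr u Ux.
have [sth _ _] := trV (p u) (tau u) Ux.
have uu := chart_at_src u; have pp := chart_at_src (p u); have tt := chart_at_src (tau u).
have uth : psrc (chart_at u) (theta (p u) (tau u)) by rewrite eu.
pose T z := chart_at u (theta (pbwd (chart_at (p u)) z.1) (pbwd (chart_at (tau u)) z.2)).
have sT : smooth_at T (chart_at (p u) (p u), chart_at (tau u) (tau u)) by apply: (msmooth2_rep sth).
pose f1 := rep u (p u) p; pose f2 := rep u (tau u) tau.
have [s1 _] := msmooth_rep (bproj_smooth B u) uu pp.
have [s2 _] := msmooth_rep stau uu tt.
have e1 : f1 (chart_at u u) = chart_at (p u) (p u) by rewrite /f1 repE.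
have e2 : f2 (chart_at u u) = chart_at (tau u) (tau u) by rewrite /f2 repE.
have sp : smooth_at (fun z => (f1 z, f2 z)) (chart_at u u) by apply: smooth_at_pair.
have [cp _] := bproj_smooth B u; have [ct _] := stau.
have nU : \forall w \near u, U (p w) by apply: (cvg_near cp); apply: open_nbhs_nbhs.
have nE : \forall z \near chart_at u u, (T \o (fun z => (f1 z, f2 z))) z = id z.
  apply: near_chart => //.
  apply: filterS3 (cvg_near cp (near_chart_src pp)) (cvg_near ct (near_chart_src tt)) nU => w h1 h2 h3 uw.
  rewrite /T /= /f1 /f2 !repE// !chartK//; congr (chart_at u _); exact: (tr w h3).2.
have spe : (fun z => (f1 z, f2 z)) (chart_at u u) = (chart_at (p u) (p u), chart_at (tau u) (tau u)).
  by rewrite /= e1 e2.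
have [did dc] := dif_comp_at v spe (smooth_at_differentiable sp) (smooth_at_differentiable sT).
have d4 := dif_pair v (smooth_at_differentiable s1) (smooth_at_differentiable s2).
have d3 : v = dif T (chart_at (p u) (p u), chart_at (tau u) (tau u))
    (dif f1 (chart_at u u) v, dif f2 (chart_at u u) v).
  apply: etrans (esym (dif_id (chart_at u u) v)) _; apply: etrans (near_eq_dif v nE did) _.
  by apply: etrans dc _; rewrite d4.
have f10 : dif f1 (chart_at u u) v = 0 by exact: pv0.
rewrite f10 in d3.
have [_ d5] := smooth_at_slice2 (findim_rV m) (findim_rV k) sT.
rewrite -d5 in d3.
pose b := tmap (fun h => (tau u)^-1 * h)%g (tau u) (dif f2 (chart_at u u) v).
exists b; apply: etrans d3 _.
have [_ d6] := msmooth_comp (msmooth_mull (tau u)^-1%g (tau u)) (msmooth_orbit u ((tau u)^-1 * tau u)%g).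
rewrite mulVg in d6; apply: etrans _ (d6 _).
have eb : (bact B u \o [eta *%g (tau u)^-1%g]) (tau u) = u by rewrite /= mulVg bact1.
apply: etrans _ (dif_rep_at _ eb); apply: eq_dif; apply/funext => q.
rewrite /T /rep /= chartK//; congr (chart_at u _).
set h := pbwd _ q; have [_ h1 h2] := trV (p u) h Ux.
have [|_ <-] := tr (u ** ((tau u)^-1 * h)%g); first by rewrite bproj_bact.
by rewrite bproj_bact th// mulgA mulgV mul1g.
Qed.

End BundleTheory.

(** * Equivariance and horizontality of the curvature *)

Section CartanGeometry.
Context {R : realType} {n k m N : nat} {G : lieGroupType R n}.
Context {g : lieAlgType R} {L : lie_algebra_of G g} {gr : onegrading g}.
Context {P : lieGroupType R k} {i : parabolic_subgroup L gr P}.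
Context {M : manifoldType R m} {E : manifoldType R N}.
Variable geo : parabolic_geometry i M E.
Local Notation "u ** h" := (bact geo u h) (at level 40, left associativity).
Local Notation p := (bproj geo).

Lemma omega_bact u h v : omega geo (u ** h) (tmap (fun w => w ** h) u v) = AdP i h^-1%g (omega geo u v).
Proof. by rewrite -omega_equivariant tmapE. Qed.

Lemma omega_orbit u b : omega geo u (tmap (bact geo u) 1%g b) = lieP i b.
Proof. by rewrite -(omega_fundamental geo u) tmapE. Qed.

Lemma omega_vertical u v : tmap p u v = 0 -> omega geo u v \in filt gr 0.
Proof. by move=> /vertical_fundamental[b ->]; rewrite omega_orbit lieP_filt0. Qed.

Lemma curvature_equivariant u h X Y :
  curvature geo (u ** h) (AdP i h^-1%g X) (AdP i h^-1%g Y) = AdP i h^-1%g (curvature geo u X Y).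
Proof.
apply: (@curvature_natural _ _ _ _ _ _ _ _ _ _ _ _ _ geo (fun w => w ** h) (AdP i h^-1%g) u).
- exact: AdP_lie.
- exact: AdP_linear.
- by apply: near_all => w; apply: msmooth_bact.
- by apply: near_all => w v; apply: omega_bact.
Qed.

Definition act_chart (u : E) (z : 'rV[R]_N * 'rV[R]_k) : 'rV[R]_N :=
  chart_at u (pbwd (chart_at u) z.1 ** pbwd (chart_at (1%g : P)) z.2).

Local Notation e0 := (chart_at (1%g : P) 1%g).

Lemma act_chart_smooth u : smooth_at (act_chart u) (chart_at u u, e0).
Proof.
apply: (msmooth2_rep (bact_smooth geo u 1%g)); rewrite ?bact1; exact: chart_at_src.
Qed.

Lemma act_chart1 u : act_chart u (chart_at u u, e0) = chart_at u u.
Proof. by rewrite /act_chart /= !chartK ?bact1//; apply: chart_at_src. Qed.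

Lemma near_act_chart_vertical u b : \forall z \near chart_at u u,
  dif (act_chart u) (z, e0) (0, b) = vf_coord (chart_at u) (eta geo (lieP i b)) z.
Proof.
have uu := chart_at_src u; have s1 := chart_at_src (1%g : P).
apply: near_chart => //.
have sp : smooth_at (fun q : 'rV[R]_N => (q, e0)) (chart_at u u).
  by apply: smooth_at_pair; [apply: smooth_at_id|apply: smooth_at_cst].
have n1 := cvg_near (chart_continuous uu) (cvg_near (smooth_at_continuous sp) (smooth_at_near (act_chart_smooth u))).
apply: filterS n1 => w sw uw.
have [_ <-] := smooth_at_slice2 (findim_rV N) (findim_rV k) sw.
rewrite vf_coordE//.
have uw1 : psrc (chart_at u) (w ** 1%g) by rewrite bact1.
have [_ d] := msmooth_rep (msmooth_orbit geo w 1%g) s1 uw1.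
have db := d b; rewrite (trans_id b s1) bact1 in db.
have -> : eta geo (lieP i b) w = tmap (bact geo w) 1%g b.
  by apply: (can_inj (omegaK geo w)); rewrite /eta omegaVK omega_orbit.
apply: etrans _ db; apply: eq_dif; apply/funext => q.
by rewrite /act_chart /rep /= chartK.
Qed.

Lemma near_act_chart_horizontal u Y : \forall q \near e0,
  dif (act_chart u) (chart_at u u, q) (eta geo (AdP i (pbwd (chart_at (1%g : P)) q) Y) u, 0)
  = vf_coord (chart_at u) (eta geo Y) (act_chart u (chart_at u u, q)).
Proof.
have uu := chart_at_src u; have s1 := chart_at_src (1%g : P).
apply: near_chart => //.
have sp : smooth_at (fun q : 'rV[R]_k => (chart_at u u, q)) e0.
  by apply: smooth_at_pair; [apply: smooth_at_cst|apply: smooth_at_id].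
have n1 := cvg_near (chart_continuous s1) (cvg_near (smooth_at_continuous sp) (smooth_at_near (act_chart_smooth u))).
have [co _] := msmooth_orbit geo u 1%g.
have n2 : \forall h \near (1%g : P), psrc (chart_at u) (u ** h).
  by apply: (cvg_near co); rewrite bact1; apply: near_chart_src.
apply: filterS2 n1 n2 => h sh uh hh.
have [_ <-] := smooth_at_slice1 (findim_rV N) (findim_rV k) sh.
have [_ d] := msmooth_rep (msmooth_bact geo h u) uu uh.
rewrite (chartK hh) {2}/act_chart /= (chartK uu) (chartK hh) (vf_coordE _ uh).
have <- : tmap (fun w => w ** h) u (eta geo (AdP i h Y) u) = eta geo Y (u ** h).
  by apply: (can_inj (omegaK geo (u ** h))); rewrite omega_bact /eta !omegaVK AdPK.
have dv := d (eta geo (AdP i h Y) u); rewrite (trans_id _ uu) in dv.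
apply: etrans _ dv; apply: eq_dif; apply/funext => q.
by rewrite /act_chart /rep /= (chartK hh).
Qed.

(* Differentiate in h, at the identity, the relation saying that right translation
   by h carries the field omega^-1(Ad_h Y) to omega^-1(Y). *)
Lemma curvature_horizontal u A Y : A \in filt gr 0 -> curvature geo u A Y = 0.
Proof.
move=> /(lieP_surj i)[b <-]; rewrite curvature_bracket.
have fN := findim_rV (R := R) N; have fk := findim_rV (R := R) k.
set z0 := chart_at u u.
have sF := act_chart_smooth u; have F1 := act_chart1 u.
set EA := vf_coord (chart_at u) (eta geo (lieP i b)).
set EY := vf_coord (chart_at u) (eta geo Y).
have uu := chart_at_src u.
have sEA : smooth_at EA z0 by apply: eta_smooth.
have sEY : smooth_at EY z0 by apply: eta_smooth.
have relA := near_act_chart_vertical u b.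
have relA0 : dif (act_chart u) (z0, e0) (0, b) = EA z0 := nbhs_singleton relA.
have relY := near_act_chart_horizontal u Y.
pose l : {linear 'rV[R]_(\dim {:g}) -> 'rV[R]_N} := HB.pack (fun r => eta geo (unvec r) u : 'rV[R]_N)
  (GRing.isLinear.Build R _ _ *:%R (fun r => eta geo (unvec r) u : 'rV[R]_N)
   (fun c r r' => etrans (congr1 (omegaV geo u) (linearP _ c r r')) (omegaV_linear geo u c _ _))).
have cl : continuous l by apply: findim_linear_continuous; apply: findim_rV.
have [sAd dAd] := AdP_chart i Y.
pose s q := eta geo (AdP i (pbwd (chart_at (1%g : P)) q) Y) u.
have ls : (fun q => l (vec (AdP i (pbwd (chart_at (1%g : P)) q) Y))) = s.
  by apply/funext => q; rewrite /l /s /= vecK.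
have ss : smooth_at s e0 by rewrite -ls; apply: smooth_at_lin.
have ds : dif s e0 b = eta geo (lie (lieP i b) Y) u.
  rewrite -ls; apply: etrans (dif_comp_lin _ cl (smooth_at_differentiable sAd)) _.
  by rewrite dAd /l /= vecK.
have s0 : s e0 = EY z0.
  by rewrite /s chartK ?AdP1 /EY ?vf_coord_self//; apply: chart_at_src.
have lw : \forall q \near id e0, linear (fun v : 'rV[R]_N => dif (act_chart u) (z0, q) (v, 0)).
  apply: near_all => q c x y; rewrite -dif_linear; congr dif.
  by rewrite -[RHS]/(c *: x + y, c *: (0 : 'rV[R]_k) + 0) scaler0 addr0.
have sw v : smooth_at (fun q => dif (act_chart u) (z0, q) (v, 0)) e0.
  by have [] := smooth_at_slice2 fN fk (smooth_at_dif (v, 0) sF).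
have did : differentiable (@id 'rV[R]_k) e0 by apply: smooth_at_differentiable; apply: smooth_at_id.
have dse := smooth_at_differentiable ss.
have [_ E1] := @derive_form _ _ _ _ _ (fun q v => dif (act_chart u) (z0, q) (v, 0)) id s e0 fN lw
  (fun v => smooth_at_differentiable (sw v)) did dse.
(* Symmetry of mixed partials exchanges differentiation in the point and in h, leaving the
   derivative of the field of A along that of Y. *)
have Em : 'D_('D_b id e0) (fun q => dif (act_chart u) (z0, q) (s e0, 0)) e0 = dif EA z0 (EY z0).
  rewrite derive_id s0 -dif_derive; last exact: smooth_at_differentiable.
  apply: etrans (mixed_partials b (EY z0) fN fk fN sF) _.
  have sv : smooth_at (fun z => dif (act_chart u) (z, e0) (0, b)) z0.
    by have [] := smooth_at_slice1 fN fk (smooth_at_dif (0, b) sF).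
  by apply: esym; apply: near_eq_dif => //; apply: smooth_at_differentiable.
have Eh : dif (act_chart u) (z0, e0) ('D_b s e0, 0) = eta geo (lie (lieP i b) Y) u.
  rewrite -(dif_derive _ dse) ds.
  have [_ <-] := smooth_at_slice1 fN fk sF.
  have nid : \forall z \near z0, id z = act_chart u (z, e0).
    apply: filterS (near_chart_tgt uu) => z tz.
    by rewrite /act_chart /= chartK ?bact1 ?chart_bwdK//; apply: chart_at_src.
  have e v : dif (fun z => act_chart u (z, e0)) z0 v = dif id z0 v.
    by apply: near_eq_dif => //; apply: smooth_at_differentiable; apply: smooth_at_id.
  by rewrite e dif_id.
have Er : 'D_b (fun q => dif (act_chart u) (z0, q) (s q, 0)) e0 = dif EY z0 (EA z0).
  have [sF2 dF2] := smooth_at_slice2 fN fk sF.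
  have dEY : differentiable EY (act_chart u (z0, e0)) by rewrite F1; apply: smooth_at_differentiable.
  have dcomp : differentiable (EY \o (fun q => act_chart u (z0, q))) e0.
    by apply: differentiable_comp => //; apply: smooth_at_differentiable.
  rewrite (near_eq_derive b relY) -[LHS](dif_derive b dcomp).
  apply: etrans (dif_comp _ (smooth_at_differentiable sF2) dEY) _.
  by rewrite F1 dF2 relA0.
have main : dif EY z0 (EA z0) = dif EA z0 (EY z0) + eta geo (lie (lieP i b) Y) u.
  by apply: etrans (esym Er) _; apply: etrans (E1 b) _; apply: (congr2 +%R Em Eh).
have -> : vf_bracket (eta geo (lieP i b)) (eta geo Y) u = eta geo (lie (lieP i b) Y) u.
  rewrite /vf_bracket -/EA -/EY -/z0 -!dif_derive; try exact: smooth_at_differentiable.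
  by rewrite main addrAC subrr add0r.
by rewrite /eta omegaVK subrr.
Qed.

End CartanGeometry.

Lemma derive_linear (R : realType) (V W : normedModType R) (f : V -> W) x v :
  findim V -> linear f -> differentiable f x /\ 'D_v f x = f v.
Proof.
move=> fV lf; pose l : {linear V -> W} := HB.pack f (GRing.isLinear.Build R V W *:%R f lf).
have cl : continuous l by apply: findim_linear_continuous.
have dl : differentiable l x by apply: linear_differentiable.
split; first exact: dl.
by apply: etrans (esym (dif_derive v dl)) _; apply: dif_lin.
Qed.

(** * Derivatives of the curvature *)

Section VerticalDerivative.
Context {R : realType} {n k m N : nat} {G : lieGroupType R n}.
Context {g : lieAlgType R} {L : lie_algebra_of G g} {gr : onegrading g}.
Context {P : lieGroupType R k} {i : parabolic_subgroup L gr P}.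
Context {M : manifoldType R m} {E : manifoldType R N}.
Variable geo : parabolic_geometry i M E.
Local Notation "u ** h" := (bact geo u h) (at level 40, left associativity).
Local Notation p := (bproj geo).
Local Notation e0 := (chart_at (1%g : P) 1%g).
Local Notation kappa := (curvature geo).
Local Notation pi := (gr_comp gr).

Lemma curvature_eql u X X' Y : X - X' \in filt gr 0 -> kappa u X Y = kappa u X' Y.
Proof.
move=> h; have := curvature_linearl geo u Y 1 (X - X') X'.
by rewrite !scale1r subrK (curvature_horizontal geo u Y h) add0r.
Qed.

Lemma curvature_eqr u X Y Y' : Y - Y' \in filt gr 0 -> kappa u X Y = kappa u X Y'.
Proof. by move=> h; rewrite curvature_skew (curvature_eql u X h) -curvature_skew. Qed.

Lemma AdP_curvature u h X Y : AdP i h (kappa (u ** h) X Y) = kappa u (AdP i h X) (AdP i h Y).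
Proof.
have := curvature_equivariant geo u h (AdP i h X) (AdP i h Y).
by rewrite !AdPK => ->; rewrite AdPKV.
Qed.

(** The derivative at h = 1, in the direction A, of Ad_h kappa(u h)(X, Y) = kappa(u)(Ad_h X, Ad_h
    Y). *)
Lemma curvature_vertical u A X Y : A \in filt gr 0 ->
  dif (fun z => vec (kappa (pbwd (chart_at u) z) X Y)) (chart_at u u) (eta geo A u) =
  vec (kappa u (lie A X) Y + kappa u X (lie A Y) - lie A (kappa u X Y)).
Proof.
move=> /(lieP_surj i)[b <-].
have uu := chart_at_src u; have s1 := chart_at_src (1%g : P).
have fk := findim_rV (R := R) k; have fN := findim_rV (R := R) N.
have fg := findim_rV (R := R) (\dim {:g}).
set K := fun z : 'rV[R]_N => _; set z0 := chart_at u u.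
have sK : smooth_at K z0 by apply: curvature_smooth.
have sF := act_chart_smooth geo u; have F1 := act_chart1 geo u.
have [sF2 dF2] := smooth_at_slice2 fN fk sF.
pose Ad q := AdP i (pbwd (chart_at (1%g : P)) q).
have Ad1 Z : Ad e0 Z = Z by rewrite /Ad chartK// AdP1.
pose s q := K (act_chart geo u (z0, q)).
have dK : differentiable K (act_chart geo u (z0, e0)) by rewrite F1; apply: smooth_at_differentiable.
have ds : differentiable s e0 by apply: differentiable_comp => //; apply: smooth_at_differentiable.
have Ds : 'D_b s e0 = dif K z0 (eta geo (lieP i b) u).
  rewrite -dif_derive//.
  have [_ ->] := dif_comp_at b F1 (smooth_at_differentiable sF2) (smooth_at_differentiable sK).
  congr dif; rewrite dF2; apply: etrans (nbhs_singleton (near_act_chart_vertical geo u b)) _.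
  exact: vf_coord_self.
have did : differentiable (@id 'rV[R]_k) e0 by apply: smooth_at_differentiable; apply: smooth_at_id.
have lw : \forall q \near id e0, linear (fun r : 'rV[R]_(\dim {:g}) => vec (Ad q (unvec r))).
  by apply: near_all => q c r r'; rewrite /Ad !linearP.
have dw r : differentiable (fun q => vec (Ad q (unvec r))) e0.
  by have [/smooth_at_differentiable] := AdP_chart i (unvec r).
have [_ D1] := @derive_form _ _ _ _ _ (fun q r => vec (Ad q (unvec r))) id s e0 fg lw dw did ds.
have {}D1 : 'D_b (fun q => vec (Ad q (unvec (s q)))) e0 =
    vec (lie (lieP i b) (kappa u X Y)) + dif K z0 (eta geo (lieP i b) u).
  apply: etrans (D1 b) _; congr (_ + _).
    rewrite derive_id -dif_derive; last exact: dw.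
    have [_ ->] := AdP_chart i (unvec (s e0)).
    by rewrite /s F1 /K /z0 vecK chartK.
  by rewrite Ds Ad1 unvecK.
pose W r r' := vec (kappa u (unvec r) (unvec r')) : 'rV[R]_(\dim {:g}).
have lWr r : linear (W r).
  by move=> c x y; rewrite /W linearP curvature_linearr linearP.
have lWl r : linear (W^~ r).
  by move=> c x y; rewrite /W linearP curvature_linearl linearP.
pose f Z q := vec (Ad q Z).
have df Z : differentiable (f Z) e0 by have [/smooth_at_differentiable] := AdP_chart i Z.
have Df Z : 'D_b (f Z) e0 = vec (lie (lieP i b) Z).
  by rewrite -dif_derive//; have [_ ->] := AdP_chart i Z.
have [_ D2] := @derive_form _ _ _ _ _ W (f X) (f Y) e0 fg
  (near_all (f X e0) lWr) (fun r => (derive_linear (f X e0) 0 fg (lWl r)).1) (df X) (df Y).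
have {}D2 : 'D_b (fun q => W (f X q) (f Y q)) e0 =
    vec (kappa u (lie (lieP i b) X) Y) + vec (kappa u X (lie (lieP i b) Y)).
  apply: etrans (D2 b) _; rewrite (derive_linear _ _ fg (lWl _)).2 !Df.
  by rewrite /W /f !vecK !Ad1.
have nE : \forall q \near e0, vec (Ad q (unvec (s q))) = W (f X q) (f Y q).
  have [co _] := msmooth_orbit geo u 1%g.
  have n2 : \forall h \near (1%g : P), psrc (chart_at u) (u ** h).
    by apply: (cvg_near co); rewrite bact1; apply: near_chart_src.
  apply: near_chart => //; apply: filterS n2 => h uh hh.
  rewrite /s /K /W /f !vecK /act_chart /= /Ad (chartK uu) (chartK hh) (chartK uh).
  by rewrite AdP_curvature.
have D12 := etrans (esym D1) (etrans (near_eq_derive b nE) D2).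
move: D12; move: (kappa u (lie (lieP i b) X) Y) (kappa u X (lie (lieP i b) Y))
  (lie (lieP i b) (kappa u X Y)) (dif K z0 _) => a a' c d.
by rewrite (raddfB vec) (raddfD vec)/= => <-; rewrite addrAC subrr add0r.
Qed.

(** The derivative D_V kappa_0(X, Y) at u along the constant field of V. *)
Definition delta u X Y (V : g) : g :=
  unvec (dif (fun z => vec (pi 0 (kappa (pbwd (chart_at u) z) X Y))) (chart_at u u) (eta geo V u)).

Lemma delta_linear u X Y : linear (delta u X Y).
Proof. by move=> c V V'; rewrite /delta /eta omegaV_linear dif_linear linearP. Qed.

Lemma delta_dif u X Y V : delta u X Y V =
  pi 0 (unvec (dif (fun z => vec (kappa (pbwd (chart_at u) z) X Y)) (chart_at u u) (eta geo V u))).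
Proof.
pose l : {linear 'rV[R]_(\dim {:g}) -> 'rV[R]_(\dim {:g})} := vec \o (pi 0 \o unvec).
have cl : continuous l by apply: findim_linear_continuous; apply: findim_rV.
have sK := curvature_smooth geo X Y (chart_at_src u).
have := dif_comp_lin (eta geo V u) cl (smooth_at_differentiable sK).
have -> : (fun z => l (vec (kappa (pbwd (chart_at u) z) X Y))) =
    (fun z => vec (pi 0 (kappa (pbwd (chart_at u) z) X Y))).
  by apply/funext => z; rewrite /l /= vecK.
by rewrite /delta => ->; rewrite /l /= vecK.
Qed.

Hypothesis tf : torsion_free geo.

Lemma torsion_free_filt0 u X Y : X \in gr (-1) -> Y \in gr (-1) -> kappa u X Y \in filt gr 0.
Proof. by move=> Xm Ym; rewrite mem_filt0; apply/eqP; apply: tf. Qed.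

(** In the formula for vertical derivatives, [A, X] and [A, Y] lie in p, where the curvature is
    horizontal, and the g_0-component of [A, kappa] is [A, kappa_(-1)], which is 0 without
    torsion. *)
Lemma delta_g1 u A X Y : X \in gr (-1) -> Y \in gr (-1) -> A \in gr 1 -> delta u X Y A = 0.
Proof.
move=> Xm Ym A1; rewrite delta_dif curvature_vertical ?mem_filt0_g1// vecK.
rewrite (curvature_horizontal geo u Y) ?mem_filt0_g0 ?lie_1m// add0r.
rewrite curvature_skew (curvature_horizontal geo u X) ?mem_filt0_g0 ?lie_1m// oppr0 add0r.
rewrite (raddfN (pi 0))/= gr_comp_lie_g1//.
have /eqP -> : pi (-1) (kappa u X Y) == 0 by rewrite -mem_filt0 torsion_free_filt0.
by rewrite lie0r oppr0.
Qed.

Lemma delta_g0 u A X Y : X \in gr (-1) -> Y \in gr (-1) -> A \in gr 0 -> delta u X Y A =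
  pi 0 (kappa u (lie A X) Y) + pi 0 (kappa u X (lie A Y)) - lie A (pi 0 (kappa u X Y)).
Proof.
move=> Xm Ym A0; rewrite delta_dif curvature_vertical ?mem_filt0_g0// vecK.
have e : pi 0 (lie A (kappa u X Y)) = lie A (pi 0 (kappa u X Y)); last first.
  rewrite -e; move: (kappa u (lie A X) Y) (kappa u X (lie A Y)) (lie A (kappa u X Y)) => a b c.
  by rewrite (raddfB (pi 0)) (raddfD (pi 0)).
move: (torsion_free_filt0 u Xm Ym); move: (kappa u X Y) => a ma.
have ea : pi 0 (lie A (pi 0 a)) = lie A (pi 0 a).
  by apply: gr_comp_id => //; apply: lie_00 => //; apply: gr_comp_mem.
have eb : pi 0 (lie A (pi 1 a)) = 0.
  apply: gr_comp_eq0 => //; rewrite gr_others0 (subvP (addvSr _ _))//.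
  by apply: lie_01 => //; apply: gr_comp_mem.
by rewrite {1}(filt0_sum ma) lieDr (raddfD (pi 0))/= ea eb addr0.
Qed.

Let mulN1N1 : -1 * -1 = 1 :> R. Proof. by rewrite mulrNN mulr1. Qed.

(** * Bundle maps fixing a point *)

Section FixedPoint.
Variables (u : E) (h : P) (Phi : E -> E).
Hypothesis Phi_u : Phi u = u.
Hypothesis Phi_smooth : \forall w \near u, msmooth_at Phi w.
Hypothesis Phi_omega : \forall w \near u, forall v,
  omega geo (Phi w) (tmap Phi w v) = AdP i h (omega geo w v).
Hypothesis Phi_p : forall v, tmap p u (tmap Phi u v) = - tmap p u v.

(** The projection kills TPhi(v) + v, so this vector is vertical and [omega] maps it into p; for v
    in the constant field of X this says that Ad_h X + X lies in p. *)
Lemma fixed_AdP_gm X : X \in gr (-1) -> pi (-1) (AdP i h X) = - 1 *: X.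
Proof.
move=> Xm; have e := nbhs_singleton Phi_omega (eta geo X u).
rewrite Phi_u /eta omegaVK in e.
have v0 : tmap p u (tmap Phi u (omegaV geo u X) + omegaV geo u X) = 0.
  by rewrite linearD/= Phi_p addNr.
have := omega_vertical v0; rewrite (raddfD (omega geo u))/= e omegaVK mem_filt0 (raddfD (pi (-1)))/=.
by rewrite addr_eq0 (gr_comp_id _ Xm)// scaleN1r => /eqP.
Qed.

Lemma fixed_AdP_filt0 x : x \in filt gr 0 -> pi 0 (AdP i h x) = pi 0 x.
Proof.
move=> x0; have h0 := filtered_aut_g0 (AdP_lie i h) (fun y => @AdP_filt _ _ _ _ _ _ _ _ i h 0 y)
  mulN1N1 fixed_AdP_gm (gr_comp_mem gr 0 x).
rewrite {1}(filt0_sum x0) (raddfD (AdP i h))/= h0 !(raddfD (pi 0))/=.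
have k1 y : y \in gr 1 -> pi 0 y = 0.
  by move=> y1; rewrite gr_comp_eq0// gr_others0 (subvP (addvSr _ _)).
rewrite (k1 _ (gr_comp_mem gr 1 _)) (k1 _ (AdP_g1 i h (gr_comp_mem gr 1 _))) !addr0.
by rewrite gr_comp_id// gr_comp_mem.
Qed.

Lemma fixed_AdP_g1 x : x \in gr 1 -> AdP i h x = - x.
Proof.
move=> x1; have := filtered_aut_g1 (AdP_lie i h) (fun y => @AdP_filt _ _ _ _ _ _ _ _ i h 0 y)
  (@AdP_g1 _ _ _ _ _ _ _ _ i h) mulN1N1 fixed_AdP_gm x1.
by rewrite scaleN1r.
Qed.

Lemma fixed_AdPV_sub X : X \in gr (-1) -> AdP i h X - (- X) \in filt gr 0.
Proof.
move=> Xm; rewrite mem_filt0 (raddfB (pi (-1)))/= fixed_AdP_gm// (raddfN (pi (-1)))/= (gr_comp_id _ Xm)//.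
by rewrite scaleN1r opprK addNr.
Qed.

(** Naturality produces the arguments Ad_h X and Ad_h Y; modulo p both only change sign, and the two
    signs cancel. *)
Lemma near_fixed_curvature X Y : X \in gr (-1) -> Y \in gr (-1) ->
  \forall w \near u, kappa (Phi w) X Y = AdP i h (kappa w X Y).
Proof.
move=> Xm Ym.
have nn : \forall w \near u, \forall w' \near w, msmooth_at Phi w' /\
    forall v, omega geo (Phi w') (tmap Phi w' v) = AdP i h (omega geo w' v).
  by apply: nbhs_interior; apply: filterS2 Phi_smooth Phi_omega.
apply: filterS nn => w nw.
have <- := @curvature_natural _ _ _ _ _ _ _ _ _ _ _ _ _ geo Phi (AdP i h) w (AdP_lie i h) (AdP_linear i h)
  (filterS (fun w' => @proj1 _ _) nw) (filterS (fun w' => @proj2 _ _) nw) X Y.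
rewrite (curvature_eql _ _ (fixed_AdPV_sub Xm)) (curvature_eqr _ _ (fixed_AdPV_sub Ym)).
have kN Z Z' : kappa (Phi w) (- Z) Z' = - kappa (Phi w) Z Z'.
  have := curvature_linearl geo (Phi w) Z' (-1) Z 0.
  have -> : kappa (Phi w) 0 Z' = 0 by rewrite curvature_horizontal ?mem0v.
  by rewrite !addr0 !scaleN1r.
apply: esym; apply: etrans (kN X (- Y)) _; rewrite (curvature_skew geo _ X (- Y)) opprK.
by apply: etrans (kN Y X) _; rewrite -curvature_skew.
Qed.

(** Since Ad_h is trivial on p / g_1, kappa_0(X, Y) is invariant under Phi near u. Its differential
    at u is then invariant under the tangent map of Phi, which [omega] turns into Ad_h. *)
Lemma delta_fixed X Y V : X \in gr (-1) -> Y \in gr (-1) -> delta u X Y (AdP i h V) = delta u X Y V.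
Proof.
move=> Xm Ym; rewrite /delta.
set K := fun z : 'rV[R]_N => _; set z0 := chart_at u u.
have uu := chart_at_src u.
have sK : smooth_at K z0.
  pose l : {linear 'rV[R]_(\dim {:g}) -> 'rV[R]_(\dim {:g})} := vec \o (pi 0 \o unvec).
  have cl : continuous l by apply: findim_linear_continuous; apply: findim_rV.
  have := smooth_at_lin cl (curvature_smooth geo X Y uu).
  by apply: smooth_at_near_eq; apply: near_all => z; rewrite /l /= vecK.
have sPhi := nbhs_singleton Phi_smooth; have [cPhi _] := sPhi.
have uPhi : psrc (chart_at u) (Phi u) by rewrite Phi_u.
have [sr dr] := msmooth_rep sPhi uu uPhi.
have rz : rep u u Phi z0 = z0 by rewrite repE// Phi_u.
have nE : \forall z \near z0, (K \o rep u u Phi) z = K z.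
  apply: near_chart => //.
  have n1 := cvg_near cPhi (near_chart_src uPhi).
  apply: filterS2 n1 (near_fixed_curvature Xm Ym) => w uw e ww.
  rewrite /K /= (repE _ _ ww) (chartK uw) (chartK ww) e.
  by rewrite fixed_AdP_filt0// torsion_free_filt0.
have [dc Dc] := dif_comp_at (eta geo V u) rz (smooth_at_differentiable sr) (smooth_at_differentiable sK).
have dKK := smooth_at_differentiable sK.
have n3 := near_eq_dif (eta geo V u) nE dc.
apply: (congr1 unvec); apply: etrans _ (esym (etrans n3 Dc)); apply: (congr1 (dif K z0)).
have d := dr (eta geo V u); rewrite (trans_id _ uu) Phi_u (trans_id _ uu) in d.
apply: esym; apply: etrans d _; apply: (can_inj (omegaK geo u)).
have e := nbhs_singleton Phi_omega (eta geo V u).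
by rewrite Phi_u in e; rewrite e /eta !omegaVK.
Qed.

(** Insert Ad_h V = - V + f(V) + (a term in g_1) into [delta_fixed]; the last term drops out by
    [delta_g1]. *)
Lemma delta_double X Y V : X \in gr (-1) -> Y \in gr (-1) -> V \in gr (-1) ->
  delta u X Y V *+ 2 = delta u X Y (pi 0 (AdP i h V)).
Proof.
move=> Xm Ym Vm; have := delta_fixed V Xm Ym.
rewrite {1}(gr_comp_sum gr (AdP i h V)) fixed_AdP_gm//.
have dD a b : delta u X Y (a + b) = delta u X Y a + delta u X Y b.
  by have := delta_linear u X Y 1 a b; rewrite !scale1r.
rewrite !dD (delta_g1 u Xm Ym (gr_comp_mem gr 1 _)) addr0.
have -> : delta u X Y (-1 *: V) = - delta u X Y V.
  have d0 : delta u X Y 0 = 0 by apply: (addIr (delta u X Y 0)); rewrite -dD !add0r.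
  by have hh := delta_linear u X Y (-1) V 0; rewrite d0 !addr0 in hh; rewrite hh scaleN1r.
by move=> /eqP; rewrite addrC subr_eq => /eqP ->; rewrite mulr2n.
Qed.

Lemma fixed_curvature_eq0 X Y : X \in gr (-1) -> Y \in gr (-1) ->
  pi 0 (kappa u X Y) = 0 -> kappa u X Y = 0.
Proof.
move=> Xm Ym k0; have e := nbhs_singleton (near_fixed_curvature Xm Ym).
rewrite Phi_u in e.
have k1 : kappa u X Y \in gr 1.
  by rewrite (filt0_sum (torsion_free_filt0 u Xm Ym)) k0 add0r gr_comp_mem.
rewrite (fixed_AdP_g1 k1) in e.
by apply: cv_inj => j; move/(congr1 (cv j)): e; rewrite !cvE; lra.
Qed.

End FixedPoint.
End VerticalDerivative.


(** * The exponential map on g_1 *)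

Section ExpAdAlgebra.
Import VectorInternalTheory.
Context {R : rcfType} {g : lieAlgType R} {gr : onegrading g}.
Local Notation gm := (gr (-1)).
Local Notation g0 := (gr 0).
Local Notation g1 := (gr 1).

Lemma exp_adD x y Y : exp_ad Y (x + y) = exp_ad Y x + exp_ad Y y :> g.
Proof.
rewrite /exp_ad !lieDr scalerDr.
by apply: cv_inj => j; rewrite !cvE; ring.
Qed.

Lemma exp_ad_linear (Y : g) : linear (exp_ad Y).
Proof.
move=> a x y; rewrite exp_adD; congr (_ + _).
by rewrite /exp_ad !lieZr !scalerDr !scalerA [_ * a]mulrC.
Qed.

Lemma exp_ad0 (x : g) : exp_ad 0 x = x.
Proof. by rewrite /exp_ad !lie0l scaler0 !addr0. Qed.

(** ad(Y) and ad(Z) commute, and any three factors from ad(g_1) compose to 0, so only the terms up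
    to order two need to match. *)
Lemma exp_ad_add Y Z x : Y \in g1 -> Z \in g1 -> exp_ad Y (exp_ad Z x) = exp_ad (Y + Z) x.
Proof.
move=> Y1 Z1; have YZ x' : lie Y (lie Z x') = lie Z (lie Y x').
  by have := lie_lie Y Z x'; rewrite (lie_11 Y1 Z1) lie0l => /eqP; rewrite eq_sym subr_eq0 => /eqP.
have h3 x' A B C : A \in g1 -> B \in g1 -> C \in g1 -> lie A (lie B (lie C x')) = 0.
  move=> A1 B1 C1; elim/(gr_ind (gr := gr)): x' => [u v hu hv|u um|u u0|u u1].
  - by rewrite !lieDr hu hv addr0.
  - by rewrite (lie_11 (gr := gr) A1) ?lie_10 ?lie_1m.
  - by rewrite (lie_11 B1 (lie_10 C1 u0)) lie0r.
  - by rewrite (lie_11 C1 u1) !lie0r.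
rewrite /exp_ad !lieDr !lieDl !lieDr !lieZr !h3// lie0r !scaler0 YZ.
by apply: cv_inj => j; rewrite !cvE; field.
Qed.

(** Evaluate at the grading element E, where exp(ad W) E = E - W. *)
Lemma exp_ad_inj Y Z : Y \in g1 -> Z \in g1 -> (forall x, exp_ad Y x = exp_ad Z x) -> Y = Z.
Proof.
move=> Y1 Z1 e; have [X [X0 _ _ X1]] := grading_element gr.
have h W : W \in g1 -> exp_ad W X = X - W.
  move=> W1; have WX : lie W X = - W by rewrite lieC X1.
  by rewrite /exp_ad WX lieNr liexx oppr0 scaler0 addr0.
by have := e X; rewrite !h// => /addrI/oppr_inj.
Qed.

Lemma center_trivial (A : g) : (forall x, lie A x = 0) -> A = 0.
Proof.
move=> h; apply: (killing_nondegenerate (gr_semisimple gr)) => y.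
rewrite /killing; have -> : admx A = 0.
  apply/row_matrixP => a; rewrite row0 rowE; have -> : delta_mx 0 a = v2r (r2v (delta_mx 0 a) : g) by rewrite r2vK.
  by rewrite admxP h linear0.
by rewrite mul0mx mxtrace0.
Qed.
End ExpAdAlgebra.

Section LinearMatrix.
Context {R : realType} {g : vectType R}.
Local Notation d := (\dim {:g}).

(** The analogue of [linmx] in the coordinates [vec], used where derivatives and norms are
    involved. *)
Definition mxl (f : g -> g) : 'M[R]_d := lin1_mx (fun r => vec (f (unvec r))).

Lemma mxlE f x : linear f -> vec (f x) = vec x *m mxl f.
Proof.
move=> lf; pose F : {linear 'rV[R]_d -> 'rV[R]_d} := HB.pack (fun r : 'rV[R]_d => vec (f (unvec r)))
  (GRing.isLinear.Build R _ _ *:%R (fun r : 'rV[R]_d => vec (f (unvec r)))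
   (fun c r r' => etrans (congr1 (vec \o f) (linearP unvec c r r')) (etrans (congr1 vec (lf c _ _)) (linearP vec c _ _)))).
by have := mul_rV_lin1 F (vec x); rewrite /F /= vecK.
Qed.

Lemma eq_mxl f h : f =1 h -> mxl f = mxl h.
Proof. by move=> fh; congr mxl; apply/funext. Qed.

Lemma mxl_inj f h : linear f -> linear h -> mxl f = mxl h -> f =1 h.
Proof. by move=> lf lh e x; apply: vec_inj; rewrite !mxlE// e. Qed.

Lemma mxl_comp f h : linear f -> linear h -> mxl (f \o h) = mxl h *m mxl f.
Proof.
move=> lf lh; apply/row_matrixP => a; rewrite !rowE -[delta_mx 0 a]unvecK mulmxA -!mxlE//=.
by move=> c x y /=; rewrite lh lf.
Qed.

Lemma mxl_id : mxl id = 1%:M.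
Proof.
apply/row_matrixP => a; rewrite !rowE -[delta_mx 0 a]unvecK -mxlE ?mulmx1//.
Qed.
End LinearMatrix.

(** * Matrix estimates *)

Section MatrixNorm.
Context {R : realType}.

Lemma le_mx_entry m n (X : 'M[R]_(m, n)) a b : `|X a b| <= `|X|.
Proof.
rewrite [leRHS]mx_normrE.
exact: (le_bigmax _ (fun i : 'I_m * 'I_n => `|X i.1 i.2|) (a, b)).
Qed.

Lemma mx_norm_le m n (X : 'M[R]_(m, n)) c : 0 <= c -> (forall a b, `|X a b| <= c) -> `|X| <= c.
Proof.
by move=> c0 h; rewrite [leLHS]mx_normrE; apply: bigmax_le => // -[a b] _; apply: h.
Qed.

(** The norm is the largest absolute value of an entry, which is not submultiplicative; the factor n
    accompanies the products in the estimates below. *)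
Lemma mx_norm_mul n (X Y : 'M[R]_n) : `|X *m Y| <= n%:R * `|X| * `|Y|.
Proof.
apply: mx_norm_le => [|a b]; first by rewrite !mulr_ge0.
rewrite mxE; apply: le_trans (ler_norm_sum _ _ _) _.
apply: le_trans (_ : \sum_(j < n) `|X| * `|Y| <= _).
  by apply: ler_sum => j _; rewrite normrM ler_pM// le_mx_entry.
by rewrite sumr_const card_ord -[leRHS]mulrA mulr_natl.
Qed.

(* The products X^j E(- j s) move away from 1 at most linearly in j. *)
Lemma power_estimate n (E : R -> 'M[R]_n) (X : 'M[R]_n) (K e s : R) (m : nat) :
  E 0 = 1%:M -> (forall s t, E (s + t) = E s *m E t) ->
  1 <= K -> (forall t, `|t| <= 1 -> n%:R * `|E t| <= K) -> `|1%:M : 'M[R]_n| <= 1 ->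
  0 <= e -> `|s| * m%:R <= 1 -> `|X - E s| <= e * `|s| -> 2 * n%:R * K ^+ 2 * e <= 1 ->
  `|iter m (mulmx^~ X) 1%:M - E (s * m%:R)| <= 2 * n%:R * K ^+ 3 * e * (`|s| * m%:R).
Proof.
move=> E0 ED K1 EK n1 e0 sm Xs small.
set a := fun j => iter j (mulmx^~ X) 1%:M : 'M[R]_n.
(* X^j moved back to time 0: one step changes it by X - E(s) between bounded factors. *)
pose x j := a j *m E (- (s * j%:R)).
have K0 : 0 <= K by apply: le_trans K1.
have aE j : a j = x j *m E (s * j%:R) by rewrite /x -mulmxA -ED addNr E0 mulmx1.
have sj j : (j <= m)%N -> `|s * j%:R| <= 1.
  move=> jm; rewrite normrM [`|j%:R|]ger0_norm//; apply: le_trans sm.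
  by apply: ler_wpM2l => //; rewrite ler_nat.
have step j : (j < m)%N -> `|x j.+1 - x j| <= `|x j| * (n%:R * K ^+ 2 * e * `|s|).
  move=> jm; have -> : x j.+1 - x j = x j *m (E (s * j%:R) *m (X - E s)) *m E (- (s * j.+1%:R)).
    rewrite mulmxBr mulmxBr mulmxBl mulmxA -aE; congr (_ - _).
    rewrite -ED -mulmxA -ED -[LHS]mulmx1 -E0; congr (_ *m E _).
    by rewrite -addn1 natrD; ring.
  apply: le_trans (mx_norm_mul _ _) _.
  have b1 : n%:R * `|E (- (s * j.+1%:R))| <= K by apply: EK; rewrite normrN sj.
  have b2 : n%:R * `|E (s * j%:R)| <= K by apply: EK; rewrite sj// ltnW.
  have b3 : `|x j *m (E (s * j%:R) *m (X - E s))| <= n%:R * `|x j| * (K * (e * `|s|)).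
    apply: le_trans (mx_norm_mul _ _) _; apply: ler_wpM2l; first by rewrite mulr_ge0.
    apply: le_trans (mx_norm_mul _ _) _; apply: ler_pM => //; by rewrite mulr_ge0.
  have -> : `|x j| * (n%:R * K ^+ 2 * e * `|s|) = n%:R * `|x j| * (K * (e * `|s|)) * K by ring.
  rewrite [n%:R * `|_|]mulrC -[leLHS]mulrA.
  by apply: ler_pM => //; rewrite mulr_ge0.
(* The factor 2 bounds [|x j|], which holds as long as j D <= 1; the hypothesis on e guarantees this
   up to j = m. *)
pose D := 2 * n%:R * K ^+ 2 * e * `|s|.
have D0 : 0 <= D by rewrite /D !mulr_ge0// exprn_ge0.
have Dm j : (j <= m)%N -> j%:R * D <= 1.
  move=> jm; apply: le_trans (_ : m%:R * D <= _).
    by apply: ler_wpM2r => //; rewrite ler_nat.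
  rewrite /D mulrCA; apply: le_trans (_ : 1 * 1 <= _); last by rewrite mulr1.
  rewrite [m%:R * _]mulrC; apply: ler_pM => //; by rewrite !mulr_ge0// exprn_ge0.
have claim j : (j <= m)%N -> `|x j - 1%:M| <= j%:R * D.
  elim: j => [_|j IH jm]; first by rewrite /x /a /= mulr0 oppr0 E0 mulmx1 subrr normr0 mul0r.
  have IHj := IH (ltnW jm).
  have xj : `|x j| <= 2.
    have := ler_normD (x j - 1%:M) 1%:M; rewrite subrK => h; apply: le_trans h _.
    by have := Dm j (ltnW jm); lra.
  have -> : x j.+1 - 1%:M = (x j.+1 - x j) + (x j - 1%:M) by rewrite addrA subrK.
  apply: le_trans (ler_normD _ _) _; rewrite -natr1 mulrDl mul1r addrC; apply: lerD => //.
  apply: le_trans (step j jm) _; rewrite /D.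
  have -> : 2 * n%:R * K ^+ 2 * e * `|s| = 2 * (n%:R * K ^+ 2 * e * `|s|) by ring.
  by apply: ler_pM => //; rewrite !mulr_ge0// exprn_ge0.
rewrite -/(a m) aE -{2}[E (s * m%:R)]mul1mx -mulmxBl.
apply: le_trans (mx_norm_mul _ _) _.
have b : n%:R * `|E (s * m%:R)| <= K by apply: EK; rewrite sj.
have c := claim m (leqnn m).
have -> : 2 * n%:R * K ^+ 3 * e * (`|s| * m%:R) = (m%:R * D) * K by rewrite /D; ring.
rewrite -mulrA mulrCA; apply: ler_pM => //; by rewrite mulr_ge0.
Qed.

End MatrixNorm.

(** * Lower bounds for immersions *)

Section Immersion.
Context {R : realType}.

Lemma findim_mx m n : findim 'M[R]_(m, n).
Proof.
pose c (j : 'I_m * 'I_n) (v : 'M[R]_(m, n)) : R := v j.1 j.2.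
have lc j : linear_for *%R (c j) by move=> a u v; rewrite /c !mxE.
pose C j : {linear 'M[R]_(m, n) -> R} :=
  HB.pack (c j) (GRing.isLinear.Build R 'M[R]_(m, n) R *%R (c j) (lc j)).
exists ('I_m * 'I_n)%type, (fun j => delta_mx j.1 j.2), C; split=> [j x|v].
  exact: coord_continuous.
by rewrite {1}[v]matrix_sum_delta pair_bigA.
Qed.

Lemma linear_bound (V W : normedModType R) (l : {linear V -> W}) : continuous l ->
  exists2 C : R, 0 < C & forall v, `|l v| <= C * `|v|.
Proof.
by move=> cl; have [C C0 h] := linear_lipschitz cl; exists C => // v; apply: h.
Qed.

Lemma linear_left_inverse (V W : vectType R) (f : {linear V -> W}) : injective f ->
  exists l : {linear W -> V}, cancel f l.
Proof.
move=> fi; have k0 : lker (linfun f) == 0%VS.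
  by apply/lker0P => x y; rewrite !lfunE => /fi.
by exists ((linfun f)^-1)%VF => x; have := lker0_lfunK k0 x; rewrite lfunE.
Qed.

Lemma near_finite (T : topologicalType) (x : T) (I : finType) (Q : I -> T -> Prop) :
  (forall j, \forall y \near x, Q j y) -> \forall y \near x, forall j, Q j y.
Proof. exact: filter_forall. Qed.

Lemma difB (V W : normedModType R) (f h : V -> W) x v :
  differentiable f x -> differentiable h x ->
  dif (fun y => f y - h y) x v = dif f x v - dif h x v.
Proof.
by move=> df dh; rewrite !difE; apply: (congr1 (fun k => k v) (diffB df dh)).
Qed.

Lemma near_norm (V : normedModType R) (x : V) (Q : V -> Prop) : (\forall y \near x, Q y) ->
  exists2 r : R, 0 < r & forall y, `|x - y| < r -> Q y.
Proof. by move=> /nbhs_normP[r r0 h]; exists r => // y xy; apply: h. Qed.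

(** Near x all partial derivatives of the coordinates of H are below [eta]. The mean value theorem
    on segments, summed over k directions, gives the Lipschitz constant k [eta] <= 1/2; the k + 1 in
    [eta] covers k = 0. *)
Lemma near_identity_bound k (H : 'rV[R]_k -> 'rV[R]_k) x : smooth_at H x ->
  (forall v, dif H x v = 0) ->
  \forall r \near 0^'+, forall p q, `|x - p| < r -> `|x - q| < r -> `|H p - H q| <= 2^-1 * `|p - q|.
Proof.
move=> sH dH0; pose eta : R := (2 * k.+1%:R)^-1.
have eta0 : 0 < eta by rewrite invr_gt0 mulr_gt0.
have sHj j : smooth_at (fun y => H y 0 j) x by apply: smooth_at_coord.
pose cf (j : 'I_k) (v : 'rV[R]_k) : R := v 0 j.
have lcf j : linear_for *%R (cf j) by move=> a u v; rewrite /cf !mxE.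
pose cl j : {linear 'rV[R]_k -> R} :=
  HB.pack (cf j) (GRing.isLinear.Build R 'rV[R]_k R *%R (cf j) (lcf j)).
have dHj j v : dif (fun y => H y 0 j) x v = 0.
  have ccl : continuous (cl j) by apply: findim_linear_continuous; apply: findim_rV.
  by apply: etrans (dif_comp_lin v ccl (smooth_at_differentiable sH)) _; rewrite dH0 linear0.
pose Q (jl : 'I_k * 'I_k) (y : 'rV[R]_k) := `|dif (fun y => H y 0 jl.1) y (delta_mx 0 jl.2)| < eta.
have nD : \forall y \near x, forall jl, Q jl y.
  apply: near_finite => -[j l]; rewrite /Q /=.
  have c := smooth_at_continuous (smooth_at_dif (delta_mx 0 l) (sHj j)).
  have /cvgr_dist_lt/(_ _ eta0) := c; apply: filterS => y.
  by rewrite dHj sub0r normrN.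
pose Q' (j : 'I_k) (y : 'rV[R]_k) := differentiable (fun y => H y 0 j) y.
have nd : \forall y \near x, forall j, Q' j y.
  apply: near_finite => j; rewrite /Q'.
  by apply: filterS (smooth_at_near (sHj j)) => y; apply: smooth_at_differentiable.
have nDd : \forall y \near x, (forall jl, Q jl y) /\ (forall j, Q' j y) by apply: filterS2 nD nd.
have [r0 r00 hr] := near_norm nDd.
near=> r; have rr0 : r <= r0 by near: r; apply: nbhs_right_le.
have {}hr y : `|x - y| < r -> (forall jl : 'I_k * 'I_k,
    `|dif (fun y => H y 0 jl.1) y (delta_mx 0 jl.2)| < eta) /\
    forall j : 'I_k, differentiable (fun y => H y 0 j) y.
  by move=> xy; apply: hr; apply: lt_le_trans xy rr0.
move=> p q xp xq; apply: mx_norm_le => [|a j]; first by rewrite mulr_ge0.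
rewrite ord1 !mxE.
have seg (s : R) : 0 <= s <= 1 -> `|x - (q + s *: (p - q))| < r.
  move=> /andP[s0 s1]; have -> : x - (q + s *: (p - q)) = (1 - s) *: (x - q) + s *: (x - p).
    by rewrite scalerBl scale1r !scalerBr; apply/rowP => l; rewrite !mxE; ring.
  apply: le_lt_trans (ler_normD _ _) _; rewrite !normrZ (ger0_norm s0) ger0_norm ?subr_ge0//.
  have [->|s00] := eqVneq s 0; first by rewrite subr0 mul1r mul0r addr0.
  have s0' : 0 < s by rewrite lt_def s00.
  have h1 : (1 - s) * `|x - q| <= (1 - s) * r by apply: ler_wpM2l; [rewrite subr_ge0|apply: ltW].
  have h2 : s * `|x - p| < s * r by rewrite ltr_pM2l.
  by lra.
have [s /andP[s0 s1] E] := @MVT_line R 'rV[R]_k (fun y => H y 0 j) q (p - q) 1 ltr01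
  (fun s hs => (hr _ (seg s hs)).2 j).
rewrite scale1r [q + _]addrC subrK mul1r in E.
have [hD hd] := hr _ (seg s (introT andP (conj (ltW s0) (ltW s1)))).
rewrite E -(dif_derive _ (hd j)).
pose l := dif (fun y => H y 0 j) (q + s *: (p - q)).
have -> : dif (fun y => H y 0 j) (q + s *: (p - q)) (p - q) = \sum_b (p - q) 0 b * l (delta_mx 0 b).
  pose L : {linear 'rV[R]_k -> R} := HB.pack l (GRing.isLinear.Build R 'rV[R]_k R *%R l (dif_linear _ _)).
  have LE u : L u = \sum_b u 0 b * l (delta_mx 0 b).
    by rewrite [in LHS](row_sum_delta u) linear_sum; apply: eq_bigr => b _; rewrite linearZ.
  exact: LE.
apply: le_trans (ler_norm_sum _ _ _) _.
apply: le_trans (_ : \sum_(b < k) `|p - q| * eta <= _).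
  apply: ler_sum => b _; rewrite normrM; apply: ler_pM => //; first exact: le_mx_entry.
  exact: ltW (hD (j, b)).
rewrite sumr_const card_ord -[leLHS]mulr_natl mulrCA mulrC.
apply: ler_wpM2r => //; rewrite /eta invfM mulrCA -[leRHS]mulr1.
apply: ler_wpM2l; first by rewrite invr_ge0.
by rewrite ler_pdivrMr// mul1r ler_nat.
Unshelve. all: by end_near. Qed.

(** With l a left inverse of the derivative at x, H = l o F - id has derivative 0 at x, so |p - q|
    <= |l(F p - F q)| + |p - q| / 2 near x. *)
Lemma immersion_lower_bound k m n (F : 'rV[R]_k -> 'M[R]_(m, n)) x : smooth_at F x ->
  (forall v, dif F x v = 0 -> v = 0) ->
  exists2 C : R, 0 < C & \forall r \near 0^'+, forall p q, `|x - p| < r -> `|x - q| < r ->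
    `|p - q| <= C * `|F p - F q|.
Proof.
move=> sF iF; pose D : {linear 'rV[R]_k -> 'M[R]_(m, n)} := HB.pack (dif F x)
  (GRing.isLinear.Build R 'rV[R]_k 'M[R]_(m, n) *:%R (dif F x) (dif_linear F x)).
have Di : injective D by apply: raddf_inj => v; apply: iF.
have [l lK] := linear_left_inverse Di.
have cl : continuous l by apply: findim_linear_continuous; apply: findim_mx.
have [C C0 lC] := linear_bound cl.
pose H p := l (F p) - p.
have slF := smooth_at_lin cl sF.
have sH : smooth_at H x by apply: smooth_atB => //; apply: smooth_at_id.
have dH v : dif H x v = 0.
  have d1 := smooth_at_differentiable slF.
  have d2 : differentiable (@id 'rV[R]_k) x by apply: smooth_at_differentiable; apply: smooth_at_id.
  apply: etrans (difB v d1 d2) _.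
  rewrite dif_id; apply/eqP; rewrite subr_eq0; apply/eqP.
  by apply: etrans (dif_comp_lin _ cl (smooth_at_differentiable sF)) _; apply: lK.
exists (2 * C); first by rewrite mulr_gt0.
apply: filterS (near_identity_bound sH dH) => r hr p q xp xq.
have h1 := hr p q xp xq; have h2 := lC (F p - F q); rewrite linearB in h2.
have e : p - q = (l (F p) - l (F q)) - (H p - H q).
  by rewrite /H; apply/rowP => j; rewrite !mxE; ring.
have h3 : `|p - q| <= `|l (F p) - l (F q)| + `|H p - H q|.
  by rewrite {1}e; apply: le_trans (ler_normD _ _) _; rewrite normrN.
have h4 : 2 * C * `|F p - F q| = 2 * (C * `|F p - F q|) by ring.
by rewrite h4; move: h1 h2 h3; lra.
Qed.

End Immersion.

Lemma dif_scale (R : realType) (V W : normedModType R) (f : V -> W) x a v :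
  dif f x (a *: v) = a *: dif f x v.
Proof. by rewrite !difE linearZ. Qed.

Section MatrixOfLinear.
Context {R : realType} {g : vectType R}.
Local Notation d := (\dim {:g}).

Lemma mxl_entry (f : g -> g) a b : mxl f a b = vec (f (unvec (delta_mx 0 a))) 0 b.
Proof. by rewrite mxE. Qed.

Lemma mxl_sum (f : g -> g) : mxl f =
  \sum_a (delta_mx a 0 : 'M[R]_(d, 1)) *m vec (f (unvec (delta_mx 0 a))).
Proof.
apply/matrixP => x y; rewrite mxl_entry summxE (bigD1 x)//= [X in _ = X + _]mxE big_ord1 [X in X * _]mxE !eqxx mul1r.
rewrite big1 ?addr0// => a ax; rewrite mxE big_ord1 [X in X * _]mxE andbT eq_sym.
by rewrite (negPf ax) mul0r.
Qed.
End MatrixOfLinear.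

(** * Ad as a matrix-valued map and curves tangent to exp *)

Section AdMatrix.
Context {R : realType} {n k : nat} {G : lieGroupType R n}.
Context {g : lieAlgType R} {L : lie_algebra_of G g} {gr : onegrading g}.
Context {P : lieGroupType R k} (i : parabolic_subgroup L gr P).
Implicit Types h : P.
Local Notation e0 := (chart_at (1%g : P) 1%g).
Local Notation bwd := (pbwd (chart_at (1%g : P))).
Local Notation d := (\dim {:g}).

Definition Adm h : 'M[R]_d := mxl (AdP i h).

Lemma AdmM h h' : Adm (h * h')%g = Adm h' *m Adm h.
Proof.
rewrite /Adm -mxl_comp; [|exact: AdP_linear|exact: AdP_linear].
by apply: eq_mxl => x; rewrite AdPM.
Qed.

Lemma Adm1 : Adm 1%g = 1%:M.
Proof. by rewrite -mxl_id; apply: eq_mxl => x; rewrite AdP1. Qed.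

Lemma AdmX h m : Adm (h ^+ m)%g = iter m (mulmx^~ (Adm h)) 1%:M.
Proof. by elim: m => [|m IH]; rewrite ?expg0 ?Adm1// expgS AdmM IH. Qed.

Definition Adm_chart (p : 'rV[R]_k) : 'M[R]_d := Adm (bwd p).

Lemma Adm_chart_smooth : smooth_at Adm_chart e0 /\
  forall b, dif Adm_chart e0 b = mxl (lie (lieP i b)).
Proof.
pose l a : {linear 'rV[R]_d -> 'M[R]_d} := mulmx (delta_mx a 0 : 'M[R]_(d, 1)).
have cl a : continuous (l a) by apply: findim_linear_continuous; apply: findim_rV.
pose T a p := l a (vec (AdP i (bwd p) (unvec (delta_mx 0 a)))).
have E p : \sum_a T a p = Adm_chart p by rewrite /Adm_chart /Adm mxl_sum.
have sT a : smooth_at (T a) e0.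
  by have [s _] := AdP_chart i (unvec (delta_mx 0 a)); apply: smooth_at_lin.
have sS : smooth_at Adm_chart e0.
  by apply: smooth_at_near_eq (smooth_at_sum sT); apply: near_all.
split=> // b; rewrite dif_derive; last exact: smooth_at_differentiable.
have nE : \forall p \near e0, \sum_a T a p = Adm_chart p by apply: near_all.
have [_ D] := derive_sum_fin (fun a => smooth_at_differentiable (sT a)).
rewrite -(near_eq_derive b nE); apply: etrans (D b) _.
rewrite [RHS]mxl_sum; apply: eq_bigr => a _.
have [s Da] := AdP_chart i (unvec (delta_mx 0 a)).
rewrite -dif_derive; last exact: smooth_at_differentiable.
apply: etrans (dif_comp_lin b (cl a) (smooth_at_differentiable s)) _.
exact: (congr1 (l a) (Da b)).
Qed.

Lemma Adm_chart_immersion b : dif Adm_chart e0 b = 0 -> b = 0.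
Proof.
have [_ ->] := Adm_chart_smooth => e; apply: (@lieP_inj _ _ _ _ _ _ _ _ i).
rewrite (linear0 (lieP i)); apply: (center_trivial (gr := gr)) => x.
apply: vec_inj; rewrite mxlE; first by rewrite e mulmx0 linear0.
exact: lie_linearr.
Qed.

Section ExpMatrix.
Variable Y : g.
Hypothesis Y1 : Y \in gr 1.

Definition expm (s : R) : 'M[R]_d := mxl (exp_ad (s *: Y)).

Lemma expm0 : expm 0 = 1%:M.
Proof. by rewrite -mxl_id; apply: eq_mxl => x; rewrite scale0r exp_ad0. Qed.

Lemma expmD s t : expm (s + t) = expm s *m expm t.
Proof.
rewrite /expm -mxl_comp; [|exact: exp_ad_linear|exact: exp_ad_linear].
by apply: eq_mxl => x /=; rewrite (exp_ad_add (gr := gr)) ?memvZ// scalerDl addrC.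
Qed.

Let B := mxl (lie Y).
Let B2 := mxl (fun x => lie Y (lie Y x)).

Lemma expmE s : expm s = 1%:M + s *: B + (s ^+ 2 / 2) *: B2.
Proof.
rewrite -mxl_id; apply/matrixP => a b; rewrite [in RHS]mxE [X in X + _]mxE !(mxE _ _ a b).
move: (unvec _) => v.
have -> : exp_ad (s *: Y) v = v + s *: lie Y v + (s ^+ 2 / 2) *: lie Y (lie Y v).
  rewrite /exp_ad !lieZl !lieZr !scalerA; congr (_ + _ *: _).
  by rewrite mulrC expr2.
by rewrite !linearD !linearZ /= !mxE.
Qed.

Lemma expm_bound : exists2 K, 1 <= K & forall t, `|t| <= 1 -> d%:R * `|expm t| <= K.
Proof.
exists (1 + d%:R * (1 + `|B| + `|B2|)); first by rewrite lerDl mulr_ge0// !addr_ge0.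
move=> t t1; apply: le_trans (_ : d%:R * (1 + `|B| + `|B2|) <= _); last by rewrite lerDr.
apply: ler_wpM2l => //; rewrite expmE.
apply: le_trans (ler_normD _ _) _; apply: lerD.
  apply: le_trans (ler_normD _ _) _; apply: lerD.
    apply: mx_norm_le => // a b; rewrite mxE.
    by case: eqP => _; rewrite ?normr1 ?normr0.
  by rewrite normrZ ler_piMl.
rewrite normrZ ler_piMl// normrM normfV [`|2|]ger0_norm// normrX.
have := exprn_ile1 2 (normr_ge0 t) t1; have := exprn_ge0 2 (normr_ge0 t); lra.
Qed.

Lemma expm_linear_approx s : `|s| <= 1 -> `|expm s - 1%:M - s *: B| <= `|s| * `|s| * `|B2|.
Proof.
move=> s1; rewrite expmE; have -> : 1%:M + s *: B + s ^+ 2 / 2 *: B2 - 1%:M - s *: B = s ^+ 2 / 2 *: B2.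
  by apply/matrixP => a b; rewrite !mxE; ring.
rewrite normrZ; apply: ler_wpM2r => //; rewrite normrM normfV [`|2|]ger0_norm// normrX expr2.
have : 0 <= `|s| * `|s| by rewrite mulr_ge0.
lra.
Qed.

Lemma expm_near1 : exists2 C, 0 < C & forall s, `|s| <= 1 -> `|expm s - 1%:M| <= C * `|s|.
Proof.
exists (1 + `|B| + `|B2|) => [|s s1]; first by rewrite -addrA ltr_pwDl// addr_ge0.
have h := expm_linear_approx s1.
have e : expm s - 1%:M = (expm s - 1%:M - s *: B) + s *: B by rewrite subrK.
rewrite e; apply: le_trans (ler_normD _ _) _; rewrite normrZ.
have h2 : `|s| * `|s| * `|B2| <= `|s| * `|B2|.
  by rewrite -mulrA; apply: ler_piMl => //; rewrite mulr_ge0.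
have h3 := normr_ge0 s.
rewrite mulrDl mulrDl mul1r [`|B| * _]mulrC [`|B2| * _]mulrC.
by move: h h2 h3; set a := `|expm s - _ - _|; lra.
Qed.

(** First-order contact of Ad(c(s)) with exp(s ad Y) at s = 0; no group property of c is
    involved. *)
Definition exp_tangent (c : R -> P) := forall e : R, 0 < e ->
  exists2 r : R, 0 < r & forall s, `|s| < r -> `|Adm (c s) - expm s| <= e * `|s|.

Lemma tangent_curve (c : R -> P) b : lieP i b = Y -> c 0 = 1%g ->
  (\forall s \near (0 : R), psrc (chart_at (1%g : P)) (c s)) ->
  differentiable (fun s => chart_at (1%g : P) (c s)) (0 : R) ->
  'D_1 (fun s => chart_at (1%g : P) (c s)) (0 : R) = b -> exp_tangent c.
Proof.
move=> bY c0 nc; set x := fun s : R => _ => dx Dx e ep.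
have [sF dF] := Adm_chart_smooth.
have x0 : x 0 = e0 by rewrite /x c0.
have df0 : differentiable Adm_chart (x 0) by rewrite x0; apply: smooth_at_differentiable.
have dc : differentiable (Adm_chart \o x) (0 : R) by apply: differentiable_comp.
have nE : \forall s \near (0 : R), (Adm_chart \o x) s = Adm (c s).
  by apply: filterS nc => s cs; rewrite /= /Adm_chart /x chartK.
have df := near_eq_differentiable nE dc.
have D s : 'd (fun s => Adm (c s)) (0 : R) s = s *: B.
  rewrite -difE.
  have -> : dif (fun s => Adm (c s)) (0 : R) s = s *: dif (fun s => Adm (c s)) (0 : R) 1.
    by rewrite -dif_scale; congr dif; rewrite [RHS]mulr1.
  congr (_ *: _); rewrite (near_eq_dif (1 : R) nE dc).
  apply: etrans (dif_comp (1 : R) dx df0) _; rewrite x0 dF.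
  by rewrite (dif_derive (1 : R) dx) Dx bY.
have e20 : 0 < e / 2 by rewrite divr_gt0.
have [r r0 hr] := near_norm (differentiable_epsP df e20).
have q0 : 0 < e / (2 * (1 + `|B2|)) by rewrite divr_gt0// mulr_gt0// ltr_pwDl.
exists (Num.min r (Num.min 1 (e / (2 * (1 + `|B2|))))); first by rewrite !lt_min r0 ltr01.
move=> s; rewrite !lt_min => /and3P[sr s1 sq].
have h1 : `|Adm (c s) - 1%:M - s *: B| <= e / 2 * `|s|.
  have := hr s; rewrite sub0r normrN => /(_ sr).
  by rewrite D c0 Adm1 addr0.
have h2 := expm_linear_approx (ltW s1).
have h3 : `|s| * `|s| * `|B2| <= e / 2 * `|s|.
  rewrite mulrAC; apply: ler_wpM2r => //.
  move: sq; rewrite ltr_pdivlMr ?mulr_gt0// ?ltr_pwDl//.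
  have := normr_ge0 s; have := normr_ge0 B2; set x1 := `|s|; set x2 := `|B2|.
  move=> a1 a2; lra.
have -> : Adm (c s) - expm s = (Adm (c s) - 1%:M - s *: B) - (expm s - 1%:M - s *: B).
  by apply/matrixP => a a'; rewrite !mxE; ring.
apply: le_trans (ler_normB _ _) _; move: h1 h2 h3.
set u1 := `|_ - _ - _|; set u2 := `|_ - _ - _|; lra.
Qed.

(** An error e'|s| in one factor grows over j factors to at most a multiple of e'|s| j <= e', by
    [power_estimate]. *)
Lemma tangent_power (c : R -> P) : exp_tangent c -> forall e : R, 0 < e ->
  exists2 r : R, 0 < r & forall s j, `|s| < r -> `|s| * j%:R <= 1 ->
    `|Adm (c s ^+ j)%g - expm (s * j%:R)| <= e.
Proof.
move=> tc e e0; have [K K1 EK] := expm_bound.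
have K0 : 0 < K by apply: lt_le_trans K1.
(* [D] dominates the constants in both the smallness hypothesis and the conclusion of
   [power_estimate], so e' = min(e, 1) / D serves both. *)
pose D : R := 1 + 2 * d%:R * K ^+ 3 + 2 * d%:R * K ^+ 2.
have k2 : 0 <= 2 * d%:R * K ^+ 2 by apply: mulr_ge0; [exact: mulr_ge0|apply: exprn_ge0; apply: ltW].
have k3 : 0 <= 2 * d%:R * K ^+ 3 by apply: mulr_ge0; [exact: mulr_ge0|apply: exprn_ge0; apply: ltW].
have D0 : 0 < D by rewrite /D -addrA ltr_pwDl// addr_ge0.
pose e' := Num.min e 1 / D.
have e'0 : 0 < e' by rewrite divr_gt0// lt_min e0 ltr01.
have e'D : e' * D = Num.min e 1 by rewrite /e' divfK// gt_eqF.
have [r r0 hr] := tc e' e'0; exists r => // s j sr sj.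
have n1 : `|1%:M : 'M[R]_d| <= 1.
  by apply: mx_norm_le => // a b; rewrite mxE; case: eqP => _; rewrite ?normr1 ?normr0.
have b2 : 2 * d%:R * K ^+ 2 * e' <= 1.
  have : Num.min e 1 <= 1 by rewrite ge_min lexx orbT.
  rewrite -e'D /D !mulrDr mulr1 [e' * (2 * d%:R * K ^+ 2)]mulrC.
  have := mulr_ge0 (ltW e'0) k3; have := ltW e'0; lra.
have := power_estimate expm0 expmD K1 EK n1 (ltW e'0) sj (hr s sr) b2.
rewrite AdmX => h; apply: le_trans h _.
apply: le_trans (_ : 2 * d%:R * K ^+ 3 * e' * 1 <= _).
  by apply: ler_wpM2l => //; apply: mulr_ge0 => //; apply: ltW.
rewrite mulr1.
have : Num.min e 1 <= e by rewrite ge_min lexx.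
rewrite -e'D /D !mulrDr mulr1 [e' * (2 * d%:R * K ^+ 3)]mulrC.
have := mulr_ge0 (ltW e'0) k2; have := ltW e'0; lra.
Qed.

Lemma small_norm_eq m1 m2 (X X' : 'M[R]_(m1, m2)) : (forall e : R, 0 < e -> `|X - X'| <= e) -> X = X'.
Proof.
move=> h; apply/eqP; rewrite -subr_eq0 -normr_le0; apply/ler_addgt0Pr => e e0.
by rewrite add0r; apply: h.
Qed.

Lemma one_parameterX (c : R -> P) : (forall s t, c (s + t) = (c s * c t)%g) ->
  c 0 = 1%g /\ forall s j, c (s * j%:R) = (c s ^+ j)%g.
Proof.
move=> cD; have c0 : c 0 = 1%g.
  by have := cD 0 0; rewrite addr0 -[LHS]mulg1 => /mulgI.
split=> // s; elim=> [|j IH]; first by rewrite mulr0 expg0.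
by rewrite expgS -IH -cD -natr1 mulrDr mulr1 addrC.
Qed.

(** c(t) = c(t / m)^m, and Ad of the right-hand side is arbitrarily close to exp(t ad Y) for large
    m. *)
Lemma exp_curve_Adm (c : R -> P) : (forall s t, c (s + t) = (c s * c t)%g) ->
  (forall t, csmooth_at c t) -> lieP i (velocity c 0) = Y ->
  forall t, `|t| <= 1 -> Adm (c t) = expm t.
Proof.
move=> cD cs cY t t1; have [c0 cX] := one_parameterX cD.
have [cc sc] := cs 0.
have tc : exp_tangent c.
  apply: (tangent_curve cY c0).
  - by apply: (cvg_near cc); rewrite c0; apply: near_chart_src; apply: chart_at_src.
  - by move: sc; rewrite c0 => /smooth_at_differentiable.
  - by rewrite /velocity derive1E c0.
apply: small_norm_eq => e e0; have [r r0 hr] := tangent_power tc e0.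
pose m := (Num.truncn (r^-1)).+1.
have m0 : 0 < m%:R :> R by rewrite ltr0n.
have mr : `|t / m%:R| < r.
  rewrite normrM normfV [`|m%:R|]ger0_norm// ltr_pdivrMr//.
  apply: le_lt_trans t1 _; rewrite -ltr_pdivrMl// mulr1.
  exact: truncnS_gt.
have mj : `|t / m%:R| * m%:R <= 1.
  by rewrite normrM normfV [`|m%:R|]ger0_norm// divfK// gt_eqF.
have := hr (t / m%:R) m mr mj.
by rewrite -cX divfK// gt_eqF.
Qed.

End ExpMatrix.
End AdMatrix.

(** * Extension of local one-parameter subgroups *)

Section LocalHomExtension.
Context {R : realType} {P : groupType}.

(** c(t) is c0(t / m)^m for m so large that t / m lies in the domain; two choices of m agree with
    their product, hence with each other. *)
Lemma local_hom_extension (c0 : R -> P) (r : R) : 0 < r ->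
  (forall s t, `|s| < r -> `|t| < r -> `|s + t| < r -> c0 (s + t) = (c0 s * c0 t)%g) ->
  exists c : R -> P, (forall s t, c (s + t) = (c s * c t)%g) /\ forall t, `|t| < r -> c t = c0 t.
Proof.
move=> r0 h.
have c00 : c0 0 = 1%g.
  by have := h 0 0; rewrite addr0 normr0 => /(_ r0 r0 r0); rewrite -[LHS]mulg1 => /mulgI.
have P1 t n j : `|t| < r -> (j <= n)%N -> c0 (t * (j%:R / n%:R)) = (c0 (t / n%:R)%R ^+ j)%g.
  move=> tr; have small x : 0 <= x <= 1 -> `|t * x| < r.
    by move=> /andP[x0 x1]; rewrite normrM (ger0_norm x0); apply: le_lt_trans tr; rewrite ler_piMr.
  have in01 j' : (j' <= n)%N -> 0 <= (j'%:R / n%:R : R) <= 1.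
    move=> jn; rewrite divr_ge0//=; case: n jn => [|n] jn; first by rewrite invr0 mulr0.
    by rewrite ler_pdivrMr ?ltr0n// mul1r ler_nat.
  elim: j => [_|j IH jn]; first by rewrite mul0r mulr0 c00 expg0.
  have n1 : (1 <= n)%N by apply: leq_trans jn.
  have tn : t / n%:R = t * (1%:R / n%:R) by rewrite mul1r.
  rewrite expgS -IH ?(ltnW jn)// -h.
  - by congr c0; rewrite -natr1; ring.
  - by rewrite tn; apply: small; apply: in01.
  - by apply: small; apply: in01; apply: ltnW.
  - by rewrite tn -mulrDr -mulrDl -natrD add1n; apply: small; apply: in01.
pose good t m := ((0 < m)%N && (`|t / m%:R| < r)).
have P2 t m n : good t m -> (0 < n)%N -> (c0 (t / m%:R)%R ^+ m = c0 (t / (m * n)%:R)%R ^+ (m * n))%g.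
  move=> /andP[m0 tm] n0.
  have := P1 _ n n tm (leqnn n); rewrite divff ?pnatr_eq0 -?lt0n// mulr1 => ->.
  by rewrite mulnC expgnA; congr ((c0 _ ^+ _) ^+ _)%g; rewrite natrM invfM mulrA mulrAC.
have P3 t m n : good t m -> good t n -> (c0 (t / m%:R)%R ^+ m = c0 (t / n%:R)%R ^+ n)%g.
  move=> gm gn; rewrite (P2 t m n)//; last by case/andP: gn.
  by rewrite [RHS](P2 t n m)//; [rewrite mulnC|case/andP: gm].
pose m0 (t : R) := (Num.truncn (`|t| / r)).+1.
have g0 t m : (m0 t <= m)%N -> good t m.
  move=> tm; apply/andP; split; first exact: leq_trans tm.
  rewrite normrM normfV [`|m%:R|]ger0_norm// ltr_pdivrMr ?ltr0n; last exact: leq_trans tm.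
  rewrite mulrC -ltr_pdivrMr//; apply: lt_le_trans (truncnS_gt _) _.
  by rewrite ler_nat.
pose c t := (c0 (t / (m0 t)%:R)%R ^+ m0 t)%g.
have cE t m : good t m -> c t = (c0 (t / m%:R)%R ^+ m)%g.
  by move=> gm; apply: P3 => //; apply: g0.
exists c; split=> [s t|t tr]; last first.
  by rewrite (@cE t 1%N) ?divr1 ?expg1//; rewrite /good divr1 tr.
(* One index serves s, t and s + t. The values of c0 at s / m and t / m commute, as c0 of their sum
   is symmetric, so the m-th power of the product splits. *)
pose m := maxn (maxn (m0 s) (m0 t)) (m0 (s + t)).
have gs : good s m by apply: g0; rewrite /m !leq_max leqnn.
have gt : good t m by apply: g0; rewrite /m !leq_max leqnn orbT.
have gst : good (s + t) m by apply: g0; rewrite /m !leq_max leqnn !orbT.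
rewrite !(cE _ m)//.
move: gs gt gst => /andP[_ ms] /andP[_ mt] /andP[_ mst].
have e1 : c0 ((s + t) / m%:R) = (c0 (s / m%:R)%R * c0 (t / m%:R)%R)%g.
  by rewrite mulrDl h// -mulrDl.
have e2 : (c0 (s / m%:R)%R * c0 (t / m%:R)%R = c0 (t / m%:R)%R * c0 (s / m%:R)%R)%g.
  by rewrite -e1 addrC mulrDl h// -mulrDl addrC.
by rewrite e1 expgMn.
Qed.

End LocalHomExtension.

Section ChartBalls.
Context {R : realType} {k : nat} {P : lieGroupType R k}.
Local Notation chart1 := (chart_at (1%g : P)).
Local Notation e0 := (chart1 1%g).

(** A ball around 1 in the chart at 1. The chart domain is part of the condition, as the values of
    the chart elsewhere are irrelevant. *)
Definition cball (r : R) (h : P) := psrc chart1 h /\ `|e0 - chart1 h| < r.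

Let s1 : psrc chart1 1%g := chart_at_src (1%g : P).

Lemma cball_le r r' h : r <= r' -> cball r h -> cball r' h.
Proof. by move=> rr [hs hr]; split=> //; apply: lt_le_trans hr rr. Qed.

Lemma cball_inj r h h' : cball r h -> cball r h' -> chart1 h = chart1 h' -> h = h'.
Proof. by move=> [hs _] [hs' _] e; rewrite -(chartK hs) e (chartK hs'). Qed.

Lemma cball1 r : 0 < r -> cball r 1%g.
Proof. by move=> r0; split=> //; rewrite subrr normr0. Qed.

Lemma near_cball r : 0 < r -> \forall h \near (1%g : P), cball r h.
Proof.
move=> r0; have /cvgr_dist_lt/(_ _ r0) n1 := chart_continuous s1.
by apply: filterS2 (near_chart_src s1) n1.
Qed.

Lemma nbhs_cball (A : P -> Prop) : (\forall h \near (1%g : P), A h) ->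
  exists2 r : R, 0 < r & forall h, cball r h -> A h.
Proof.
move=> nA; have [r r0 hr] := near_norm (cvg_near (chart_bwd_continuous s1) nA).
by exists r => // h [hs /hr]; rewrite chartK.
Qed.

Lemma cball_mul r : 0 < r -> exists2 q : R, 0 < q <= r &
  forall h h', cball q h -> cball q h' -> cball r (h * h')%g.
Proof.
move=> r0; have [cm _] := @mul_smooth _ _ P 1%g 1%g.
have nm : \forall z \near ((1%g : P), (1%g : P)), cball r (z.1 * z.2)%g.
  by apply: (cvg_near cm); rewrite mulg1; apply: near_cball.
case: nm => -[A B] /= [nA nB] AB.
have [a a0 ha] := nbhs_cball nA; have [b b0 hb] := nbhs_cball nB.
exists (Num.min r (Num.min a b)); first by rewrite !lt_min r0 a0 b0 ge_min lexx.
move=> h h' hh hh'; apply: (AB (h, h')); split=> /=.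
  by apply: ha; apply: cball_le hh; rewrite !ge_min lexx !orbT.
by apply: hb; apply: cball_le hh'; rewrite !ge_min lexx !orbT.
Qed.
End ChartBalls.

(** * Existence of exp on g_1 *)

Section ExpExistence.
Context {R : realType} {n k : nat} {G : lieGroupType R n}.
Context {g : lieAlgType R} {L : lie_algebra_of G g} {gr : onegrading g}.
Context {P : lieGroupType R k} (i : parabolic_subgroup L gr P).
Local Notation chart1 := (chart_at (1%g : P)).
Local Notation e0 := (chart1 1%g).
Local Notation Adm := (Adm i).
Let s1 : psrc chart1 1%g := chart_at_src (1%g : P).

Lemma Adm_lower_bound : exists2 C : R, 0 < C & exists2 r : R, 0 < r &
  forall h h', cball r h -> cball r h' -> `|chart1 h - chart1 h'| <= C * `|Adm h - Adm h'|.
Proof.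
have [C C0 hC] := immersion_lower_bound (Adm_chart_smooth i).1 (Adm_chart_immersion (i := i)).
exists C => //; have [r [hr r0]] := filter_ex (filterI hC (nbhs_right_gt 0)).
exists r => // h h' [hs hh] [hs' hh'].
by have := hr _ _ hh hh'; rewrite /Adm_chart !chartK.
Qed.

Lemma Adm_locally_injective : exists2 r : R, 0 < r &
  forall h h', cball r h -> cball r h' -> Adm h = Adm h' -> h = h'.
Proof.
have [C _ [r r0 hr]] := Adm_lower_bound; exists r; first exact: r0.
move=> h h' hh hh' e.
have := hr h h' hh hh'; rewrite e subrr normr0 mulr0 normr_le0 subr_eq0 => /eqP ee.
exact: cball_inj hh hh' ee.
Qed.

(** The curve gamma of the overview: straight in the chart at 1, with initial velocity b. *)
Definition line (b : 'rV[R]_k) (s : R) : P := pbwd chart1 (e0 + s *: b).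

Lemma line_chart b : \forall s \near (0 : R), psrc chart1 (line b s) /\ chart1 (line b s) = e0 + s *: b.
Proof.
have c : smooth_at (fun s : R => e0 + s *: b) (0 : R).
  by apply: smooth_atD; [apply: smooth_at_cst|apply: smooth_at_scale; [apply: smooth_at_id|apply: smooth_at_cst]].
have nt : \forall s \near (0 : R), ptgt chart1 (e0 + s *: b).
  by apply: (cvg_near (smooth_at_continuous c)); rewrite scale0r addr0; apply: near_chart_tgt.
by apply: filterS nt => s ts; rewrite /line chart_bwdK//; split=> //; apply: chart_bwd_src.
Qed.

Lemma line_tangent b Y : lieP i b = Y -> exp_tangent i Y (line b).
Proof.
move=> bY; have n1 := line_chart b.
have did : differentiable (@id 'rV[R]_k) (e0 + 0 *: b).
  by apply: smooth_at_differentiable; apply: smooth_at_id.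
have [D1 D2] := is_derive_line did.
have nE : \forall s \near (0 : R), id (e0 + s *: b) = chart1 (line b s).
  by apply: filterS n1 => s [_ ->].
have dl : differentiable (fun s : R => id (e0 + s *: b)) (0 : R).
  apply: smooth_at_differentiable.
  by apply: smooth_atD; [apply: smooth_at_cst|apply: smooth_at_scale; [apply: smooth_at_id|apply: smooth_at_cst]].
apply: (tangent_curve bY).
- by rewrite /line scale0r addr0 chartK.
- by apply: filterS n1 => s [].
- exact: near_eq_differentiable nE dl.
- by rewrite -(near_eq_derive (1 : R) nE); apply: etrans D2 _; apply: derive_id.
Qed.

Section Y.
Variables (Y : g) (b : 'rV[R]_k).
Hypothesis Y1 : Y \in gr 1.
Hypothesis bY : lieP i b = Y.
Local Notation expm := (expm Y).

(** The powers [line b (t / m)] ^ m are Cauchy in the chart: their images under Ad tend to exp(t ad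
    Y), and near 1 distances in the chart are bounded by those between images under Ad. The limit is
    the required element. *)
Lemma exp_small (rho : R) : 0 < rho -> exists2 r : R, 0 < r & forall t, `|t| < r ->
  exists2 h, cball rho h & Adm h = expm t.
Proof.
have third (x : R) : 0 < x -> x * (2 / 3) < x by move=> x0; lra.
move=> rho0; have [C C0 [r1 r10 hC]] := Adm_lower_bound.
have [sF _] := Adm_chart_smooth i.
have nc : \forall p \near e0, {for p, continuous (Adm_chart i)}.
  by apply: filterS (smooth_at_near sF) => p; apply: smooth_at_continuous.
have ntc : \forall p \near e0, ptgt chart1 p /\ {for p, continuous (Adm_chart i)}.
  by apply: filterS2 (near_chart_tgt s1) nc.
have [r2 r20 hr2] := near_norm ntc.
pose r := Num.min (Num.min r1 r2) rho.
have r0 : 0 < r by rewrite !lt_min r10 r20.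
have rr1 : r <= r1 by rewrite !ge_min lexx.
have rr2 : r <= r2 by rewrite !ge_min lexx orbT.
have rr : r <= rho by rewrite !ge_min lexx orbT.
have [q /andP[q0 qr] hq] := @cball_mul _ _ P _ r0.
(* An element of the ball of radius r whose Ad is within 2 e of 1 is then at chart distance at most
   q / 2 from 1. *)
pose e := q / (4 * C).
have ee0 : 0 < e by rewrite divr_gt0// mulr_gt0.
have Ce : C * (e + e) = q / 2 by rewrite /e; field; rewrite gt_eqF.
have [C1 C10 hC1] := expm_near1 Y.
pose t0 := Num.min 1 (e / C1).
have t00 : 0 < t0 by rewrite lt_min ltr01 divr_gt0.
have ht0 t : `|t| < t0 -> `|t| <= 1 /\ `|expm t - 1%:M| <= e.
  rewrite lt_min => /andP[/ltW t1 te]; split=> //; apply: le_trans (hC1 _ t1) _.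
  by rewrite mulrC -ler_pdivlMr// ltW.
have tl := line_tangent bY.
have [d1 d10 hd1] := tangent_power Y1 tl ee0.
have nq : \forall s \near (0 : R), cball q (line b s).
  have c : {for (0 : R), continuous (fun s : R => e0 + s *: b)}.
    apply: smooth_at_continuous.
    by apply: smooth_atD; [apply: smooth_at_cst|apply: smooth_at_scale; [apply: smooth_at_id|apply: smooth_at_cst]].
  have /cvgr_dist_lt/(_ _ q0) := c; rewrite scale0r addr0.
  by apply: filterS2 (line_chart b) => s [ps es] hs; split=> //; rewrite es.
have [d2 d20 hd2] := near_norm nq.
(* The powers cannot escape: one more factor leads at most into the ball of radius r, where the
   lower bound for Ad is valid and brings the power back within q / 2. *)
have key s j : `|s| < d1 -> `|s| < d2 -> `|s| * j%:R < t0 ->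
    cball q (line b s ^+ j)%g /\ `|e0 - chart1 (line b s ^+ j)%g| <= q / 2.
  move=> sd1 sd2; elim: j => [_|j IH sj].
    by rewrite expg0 subrr normr0; split; [apply: cball1|rewrite divr_ge0// ltW].
  have sj' : `|s| * j%:R < t0 by apply: le_lt_trans sj; rewrite ler_wpM2l// ler_nat.
  have [IH1 _] := IH sj'.
  have ls : cball q (line b s) by apply: hd2; rewrite sub0r normrN.
  have lr := hq _ _ ls IH1; rewrite -expgS in lr.
  have sj1 : `|s * j.+1%:R| < t0 by rewrite normrM [`|j.+1%:R|]ger0_norm.
  have [h1 h2] := ht0 _ sj1; rewrite normrM [`|j.+1%:R|]ger0_norm// in h1.
  have h3 := hd1 s j.+1 sd1 h1.
  have h4 := hC _ _ (cball1 r10) (cball_le rr1 lr); rewrite Adm1 in h4.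
  have h5 : `|e0 - chart1 (line b s ^+ j.+1)%g| <= q / 2.
    apply: le_trans h4 _; rewrite -Ce ler_pM2l//.
    have -> : 1%:M - Adm (line b s ^+ j.+1)%g =
        - (expm (s * j.+1%:R) - 1%:M) - (Adm (line b s ^+ j.+1)%g - expm (s * j.+1%:R)).
      by apply/matrixP => x y; rewrite !mxE; ring.
    by apply: le_trans (ler_normB _ _) _; rewrite normrN; apply: lerD.
  split=> //; split; first by case: lr.
  by apply: le_lt_trans h5 _; rewrite ltr_pdivrMr// mulr_natr mulr2n ltrDl.
exists t0 => // t tt0; have [t1 _] := ht0 t tt0.
pose u m := (line b (t / m.+1%:R) ^+ m.+1)%g.
have tm m : `|t / m.+1%:R| * m.+1%:R = `|t|.
  by rewrite normrM normfV [`|m.+1%:R|]ger0_norm// divfK// pnatr_eq0.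
have tsmall (e' : R) : 0 < e' -> \forall m \near \oo, `|t / m.+1%:R| < e'.
  move=> e'0; apply: filterS (near_infty_natSinv_lt (PosNum e'0)) => m /= hm.
  rewrite normrM normfV [`|m.+1%:R|]ger0_norm//; apply: le_lt_trans hm.
  by rewrite ler_piMl.
have nA (e' : R) : 0 < e' -> \forall m \near \oo, `|Adm (u m) - expm t| <= e'.
  move=> e'0; have [d3 d30 hd3] := tangent_power Y1 tl e'0.
  apply: filterS (tsmall _ d30) => m hm; have := hd3 (t / m.+1%:R) m.+1 hm.
  by rewrite tm divfK ?pnatr_eq0// => /(_ t1).
have nB : \forall m \near \oo, cball q (u m) /\ `|e0 - chart1 (u m)| <= q / 2.
  apply: filterS2 (tsmall _ d10) (tsmall _ d20) => m h1 h2.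
  by apply: key => //; rewrite tm.
pose v m := chart1 (u m).
have cv : cvg (v @ \oo).
  apply: cauchy_cvg; apply: cauchy_exP => e' e'0.
  pose e2 := e' / (3 * C); have e20 : 0 < e2 by rewrite divr_gt0// mulr_gt0.
  have nAB := filterI (nA _ e20) nB.
  case: nAB => M _ hM; exists (v M); exists M => // m /= Mm.
  have [a1 [a2 _]] := hM m Mm; have [b1 [b2 _]] := hM M (leqnn M).
  rewrite mx_norm_ball /ball_ /=.
  apply: le_lt_trans (hC _ _ (cball_le (le_trans qr rr1) b2) (cball_le (le_trans qr rr1) a2)) _.
  have -> : Adm (u M) - Adm (u m) = (Adm (u M) - expm t) - (Adm (u m) - expm t).
    by rewrite opprB addrA subrK.
  apply: le_lt_trans (_ : C * (e2 + e2) < _).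
    apply: ler_wpM2l; first exact: ltW.
    by apply: le_trans (ler_normB _ _) _; apply: lerD; [exact: b1|exact: a1].
  have -> : C * (e2 + e2) = e' * (2 / 3) by rewrite /e2; field; rewrite gt_eqF.
  exact: third.
set p := lim (v @ \oo) in cv; have vp : v @ \oo --> p by exact: cv.
have q4 : 0 < q / 4 by rewrite divr_gt0.
have pq : `|e0 - p| < q.
  have /cvgr_dist_lt/(_ _ q4) nv := vp.
  have [m [[_ h1] h2]] := filter_ex (filterI nB nv).
  have -> : e0 - p = (e0 - v m) - (p - v m) by rewrite opprB addrA subrK.
  by apply: le_lt_trans (ler_normB _ _) _; rewrite /v in h2 *; lra.
have [tp cp] := hr2 p (lt_le_trans pq (le_trans qr rr2)).
exists (pbwd chart1 p).
  split; first exact: chart_bwd_src.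
  by rewrite chart_bwdK//; apply: lt_le_trans pq (le_trans qr rr).
apply: small_norm_eq => e' e'0.
have e'2 : 0 < e' / 2 by rewrite divr_gt0.
have nC : \forall m \near \oo, `|Adm_chart i p - Adm_chart i (v m)| < e' / 2.
  by have /cvgr_dist_lt/(_ _ e'2) nap := cp; exact: vp _ nap.
have [m [[h1 h2] [h3 _]]] := filter_ex (filterI (filterI nC (nA _ e'2)) nB).
have -> : Adm (pbwd chart1 p) - expm t =
    (Adm_chart i p - Adm_chart i (v m)) + (Adm (u m) - expm t).
  by rewrite /v /Adm_chart (chartK h3.1) addrA subrK.
by apply: le_trans (ler_normD _ _) _; have := ltW h1; lra.
Qed.

End Y.
End ExpExistence.

Section OneParameter.
Context {R : realType}.

Lemma is_diff_line (V : normedModType R) (x : R -> V) (b : V) :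
  (forall e : R, 0 < e -> \forall s \near (0 : R), `|x s - (x 0 + s *: b)| <= e * `|s|) ->
  differentiable x (0 : R) /\ forall v : R, dif x (0 : R) v = v *: b.
Proof.
move=> h; pose f (s : R) := s *: b.
have lf : linear f by move=> a s t; rewrite /f scalerDl scalerA.
pose l : {linear R -> V} := HB.pack f (GRing.isLinear.Build R R V *:%R f lf).
have cl : continuous l by apply: findim_linear_continuous; apply: findim_R.
have [|d1 d2] := @is_diff_eps R R V x 0 l cl.
  move=> e e0; apply: filterS (h e e0) => s.
  by rewrite addr0 opprD addrA.
by split=> // v; rewrite difE; apply: (congr1 (fun k => k v) d2).
Qed.

(** Bootstrapping in x' = F(x): if x is C^j, then so is F o x, and x is C^(j+1). *)
Lemma autonomous_smooth k (F : 'rV[R]_k -> 'rV[R]_k) (x : R -> 'rV[R]_k) (r : R)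
    (U : set 'rV[R]_k) : 0 < r -> open U -> (forall j, Ck j U F) ->
  (forall t, `|t| < r -> [/\ U (x t), differentiable x t & forall v : R, 'D_v x t = v *: F (x t)]) ->
  smooth_at x (0 : R).
Proof.
move=> r0 oU CF h; pose I : set R := ball (0 : R) r.
have oI : open I by apply: ball_open.
have hI t : I t -> `|t| < r by rewrite /I /ball /= sub0r normrN.
exists I; first by split=> //; apply: ballxx.
elim=> [t /hI/h[_ d _]|j IH]; first exact: differentiable_continuous.
split=> [t /hI/h[]//|v].
apply: (@Ck_ext _ _ _ _ _ (fun t => v *: F (x t))) => // [t /hI/h[_ _ ->]//|].
apply: Ck_scale => //; first exact: Ck_cst.
apply: (Ck_comp (findim_rV k) oI oU _ IH (CF j)) => t /hI/h[].
by [].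
Qed.

End OneParameter.

Section ExpExists.
Context {R : realType} {n k : nat} {G : lieGroupType R n}.
Context {g : lieAlgType R} {L : lie_algebra_of G g} {gr : onegrading g}.
Context {P : lieGroupType R k} (i : parabolic_subgroup L gr P).
Local Notation chart1 := (chart_at (1%g : P)).
Local Notation e0 := (chart1 1%g).
Local Notation Adm := (Adm i).
Let s1 : psrc chart1 1%g := chart_at_src (1%g : P).

(** c(s) = c(t) c(s - t), so left translation carries smoothness at 0 to t. *)
Lemma csmooth_one_parameter (c : R -> P) : (forall s t, c (s + t) = (c s * c t)%g) ->
  (\forall t \near (0 : R), psrc chart1 (c t)) -> smooth_at (fun t => chart1 (c t)) (0 : R) ->
  forall t, csmooth_at c t.
Proof.
move=> cD nc; set x := fun t : R => _ => sx t.
have c0 : c 0 = 1%g by have := cD 0 0; rewrite addr0 -[LHS]mulg1 => /mulgI.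
have x0 : x 0 = e0 by rewrite /x c0.
pose f s := s - t; have f0 : f t = 0 by rewrite /f subrr.
have sf : smooth_at f t by apply: smooth_atB; [apply: smooth_at_id|apply: smooth_at_cst].
have sxf : smooth_at (x \o f) t by apply: smooth_at_comp => //; [exact: findim_R|rewrite f0].
have cxf : (x \o f) @ t --> e0.
  have xf0 : (x \o f) t = e0 by rewrite /= f0.
  suff : (x \o f) @ t --> (x \o f) t by rewrite xf0.
  exact: smooth_at_continuous sxf.
have nE : \forall s \near t, psrc chart1 (c (f s)).
  have nc' : \forall s \near f t, psrc chart1 (c s) by rewrite f0.
  exact: (cvg_near (smooth_at_continuous sf) nc').
have cE s : c s = (c t * c (f s))%g by rewrite -cD /f addrC subrK.
split.
  have [cm _] := msmooth_mull (c t) 1%g.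
  have cb : (pbwd chart1 \o (x \o f)) @ t --> (1%g : P).
    by apply: (@cvg_comp _ _ _ (x \o f) (pbwd chart1) _ _ _ cxf); apply: chart_bwd_continuous.
  have cc : ((fun y => (c t * y)%g) \o (pbwd chart1 \o (x \o f))) @ t --> (c t * 1)%g.
    by apply: (@cvg_comp _ _ _ (pbwd chart1 \o (x \o f)) (fun y => (c t * y)%g) _ _ _ cb); apply: cm.
  rewrite mulg1 in cc.
  have nE2 : \forall s \near t, ((fun y => (c t * y)%g) \o (pbwd chart1 \o (x \o f))) s = c s.
    by apply: filterS nE => s hs; rewrite [RHS]cE /= /x chartK.
  by apply: cvg_trans cc; apply: near_eq_cvg.
have ct1 : psrc (chart_at (c t)) (c t * 1)%g by rewrite mulg1; apply: chart_at_src.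
have [sr _] := msmooth_rep (msmooth_mull (c t) 1%g) s1 ct1.
have srx : smooth_at (rep (1%g : P) (c t) (fun y => (c t * y)%g) \o (x \o f)) t.
  by apply: smooth_at_comp => //; [exact: findim_rV|rewrite /= f0 x0].
apply: smooth_at_near_eq srx; apply: filterS nE => s hs.
by rewrite -[RHS]/(chart_at (c t) (c s)) [in RHS](cE s) /rep /= /x chartK.
Qed.

Lemma line_cball r b : 0 < r ->
  \forall s \near (0 : R), cball r (line (P := P) b s) /\ chart1 (line b s) = e0 + s *: b.
Proof.
move=> r0; have cl : {for (0 : R), continuous (fun s : R => e0 + s *: b)}.
  apply: smooth_at_continuous.
  by apply: smooth_atD; [apply: smooth_at_cst|apply: smooth_at_scale; [apply: smooth_at_id|apply: smooth_at_cst]].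
have /cvgr_dist_lt/(_ _ r0) := cl; rewrite scale0r addr0.
by apply: filterS2 (line_chart (P := P) b) => s [ps es] hs; split=> //; split=> //; rewrite es.
Qed.

(** Near 1 the elements with Ad equal to exp(t ad Y) are unique, so they form a local homomorphism,
    which extends to all times. It is differentiable at 0 by comparison with [line], hence an
    integral curve of a left-invariant field, hence smooth. *)
Lemma exp_exists Y : Y \in gr 1 -> exists c : R -> P,
  [/\ forall s t, c (s + t) = (c s * c t)%g, forall t, csmooth_at c t & lieP i (velocity c 0) = Y].
Proof.
move=> Y1; have [b bY] := lieP_surj i (mem_filt0_g1 Y1).
have [C C0 [r1 r10 hC]] := Adm_lower_bound i.
have fk := findim_rV (R := R) k.
have smm := mul_chart_smooth s1.
(* The left-invariant field of b, in the chart at 1. *)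
pose F p := dif (mul_chart (1%g : P)) (p, e0) (0, b).
have sF : smooth_at F e0 by have [] := smooth_at_slice1 fk fk (smooth_at_dif (0, b) smm).
case: sF => U [oU Ue] CF.
have sp : smooth_at (fun p : 'rV[R]_k => (p, e0)) e0.
  by apply: smooth_at_pair; [apply: smooth_at_id|apply: smooth_at_cst].
have nU : \forall p \near e0, U p /\ smooth_at (mul_chart (1%g : P)) (p, e0).
  apply: filterS2 (open_nbhs_nbhs (conj oU Ue)) (cvg_near (smooth_at_continuous sp) (smooth_at_near smm)).
  by [].
have [r2 r20 hr2] := near_norm nU.
pose r := Num.min r1 r2; have r0 : 0 < r by rewrite lt_min r10 r20.
have rr1 : r <= r1 by rewrite ge_min lexx.
have rr2 : r <= r2 by rewrite ge_min lexx orbT.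
have [q /andP[q0 qr] hq] := @cball_mul _ _ P _ r0.
have [r3 r30 h3] := exp_small Y1 bY q0.
have inj h h' : cball r h -> cball r h' -> Adm h = Adm h' -> h = h'.
  move=> hh hh' e; have := hC _ _ (cball_le rr1 hh) (cball_le rr1 hh').
  rewrite e subrr normr0 mulr0 normr_le0 subr_eq0 => /eqP; exact: cball_inj hh hh'.
(* Outside |t| < r3 the value 1 is a default. *)
have [c0 hc0] : exists c0 : R -> P, forall t, `|t| < r3 -> cball q (c0 t) /\ Adm (c0 t) = expm Y t.
  have ex t : exists h : P, `|t| < r3 -> cball q h /\ Adm h = expm Y t.
    have [tr|tr] := pselect (`|t| < r3); last by exists 1%g.
    by have [h h1 h2] := h3 t tr; exists h.
  by have [c0 hc0] := choice ex; exists c0.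
have [|c [cD cE]] := local_hom_extension (c0 := c0) r30.
  move=> s t sr tr str; have [a1 a2] := hc0 _ sr; have [b1 b2] := hc0 _ tr.
  have [d1 d2] := hc0 _ str; apply: inj; [exact: cball_le d1|exact: hq|].
  by rewrite AdmM a2 b2 d2 -(expmD Y1) addrC.
have hc t : `|t| < r3 -> cball q (c t) /\ Adm (c t) = expm Y t.
  by move=> tr; rewrite cE//; apply: hc0.
have c01 : c 0 = 1%g by have := cD 0 0; rewrite addr0 -[LHS]mulg1 => /mulgI.
have n3 : \forall t \near (0 : R), `|t| < r3.
  by apply: filterS (nbhsx_ballx (0 : R) r3 r30) => t; rewrite /ball /= sub0r normrN.
pose x t := chart1 (c t).
have x0 : x 0 = e0 by rewrite /x c01.
have [dx0 Dx0] : differentiable x (0 : R) /\ forall v : R, dif x (0 : R) v = v *: b.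
  apply: is_diff_line => e ep; rewrite x0.
  have eC : 0 < e / C by rewrite divr_gt0.
  have [d d0 hd] := line_tangent bY eC.
  have nd : \forall s \near (0 : R), `|s| < d.
    by apply: filterS (nbhsx_ballx (0 : R) d d0) => t; rewrite /ball /= sub0r normrN.
  have nl : \forall s \near (0 : R), cball r (line (P := P) b s) /\ chart1 (line (P := P) b s) = e0 + s *: b.
    exact: line_cball.
  apply: filterS3 n3 nd nl => s s3 sd [hl el].
  have [a1 a2] := hc s s3.
  have := hC _ _ (cball_le (le_trans qr rr1) a1) (cball_le rr1 hl).
  rewrite el a2 => h; apply: le_trans h _.
  have := hd s sd; rewrite distrC => h; rewrite mulrC -ler_pdivlMr//.
  by apply: le_trans h _; rewrite mulrAC.
(* The chart expression of c(s) = c(t) c(s - t) is differentiated at s = t, which only involves the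
   derivative of the curve at 0. *)
have sol t : `|t| < r3 -> [/\ U (x t), differentiable x t & forall v : R, 'D_v x t = v *: F (x t)].
  move=> tr; have [ht _] := hc t tr.
  have [Ut smt] := hr2 (x t) (lt_le_trans ht.2 (le_trans qr rr2)).
  pose f s := s - t; have f0 : f t = 0 by rewrite /f subrr.
  have did : differentiable (@id R) t by apply: smooth_at_differentiable; apply: smooth_at_id.
  have dct : differentiable (fun _ : R => t) t by apply: smooth_at_differentiable; apply: smooth_at_cst.
  have df : differentiable f t by exact: differentiableB.
  have Df v : dif f t v = v by apply: etrans (difB v did dct) _; rewrite dif_id dif_cst subr0.
  have [sm2 dm2] := smooth_at_slice2 fk fk smt.
  pose w := x \o f.
  have wt : w t = e0 by rewrite /w /= f0.
  have dwt v := dif_comp_at v f0 df dx0.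
  have dw : differentiable w t := (dwt 0).1.
  have dmw v := dif_comp_at v wt dw (smooth_at_differentiable sm2).
  have nE : \forall s \near t, ((fun q => mul_chart (1%g : P) (x t, q)) \o w) s = x s.
    have nf : \forall s \near t, `|f s| < r3.
      have nf0 : \forall y \near f t, `|y| < r3 by rewrite f0.
      exact: (cvg_near (differentiable_continuous df) nf0).
    apply: filterS nf => s fs; have [hs _] := hc _ fs.
    by rewrite /mul_chart /w /x /= (chartK ht.1) (chartK hs.1) -cD /f addrC subrK.
  have dm := (dmw 0).1.
  split=> //; first exact: near_eq_differentiable nE dm.
  move=> v; rewrite -(near_eq_derive v nE) -(dif_derive v dm) (dmw v).2 dm2 (dwt v).2 Df Dx0.
  rewrite /F -dif_scale; congr dif.
  by rewrite -[RHS]/(v *: (0 : 'rV[R]_k), v *: b) scaler0.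
have sx := autonomous_smooth r30 oU CF sol.
exists c; split=> //.
  by apply: csmooth_one_parameter => //; apply: filterS n3 => t tr; have [[]] := hc t tr.
rewrite /velocity derive1E c01 -bY; congr lieP.
by apply: etrans (esym (dif_derive (1 : R) dx0)) _; rewrite Dx0 scale1r.
Qed.

End ExpExists.

(** * The group exp(g_1) *)

Section ExpGroup.
Context {R : realType} {n k : nat} {G : lieGroupType R n}.
Context {g : lieAlgType R} {L : lie_algebra_of G g} {gr : onegrading g}.
Context {P : lieGroupType R k} (i : parabolic_subgroup L gr P).
Local Notation Adm := (Adm i).

Lemma expP_AdP Y y x : Y \in gr 1 -> expP i Y y -> AdP i y x = exp_ad Y x.
Proof.
move=> Y1 [c [cD cs cY <-]].
have := exp_curve_Adm Y1 cD cs cY (t := 1); rewrite normr1 => /(_ (lexx 1)).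
rewrite /expm scale1r => e; apply: (mxl_inj _ _ e); [exact: AdP_linear|exact: exp_ad_linear].
Qed.

Lemma expP_roots Y y : Y \in gr 1 -> expP i Y y -> exists q : nat -> P,
  [/\ forall r : R, 0 < r -> \forall m \near \oo, cball r (q m),
      forall m, Adm (q m) = expm Y m.+1%:R^-1 & forall m, (q m ^+ m.+1)%g = y].
Proof.
move=> Y1 [c [cD cs cY <-]]; have [c0 cX] := one_parameterX cD.
exists (fun m => c m.+1%:R^-1); split=> [r r0|m|m].
- have [cc _] := cs 0.
  have nr : \forall h \near c 0, cball r h by rewrite c0; apply: near_cball.
  have [d d0 hd] := near_norm (cvg_near cc nr).
  apply: filterS (near_infty_natSinv_lt (PosNum d0)) => m /= hm; apply: hd.
  by rewrite sub0r normrN ger0_norm.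
- by apply: (exp_curve_Adm Y1 cD cs cY); rewrite ger0_norm// invf_le1// ler1n.
- by rewrite -cX mulVf// pnatr_eq0.
Qed.

(** For large m the given q_m and exp(Y / (m + 1)) are both near 1 and have the same Ad, so they
    coincide, and so do their powers. *)
Lemma expP_of_roots Y (q : nat -> P) : Y \in gr 1 ->
  (forall r : R, 0 < r -> \forall m \near \oo, cball r (q m)) ->
  (forall m, Adm (q m) = expm Y m.+1%:R^-1) ->
  \forall m \near \oo, expP i Y (q m ^+ m.+1)%g.
Proof.
move=> Y1 nq Aq; have [c [cD cs cY]] := exp_exists i Y1.
have eY : expP i Y (c 1) by exists c.
have [q' [nq' Aq' Xq']] := expP_roots Y1 eY.
have [r r0 inj] := Adm_locally_injective i.
apply: filterS2 (nq _ r0) (nq' _ r0) => m hm hm'.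
have -> : q m = q' m := inj _ _ hm hm' (etrans (Aq m) (esym (Aq' m))).
by rewrite Xq'.
Qed.

Lemma expP0 : expP i 0 1%g.
Proof.
have h := @expP_of_roots 0 (fun=> 1%g) (mem0v _).
have [|m|m] := filter_ex (h _ _).
- by move=> r r0; apply: nearW => m; apply: cball1.
- by rewrite Adm1 -mxl_id; apply: eq_mxl => x; rewrite scaler0 exp_ad0.
- by rewrite expg1n.
Qed.

(** For large m the roots q of y and q' of z commute, since q q' and q' q are near 1 with the same
    Ad. Hence the power of q q' is y z, and Ad of q q' is that of a root of exp(Y + Z). *)
Lemma expPM Y Z y z : Y \in gr 1 -> Z \in gr 1 -> expP i Y y -> expP i Z z ->
  expP i (Y + Z) (y * z)%g.
Proof.
move=> Y1 Z1 eY eZ; have YZ1 : Y + Z \in gr 1 by rewrite memvD.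
have [q [nq Aq Xq]] := expP_roots Y1 eY; have [q' [nq' Aq' Xq']] := expP_roots Z1 eZ.
have [r r0 inj] := Adm_locally_injective i.
have nm (c d : nat -> P) : (forall r : R, 0 < r -> \forall m \near \oo, cball r (c m)) ->
    (forall r : R, 0 < r -> \forall m \near \oo, cball r (d m)) ->
    forall r : R, 0 < r -> \forall m \near \oo, cball r (c m * d m)%g.
  move=> nc nd r' r'0; have [s /andP[s0 _] hs] := @cball_mul _ _ P _ r'0.
  by apply: filterS2 (nc _ s0) (nd _ s0) => m; apply: hs.
have eM A B s x : A \in gr 1 -> B \in gr 1 -> exp_ad (s *: A) (exp_ad (s *: B) x) = exp_ad (s *: (A + B)) x.
  by move=> A1 B1; rewrite (exp_ad_add (gr := gr)) ?memvZ// scalerDr.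
have Am m : Adm (q m * q' m)%g = expm (Y + Z) m.+1%:R^-1.
  rewrite AdmM Aq Aq' /expm -mxl_comp; [|exact: exp_ad_linear|exact: exp_ad_linear].
  by apply: eq_mxl => x; rewrite /= eM.
have Am' m : Adm (q' m * q m)%g = expm (Y + Z) m.+1%:R^-1.
  rewrite AdmM Aq Aq' /expm -mxl_comp; [|exact: exp_ad_linear|exact: exp_ad_linear].
  by apply: eq_mxl => x; rewrite /= eM// addrC.
have ne := expP_of_roots YZ1 (nm _ _ nq nq') Am.
have nc : \forall m \near \oo, commute (q m) (q' m).
  apply: filterS2 (nm _ _ nq nq' _ r0) (nm _ _ nq' nq _ r0) => m h h'.
  exact: (inj _ _ h h' (etrans (Am m) (esym (Am' m)))).
have [m [e com]] := filter_ex (filterI ne nc).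
by move: e; rewrite expgMn// Xq Xq'.
Qed.

Lemma expPV Y y : Y \in gr 1 -> expP i Y y -> expP i (- Y) y^-1%g.
Proof.
move=> Y1 eY; have NY1 : - Y \in gr 1 by rewrite memvN.
have [q [nq Aq Xq]] := expP_roots Y1 eY.
have nqV r : 0 < r -> \forall m \near \oo, cball r (q m)^-1%g.
  move=> r0; have [ci _] := @inv_smooth _ _ P 1%g.
  have n1 : \forall h \near (1%g : P)^-1%g, cball r h by rewrite invg1; apply: near_cball.
  have [d d0 hd] := nbhs_cball (cvg_near ci n1).
  by apply: filterS (nq _ d0) => m /hd.
have AV m : Adm (q m)^-1%g = expm (- Y) m.+1%:R^-1.
  have e1 : Adm (q m)^-1%g *m Adm (q m) = 1%:M by rewrite -AdmM mulgV Adm1.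
  have -> : expm (- Y) m.+1%:R^-1 = expm Y (- m.+1%:R^-1) by rewrite /expm scalerN scaleNr.
  by rewrite -[LHS]mulmx1 -(expm0 Y) -(subrr m.+1%:R^-1) (expmD Y1) -Aq mulmxA e1 mul1mx.
have [m] := filter_ex (expP_of_roots NY1 nqV AV).
by rewrite expVgn Xq.
Qed.

End ExpGroup.

(** * Weyl structures and symmetries *)

Section Orbits.
Context {R : realType} {n k m N : nat} {G : lieGroupType R n}.
Context {g : lieAlgType R} {L : lie_algebra_of G g} {gr : onegrading g}.
Context {P : lieGroupType R k} {i : parabolic_subgroup L gr P}.
Context {M : manifoldType R m} {E : manifoldType R N}.
Variable geo : parabolic_geometry i M E.
Local Notation "u ** h" := (bact geo u h) (at level 40, left associativity).
Local Notation p := (bproj geo).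

Lemma pi0_exp u Y y : Y \in gr 1 -> expP i Y y -> pi0 geo (u ** y) = pi0 geo u.
Proof.
move=> Y1 eY; apply: eq_exist; rewrite /orbit1; apply/seteqP; split=> w [Z [z [Z1 eZ ->]]].
  by exists (Y + Z), (y * z)%g; rewrite memvD// bactM; split=> //; apply: expPM.
exists (- Y + Z), (y^-1 * z)%g; split; first by rewrite memvD// memvN.
  by apply: expPM => //; [rewrite memvN|apply: expPV].
by rewrite -bactM mulgA mulgV mul1g.
Qed.

Lemma pi0_bproj u w : pi0 geo u = pi0 geo w -> p u = p w.
Proof.
move=> /(congr1 sval) /= e; have : orbit1 geo u u.
  by exists 0, 1%g; rewrite mem0v bact1; split=> //; apply: expP0.
by rewrite e => -[Z [h [_ _ ->]]]; rewrite bproj_bact.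
Qed.

Lemma weyl_bproj sigma u : weyl_structure sigma -> p (sigma (pi0 geo u)) = p u.
Proof. by case=> sK _ _; apply: pi0_bproj; rewrite sK. Qed.

End Orbits.

(** * Automorphisms covering a symmetry *)

Section Symmetries.
Context {R : realType} {n k m N : nat} {G : lieGroupType R n}.
Context {g : lieAlgType R} {L : lie_algebra_of G g} {gr : onegrading g}.
Context {P : lieGroupType R k} {i : parabolic_subgroup L gr P}.
Context {M : manifoldType R m} {E : manifoldType R N}.
Variable geo : parabolic_geometry i M E.
Local Notation "u ** h" := (bact geo u h) (at level 40, left associativity).
Local Notation p := (bproj geo).

Variables (x : M) (s : partial_map M M) (phi : partial_map E E) (u : E).
Hypothesis sym_s : symmetry geo x s.
Hypothesis cov : covers_at geo x phi s.
Hypothesis pu : p u = x.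

Lemma cover_fibre : exists h, phi u = u ** h.
Proof.
have [_ ns] := cov; apply: bact_trans.
by rewrite (nbhs_singleton ns)// pu (sym_fix sym_s).
Qed.

Lemma cover_bwd w : p w = x -> phi (pbwd phi w) = w.
Proof.
move=> pw; have [[U [V [Ux la]]] ns] := cov.
have [[ht _ _ hK] _ _ _ _] := laut_diffeo la.
apply: hK; rewrite (laut_tgt la) /=.
have := ht u; rewrite (laut_src la) (laut_tgt la) /= pu => /(_ Ux).
by rewrite (nbhs_singleton ns)// (sym_fix sym_s) pw.
Qed.

Lemma cover_src : psrc phi u.
Proof. by have [[U [V [Ux la]]] _] := cov; rewrite (laut_src la) /= pu. Qed.

Lemma cover_equivariant e : phi (u ** e) = phi u ** e.
Proof. by have [[U [V [Ux la]]] _] := cov; rewrite (laut_equivariant la)// pu. Qed.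

Variable h : P.
Hypothesis phi_u : phi u = u ** h.
Let Phi w := phi w ** h^-1%g.

Lemma cover_fix : Phi u = u.
Proof. by rewrite /Phi phi_u bactK. Qed.

Lemma cover_smooth_omega : (\forall w \near u, msmooth_at Phi w) /\
  \forall w \near u, forall v, omega geo (Phi w) (tmap Phi w v) = AdP i h (omega geo w v).
Proof.
have [[U [V [Ux la]]] _] := cov.
have [_ _ _ sphi _] := laut_diffeo la.
have [cp _] := bproj_smooth geo u.
have nU : \forall w \near u, U (p w).
  by apply: (cvg_near cp); rewrite pu; apply: open_nbhs_nbhs; split=> //; apply: laut_openl la.
have cm w : U (p w) -> msmooth_at Phi w /\
    forall v, tmap Phi w v = tmap (fun w => w ** h^-1%g) (phi w) (tmap phi w v).
  move=> Uw; apply: (msmooth_comp (f := phi) (h := fun w => w ** h^-1%g)).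
    by apply: sphi; rewrite (laut_src la).
  exact: msmooth_bact.
split; apply: filterS nU => w Uw; first exact: (cm w Uw).1.
move=> v; rewrite (cm w Uw).2 /Phi omega_bact invgK -tmapE.
by rewrite (laut_omega la).
Qed.

(** Near u the projection satisfies s o p = p o Phi; differentiate at u and use that the derivative
    of s at x is - id. *)
Lemma cover_bproj v : tmap p u (tmap Phi u v) = - tmap p u v.
Proof.
have [sPhi _] := cover_smooth_omega; have [_ ns] := cov.
have sPu := nbhs_singleton sPhi.
have sp := bproj_smooth geo.
have [_ d1] := msmooth_comp sPu (sp (Phi u)).
have [_ _ _ ss _] := sym_diffeo sym_s.
have sps : msmooth_at s (p u) by rewrite pu; apply: ss; apply: sym_src sym_s.
have [sc d2] := msmooth_comp (sp u) sps.
have [cp _] := sp u.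
have nE : \forall w \near u, (s \o p) w = (p \o Phi) w.
  have np : \forall y \near p u, forall w, p w = y -> p (phi w) = s y by rewrite pu.
  apply: filterS (cvg_near cp np) => w e.
  by rewrite /= /Phi bproj_bact e.
have [_ d3] := msmooth_near_eq nE sc.
have d1v := d1 v; rewrite cover_fix in d1v.
apply: etrans (esym d1v) _; apply: etrans (d3 v) _; apply: etrans (d2 v) _.
by rewrite pu -(tmapE s) (sym_diff sym_s).
Qed.

End Symmetries.

(** * Comparison of the two symmetries *)

Section Final.
Context {R : realType} {n k m N : nat} {G : lieGroupType R n}.
Context {g : lieAlgType R} {L : lie_algebra_of G g} {gr : onegrading g}.
Context {P : lieGroupType R k} {i : parabolic_subgroup L gr P}.
Context {M : manifoldType R m} {E : manifoldType R N}.
Variable geo : parabolic_geometry i M E.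
Local Notation "u ** h" := (bact geo u h) (at level 40, left associativity).
Local Notation p := (bproj geo).
Local Notation pi := (gr_comp gr).
Local Notation kappa := (curvature geo).

Lemma assoc_inj u Z Z' : assoc geo u Z = assoc geo u Z' -> Z = Z'.
Proof.
move=> e; have : assoc geo u Z (u, Z) by exists 1%g; rewrite bact1 invg1 AdP1.
rewrite e => -[h [uh ->]].
have -> : h = 1%g by apply: (bact_inj (B := geo) (u := u)); rewrite bact1.
by rewrite invg1 AdP1.
Qed.

Lemma AdPV_gm1 h : (forall X, X \in gr (-1) -> pi (-1) (AdP i h X) = - 1 *: X) ->
  forall y, pi (-1) (AdP i h^-1%g y) = - pi (-1) y.
Proof.
move=> hm y; have hz z : pi (-1) (AdP i h z) = - pi (-1) z.
  by rewrite AdP_gm1 hm ?gr_comp_mem// scaleN1r.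
by rewrite -[in RHS](AdPKV i h y) hz opprK.
Qed.

Section Difference.
Variables (x : M) (s s' : partial_map M M) (phi psi : partial_map E E).
Variables (sigma : bundle0 geo -> E) (Upsilon : bundle0 geo -> g) (u : E).
Hypothesis sym_s : symmetry geo x s.
Hypothesis sym_s' : symmetry geo x s'.
Hypothesis cov : covers_at geo x phi s.
Hypothesis cov' : covers_at geo x psi s'.
Hypothesis weyl : weyl_structure sigma.
Hypothesis phi_sigma : forall w, p w = x -> weyl_pullback phi sigma w = sigma (pi0 geo w).
Hypothesis psi_sigma : forall w, psrc psi w ->
  weyl_shift sigma Upsilon (pi0 geo w) (weyl_pullback psi sigma w).
Hypothesis pu : p u = x.
Hypothesis su : sigma (pi0 geo u) = u.

Variables (h h' : P).
Hypothesis phi_u : phi u = u ** h.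
Hypothesis psi_u : psi u = u ** h'.

Let fix_h X : X \in gr (-1) -> pi (-1) (AdP i h X) = - 1 *: X.
Proof.
exact: (fixed_AdP_gm (cover_fix phi_u) (cover_smooth_omega cov pu h).2 (cover_bproj sym_s cov pu phi_u)).
Qed.

Let fix_h' X : X \in gr (-1) -> pi (-1) (AdP i h' X) = - 1 *: X.
Proof.
exact: (fixed_AdP_gm (cover_fix psi_u) (cover_smooth_omega cov' pu h').2 (cover_bproj sym_s' cov' pu psi_u)).
Qed.

(* Since sigma is equivariant under the Levi subgroup only, h^-1 h' is determined
   by sigma up to that subgroup, and its exponential part must be exp(- Upsilon). *)
Lemma difference_Ad : Upsilon (pi0 geo u) \in gr 1 /\
  forall y, AdP i h' y = AdP i h (exp_ad (- Upsilon (pi0 geo u)) y).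
Proof.
(* The invariance of sigma under phi says that phi(u) = u h lies in the image of sigma. *)
have e1 : sigma (pi0 geo (u ** h)) = u ** h.
  have := phi_sigma pu; rewrite su /weyl_pullback phi_u => e.
  have := cover_bwd sym_s cov pu (w := sigma (pi0 geo (u ** h))).
  by rewrite (weyl_bproj _ weyl) bproj_bact pu e phi_u => /(_ erefl).
have [Z1 [e eZ]] := psi_sigma (cover_src cov' pu).
rewrite su /weyl_pullback psi_u => e2.
have e3 : sigma (pi0 geo (u ** h')) = u ** h' ** e.
  have := cover_bwd sym_s' cov' pu (w := sigma (pi0 geo (u ** h'))).
  by rewrite (weyl_bproj _ weyl) bproj_bact pu e2 (cover_equivariant cov' pu) psi_u => /(_ erefl).
split=> //; move: (Upsilon _) Z1 eZ => Z Z1 eZ.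
pose b := (h^-1 * h')%g.
have hb : (h * b)%g = h' by rewrite /b mulgA mulgV mul1g.
have bm X : X \in gr (-1) -> pi (-1) (AdP i b X) = X.
  move=> Xm; have eN y := AdPV_gm1 fix_h y.
  by rewrite AdPM eN fix_h'// scaleN1r opprK.
have [Y Y1 bY] := filtered_aut_exp_ad (AdP_lie i b) (fun y => @AdP_filt _ _ _ _ _ _ _ _ i b 0 y)
  (@AdP_g1 _ _ _ _ _ _ _ _ i b) bm.
have [c [cD cs cY]] := exp_exists i Y1.
have eY : expP i Y (c 1) by exists c.
(* Ad_l is the identity, so l belongs to the Levi subgroup, although it need not be 1. *)
set y := c 1 in eY; pose l := (b * y^-1)%g.
have lb : (l * y)%g = b by rewrite /l -mulgA mulVg mulg1.
have lid z : AdP i l z = z by rewrite /l AdPM bY -(expP_AdP _ Y1 eY) AdPKV.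
have ll : levi i l by move=> j z zj; rewrite lid.
(* h' = h l y, and the factor y in exp(g_1) disappears in G_0. *)
have e4 : sigma (pi0 geo (u ** h')) = u ** h ** l.
  rewrite -hb bactM -lb bactM (pi0_exp _ _ Y1 eY) (weyl_equivariant weyl)//.
  by rewrite e1.
(* The same point is u h' e and u h l; as h' = h l y and the action is free, y e = 1, that is exp(Y)
   exp(Upsilon) = 1. *)
have e5 : (y * e)%g = 1%g.
  have aux (a1 a2 a3 a4 : P) : (a1 * (a2 * a3) * a4 = a1 * a2 -> a3 * a4 = 1)%g.
    by move=> q; apply: (mulgI (a1 * a2)%g); rewrite mulg1 -[RHS]q !mulgA.
  apply: (aux h l); rewrite lb hb; apply: (bact_inj (B := geo) (u := u)).
  by rewrite (bactM geo u h' e) (bactM geo u h l) -e3 -e4.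
have YZ : Y = - Z.
  apply/eqP; rewrite -subr_eq0 opprK; apply/eqP.
  apply: (exp_ad_inj (gr := gr)); [exact: memvD|exact: mem0v|].
  move=> z; rewrite -(exp_ad_add (gr := gr))// exp_ad0.
  by rewrite -(expP_AdP _ Z1 eZ) -(expP_AdP _ Y1 eY) -AdPM e5 AdP1.
by move=> z; rewrite -YZ -bY -AdPM hb.
Qed.

Hypothesis tf : torsion_free geo.

Lemma delta_difference X Y V : X \in gr (-1) -> Y \in gr (-1) -> V \in gr (-1) ->
  delta geo u X Y (lie (Upsilon (pi0 geo u)) V) = 0.
Proof.
move=> Xm Ym Vm; have [Z1 hh'] := difference_Ad; move: (Upsilon _) Z1 hh' => Z Z1 hh'.
have [sP oP] := cover_smooth_omega cov pu h; have [sP' oP'] := cover_smooth_omega cov' pu h'.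
have d := delta_double tf (cover_fix phi_u) sP oP (cover_bproj sym_s cov pu phi_u) Xm Ym Vm.
have d' := delta_double tf (cover_fix psi_u) sP' oP' (cover_bproj sym_s' cov' pu psi_u) Xm Ym Vm.
have F0 := fixed_AdP_filt0 (cover_fix phi_u) oP (cover_bproj sym_s cov pu phi_u).
have dD a b : delta geo u X Y (a + b) = delta geo u X Y a + delta geo u X Y b.
  by have := delta_linear geo u X Y 1 a b; rewrite !scale1r.
have Zm : lie Z V \in gr 0 by apply: lie_1m.
have e : pi 0 (AdP i h V) = pi 0 (AdP i h' V) + lie Z V.
  rewrite hh' /exp_ad !lieNl lieNr opprK !(raddfD (AdP i h)) (raddfN (AdP i h)).
  rewrite !(raddfD (pi 0)) (raddfN (pi 0))/=.
  have -> : pi 0 (AdP i h (lie Z V)) = lie Z V.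
    by rewrite F0 ?mem_filt0_g0// gr_comp_id.
  have -> : pi 0 (AdP i h (2^-1 *: lie Z (lie Z V))) = 0.
    have z1 : 2^-1 *: lie Z (lie Z V) \in gr 1 by rewrite memvZ ?lie_10.
    rewrite F0 ?mem_filt0_g1// gr_comp_eq0// gr_others0.
    exact: (subvP (addvSr _ _)).
  by rewrite addr0 subrK.
have := d; rewrite e dD -d' => /eqP; rewrite -subr_eq0 opprD addrA subrr sub0r oppr_eq0.
by move/eqP.
Qed.

End Difference.

(** Equivariance moves w to u at the cost of applying Ad_h to the arguments; by horizontality these
    may be replaced by their components in g_(-1). *)
Lemma curvature_vanishes_fibre u : (forall X Y, X \in gr (-1) -> Y \in gr (-1) -> kappa u X Y = 0) ->
  curvature_vanishes_at geo (p u).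
Proof.
move=> ku w X Y pw Xm Ym; have [h ->] := bact_trans (esym pw).
have modm V : V - pi (-1) V \in filt gr 0.
  by rewrite mem_filt0 (raddfB (pi (-1)))/= (gr_comp_id _ (gr_comp_mem gr (-1) V))// subrr.
rewrite -[LHS](AdPK i h) AdP_curvature (curvature_eql _ _ _ (modm _)) (curvature_eqr _ _ _ (modm _)).
by rewrite ku ?gr_comp_mem// linear0.
Qed.

End Final.

Theorem theorem4p5 (R : realType) (g : lieAlgType R) (gr : onegrading g)
    (n : nat) (G : lieGroupType R n) (L : lie_algebra_of G g)
    (k : nat) (P : lieGroupType R k) (i : parabolic_subgroup L gr P)
    (m N : nat) (M : manifoldType R m) (E : manifoldType R N)
    (geo : parabolic_geometry i M E) (torsion_free_geo : torsion_free geo)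
    (x : M) (s s' : partial_map M M)
    (sym_s : symmetry geo x s) (sym_s' : symmetry geo x s')
    (s_neq_s' : different_at x s s')
    (u : E) (Z : g) (u_over_x : bproj geo u = x) (Z_in_g1 : Z \in gr 1)
    (difference_uZ : difference geo x s s' (assoc geo u Z))
    (eigenvalue_condition :
       exists2 X : g, X \in gr (-1) &
       exists (r : nat) (a : r.-tuple R),
         ad_diagonalizable (lie X Z) (gr (-1)) a /\
         forall i1 i2 i3 i4 : 'I_r,
           tnth a i1 + tnth a i2 + tnth a i3 - tnth a i4 != 0) :
  weyl_curvature_vanishes_at geo x /\ curvature_vanishes_at geo x.
Proof.
have [phi [psi [sigma [Ups [cov cov' weyl phi_sigma [psi_sigma DE]]]]]] := difference_uZ.
set u1 := sigma (pi0 geo u).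
have p1 : pi0 geo u1 = pi0 geo u by case: weyl => sK _ _; apply: sK.
have pu1 : bproj geo u1 = x by rewrite -u_over_x; apply: pi0_bproj p1.
have su1 : sigma (pi0 geo u1) = u1 by rewrite p1.
have UZ : Ups (pi0 geo u1) = Z by rewrite p1; apply: assoc_inj (esym (DE u u_over_x)).
have [h phi_u] := cover_fibre sym_s cov pu1.
have [h' psi_u] := cover_fibre sym_s' cov' pu1.
have [V Vm [r [a [aV ea]]]] := eigenvalue_condition.
have del0 X Y : X \in gr (-1) -> Y \in gr (-1) -> delta geo u1 X Y (lie V Z) = 0.
  move=> Xm Ym; have d := delta_difference sym_s sym_s' cov cov' weyl phi_sigma psi_sigma pu1 su1
    phi_u psi_u torsion_free_geo Xm Ym Vm.
  rewrite UZ in d; rewrite lieC -scaleN1r -[_ *: _]addr0.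
  by rewrite delta_linear d scaler0 add0r delta_g1 ?mem0v.
pose w X Y := gr_comp gr 0 (curvature geo u1 X Y).
have w0 X Y : X \in gr (-1) -> Y \in gr (-1) -> w X Y = 0.
  apply: (invariant_bilinear_eq0 (gr := gr) aV ea).
  - by move=> y c z z'; rewrite /w curvature_linearl linearP.
  - by move=> y c z z'; rewrite /w curvature_linearr linearP.
  - by move=> z z' _ _; apply: gr_comp_mem.
  (* By equivariance, the vanishing derivative of kappa_0 along [V, Z] is its invariance under
     ad([V, Z]). *)
  - move=> z z' zm zm'; have VZ : lie V Z \in gr 0 by apply: lie_m1.
    have := del0 z z' zm zm'; rewrite (delta_g0 torsion_free_geo u1 zm zm' VZ).
    by move=> /eqP; rewrite subr_eq0 => /eqP ->.
have k0 X Y : X \in gr (-1) -> Y \in gr (-1) -> curvature geo u1 X Y = 0.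
  move=> Xm Ym; have [sP oP] := cover_smooth_omega cov pu1 h.
  apply: (fixed_curvature_eq0 torsion_free_geo (cover_fix phi_u) sP oP
    (cover_bproj sym_s cov pu1 phi_u) Xm Ym).
  exact: w0.
have kx : curvature_vanishes_at geo x by rewrite -pu1; apply: curvature_vanishes_fibre.
split=> // sigma' weyl' w' X Y pw Xm Ym.
by rewrite /weyl_curvature /curvature_comp kx ?linear0// (weyl_bproj _ weyl').
Qed.
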